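(* Let $a\in[0,1]$ be irrational and suppose that $a$ is badly approximable by rationals, in the sense that for any $\eta>0$ the inequality $d(ka,\mathbf Z)<|k|^{-1-\eta}$ has only finitely many solutions $k\in\mathbf Z$. Let $f:\mathbf R/\mathbf Z\to\mathbf R$ be a function whose Fourier coefficients $\hat f(k)$ satisfy $$\sup_{k\ne0}|k|^{1+\varepsilon}|\hat f(k)|<\infty\quad\text{for some }\varepsilon>0 .$$ Then, with $\sigma\ge0$ given by $$\sigma^2=\sigma^2(f)=m\big((f-m(f))^2\big)+2\sum_{n>0}m\big(fK^n(f-m(f))\big),$$ for every sequence $(a_n)$ of positive numbers with $a_n\to0$ and $na_n\to\infty$, the processes $W_n(t)=n^{-1/2}\sum_{i=1}^{[nt]}(f(\xi_i)-m(f))$, $t\in[0,1]$, satisfy the moderate deviation principle in $D([0,1])$ with speed $a_n$ and good rate function $I_\sigma$.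
   Context: $K$ is the Markov kernel on the torus $\mathbf R/\mathbf Z$ defined by $Kf(x)=\frac12(f(x+a)+f(x-a))$; $m$ is the Lebesgue-Haar probability on $\mathbf R/\mathbf Z$ (the unique $K$-invariant probability), $m(g)=\int g\,dm$; $(\xi_i)_{i\in\mathbf Z}$ is the stationary Markov chain with transition kernel $K$ and invariant distribution $m$. $d(x,\mathbf Z)$ is the distance from $x$ to the nearest integer. The functions $f$ considered are integrable with respect to $m$. $D([0,1])$ is the space of right-continuous functions on $[0,1]$ with left-hand limits, with the Skorohod topology. $(W_n)$ satisfies the moderate deviation principle (MDP) in $D([0,1])$ with speed $a_n$ and good rate function $I$ if $\{x: I(x)\le\alpha\}$ is compact for every $\alpha<\infty$ and, for every Borel set $\Gamma\subseteq D([0,1])$ with interior $\Gamma^0$ and closure $\bar\Gamma$, $$-\inf_{x\in\Gamma^0}I(x)\le\liminf_n a_n\log\mathbf P(\sqrt{a_n}\,W_n\in\Gamma)\le\limsup_n a_n\log\mathbf P(\sqrt{a_n}\,W_n\in\Gamma)\le-\inf_{x\in\bar\Gamma}I(x).$$ For $\sigma>0$, $I_\sigma(h)=\frac1{2\sigma^2}\int_0^1(h'(u))^2\,du$ if $h(0)=0$ and $h$ is absolutely continuous, and $I_\sigma(h)=\infty$ otherwise. For $\sigma=0$, $I_0(h)=0$ if $h\equiv0$ and $I_0(h)=\infty$ otherwise. $[\cdot]$ denotes the integer part. *)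

(* Defs.v *)
From HB Require Import structures.
From mathcomp Require Import all_boot all_order all_algebra.
From mathcomp Require Import all_classical all_reals all_analysis.
From mathcomp Require Import measurable_realfun.
From mathcomp Require Import complex.

Set Implicit Arguments.
Unset Strict Implicit.
Unset Printing Implicit Defensive.

Import Order.TTheory GRing.Theory Num.Theory.
Import numFieldNormedType.Exports.

Local Open Scope classical_set_scope.
Local Open Scope ring_scope.

Section torus.
Variable R : realType.
Local Open Scope quotient_scope.

Definition eq_modZ (x y : R) : bool := x - y \is a Num.int.

Lemma eq_modZ_refl : reflexive eq_modZ.
Proof. by move=> x; rewrite /eq_modZ subrr rpred0. Qed.

Lemma eq_modZ_sym : symmetric eq_modZ.
Proof. by move=> x y; rewrite /eq_modZ -opprB rpredN. Qed.

Lemma eq_modZ_trans : transitive eq_modZ.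
Proof.
by move=> y x z xy yz; rewrite /eq_modZ -(subrKA y) rpredD.
Qed.

Canonical eq_modZ_equiv :=
  EquivRel eq_modZ eq_modZ_refl eq_modZ_sym eq_modZ_trans.

Definition torus : Type := quotient_topology {eq_quot eq_modZ_equiv}.

HB.instance Definition _ := PointedTopological.on torus.
HB.instance Definition _ := Quotient.on torus.

Lemma torus_sigmaC (A : set torus) :
  <<s (@open torus) >> A -> <<s (@open torus) >> (~` A).
Proof. exact: sigma_algebraC. Qed.

HB.instance Definition _ := @isMeasurable.Build (sigma_display (@open torus))
  torus <<s (@open torus) >> (@sigma_algebra0 _ setT (@open torus))
  torus_sigmaC (@sigma_algebra_bigcup _ setT (@open torus)).

Definition torus_pi (x : R) : torus := \pi_torus x.

Lemma torus_piP (x y : R) : reflect (torus_pi x = torus_pi y) (eq_modZ x y).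
Proof. exact: eqquotP. Qed.

Lemma measurable_torus_pi : measurable_fun setT torus_pi.
Proof.
apply: (measurability (@open torus)) => //.
move=> _ [A oA <-]; rewrite setTI; apply: open_measurable.
by move/continuousP : (@pi_continuous R {eq_quot eq_modZ_equiv}); exact.
Qed.

Lemma torus_reprP (x : R) : repr (torus_pi x) - x \is a Num.int.
Proof. by apply/torus_piP; rewrite /torus_pi reprK. Qed.

Definition rot (a : R) (x : torus) : torus := torus_pi (repr x + a).

Lemma rot_pi (a x : R) : rot a (torus_pi x) = torus_pi (x + a).
Proof.
apply/torus_piP; rewrite /eq_modZ opprD addrACA subrr addr0.
exact: torus_reprP.
Qed.

Definition haar : set torus -> \bar R :=
  pushforward (mrestr lebesgue_measure (measurable_itv `[0%R, 1%R[)) torus_pi.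

Let haarE := measure_function_pushforward__canonical__measure_function_Measure
  (mrestr lebesgue_measure (measurable_itv `[0%R, 1%R[)) measurable_torus_pi.

HB.instance Definition _ := isMeasure.Build _ _ _ haar
  (measure0 haarE) (measure_ge0 haarE) (@measure_semi_sigma_additive _ _ _ haarE).

Lemma haar_setT : haar setT = 1%E.
Proof.
rewrite /haar /pushforward /mrestr preimage_setT setTI.
by rewrite lebesgue_measure_itv/= lte_fin ltr01 oppr0 adde0.
Qed.

HB.instance Definition _ := Measure_isProbability.Build _ _ _ haar haar_setT.

End torus.

Section kernel.
Variable R : realType.

Definition walk_kernel (a : R) (f : torus R -> R) : torus R -> R :=
  fun x => (f (rot a x) + f (rot (- a) x)) / 2.

Definition mean (f : torus R -> R) : R := \int[@haar R]_x f x.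

(* Complex-valued integrals are not in the library: this is the integral of
   f(x) e^{-2 i pi k x} split into its real and imaginary parts.  As k is an
   integer, the value at x does not depend on the representative of x. *)
Definition fourier_coef (f : torus R -> R) (k : int) : R[i] :=
  Complex
    (\int[@haar R]_x (f x * cos (2 * pi * k%:~R * repr x)))
    (- \int[@haar R]_x (f x * sin (2 * pi * k%:~R * repr x))).

Definition autocov (a : R) (f : torus R -> R) (n : nat) : R :=
  mean (fun x => f x * iter n (walk_kernel a) (fun y => f y - mean f) x).

Definition autocov_sum (a : R) (f : torus R -> R) (N : nat) : R :=
  \sum_(1 <= n < N) autocov a f n.

Definition asymptotic_variance (a : R) (f : torus R -> R) : R :=
  mean (fun x => (f x - mean f) ^+ 2) + 2 * limn (autocov_sum a f).

Definition dist_int (x : R) : R := inf [set `|x - z%:~R| | z in [set: int]].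

(* k = 0 never satisfies the inequality, since 0 `^ (- 1 - eta) = 0 here. *)
Definition badly_approximable (a : R) : Prop :=
  forall eta : R, 0 < eta ->
    finite_set [set k : int | dist_int (k%:~R * a) < `|k%:~R| `^ (- 1 - eta)].

End kernel.

Definition past d d' (Omega : measurableType d) (E : measurableType d')
    (xi : int -> Omega -> E) (i : int) : set (set Omega) :=
  <<s [set A | exists j : int, exists B : set E,
        [/\ j <= i, measurable B & A = xi j @^-1` B] ]>>.

(* The second clause says E(g(xi_{i+1}) | sigma(xi_j, j <= i)) = Qg(xi_i) for
   every bounded measurable g.  Together with the first one it determines the
   law of the chain, which is therefore invariant under the shift. *)
Definition stationary_markov_chain d d' (Omega : measurableType d)
    (E : measurableType d') (R : realType) (P : probability Omega R)
    (Q : (E -> R) -> (E -> R)) (mu : set E -> \bar R)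
    (xi : int -> {RV P >-> E}) : Prop :=
  (forall i B, measurable B -> distribution P (xi i) B = mu B) /\
  (forall i (g : E -> R) (A : set Omega),
    measurable_fun setT g -> bounded_fun g -> past xi i A ->
    \int[P]_(w in A) g (xi (i + 1) w) = \int[P]_(w in A) Q g (xi i w)).

(* A function on [0,1] is represented by its extension by 0 to the real line,
   so that equality in this type is equality on [0,1]. *)
Record cadlag (R : realType) := Cadlag {
  cadlag_fun :> R -> R ;
  cadlag_out : forall t, t \notin `[0, 1] -> cadlag_fun t = 0 ;
  cadlag_right : forall t, 0 <= t < 1 ->
    cadlag_fun s @[s --> t^'+] --> cadlag_fun t ;
  cadlag_left : forall t, 0 < t <= 1 -> cvg (cadlag_fun s @[s --> t^'-])
}.

Section cadlag_constructions.
Variable R : realType.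

Lemma scale_out (c : R) (h : cadlag R) t : t \notin `[0, 1] -> c * h t = 0.
Proof. by move=> /(@cadlag_out _ h _) ->; rewrite mulr0. Qed.

Lemma scale_right (c : R) (h : cadlag R) t : 0 <= t < 1 ->
  c * h s @[s --> t^'+] --> c * h t.
Proof. by move=> /(@cadlag_right _ h _) ht; apply: cvgMr. Qed.

Lemma scale_left (c : R) (h : cadlag R) t : 0 < t <= 1 ->
  cvg (c * h s @[s --> t^'-]).
Proof.
move=> /(@cadlag_left _ h _) /cvg_ex[l hl]; apply/cvg_ex.
by exists (c * l); apply: cvgMr.
Qed.

Definition cadlag_scale (c : R) (h : cadlag R) : cadlag R :=
  @Cadlag R (fun t => c * h t) (scale_out c h) (@scale_right c h)
    (@scale_left c h).

Definition step_fun (S : nat -> R) (n : nat) (t : R) : R :=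
  if t \in `[0, 1] then S (Num.truncn (n%:R * t)) else 0.

Variables (S : nat -> R) (n : nat).

Lemma step_out t : t \notin `[0, 1] -> step_fun S n t = 0.
Proof. by rewrite /step_fun => /negbTE ->. Qed.

Lemma step_right t : 0 <= t < 1 -> step_fun S n s @[s --> t^'+] --> step_fun S n t.
Proof.
move=> /andP[t0 t1]; apply: cvg_near_cst; near=> s.
have ts : t < s by near: s; exact: nbhs_right_gt.
have s1 : s <= 1 by near: s; exact: nbhs_right_le.
have nt0 : 0 <= n%:R * t by rewrite mulr_ge0.
have ns0 : 0 <= n%:R * s by rewrite mulr_ge0// (le_trans t0)// ltW.
rewrite /step_fun !in_itv/= t0 (ltW t1) s1 (le_trans t0 (ltW ts))/=.
congr (S _); apply/eqP; rewrite truncn_eq//; apply/andP; split.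
  by rewrite (@le_trans _ _ (n%:R * t))// ?truncn_le// ler_wpM2l// ltW.
near: s; apply: (@cvgr_lt _ _ _ _ (fun s => n%:R * s) (n%:R * t)).
  by apply: cvgMr; apply: cvg_within.
by rewrite truncnS_gt.
Unshelve. all: by end_near. Qed.

Lemma step_left t : 0 < t <= 1 -> cvg (step_fun S n s @[s --> t^'-]).
Proof.
move=> /andP[t0 t1]; have [n0|n0] := posnP n.
  apply/cvg_ex; exists (S 0%N); apply: cvg_near_cst; near=> s.
  have s0 : 0 < s by near: s; exact: nbhs_left_gt.
  have st : s < t by near: s; exact: nbhs_left_lt.
  rewrite /step_fun in_itv/= (ltW s0) (le_trans (ltW st) t1)/=.
  by rewrite n0 mul0r truncn0.
have nt0 : 0 < n%:R * t by rewrite mulr_gt0// ltr0n.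
have [k /andP[kt tk]] : exists k : nat, k%:R < n%:R * t <= k.+1%:R.
  have := truncn_itv (ltW nt0); set m := Num.truncn _ => /andP[].
  rewrite le_eqVlt => /orP[/eqP mt _|mt tm]; last first.
    by exists m; rewrite mt ltW.
  case: m mt => [|m] mt; first by rewrite -mt ltxx in nt0.
  by exists m; rewrite -mt lexx ltr_nat ltnSn.
apply/cvg_ex; exists (S k); apply: cvg_near_cst; near=> s.
have s0 : 0 < s by near: s; exact: nbhs_left_gt.
have st : s < t by near: s; exact: nbhs_left_lt.
rewrite /step_fun in_itv/= (ltW s0) (le_trans (ltW st) t1)/=.
congr (S _); apply/eqP; rewrite truncn_eq; last by rewrite mulr_ge0// ltW.
apply/andP; split; last by rewrite (lt_le_trans _ tk)// ltr_pM2l// ltr0n.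
apply/ltW; near: s.
apply: (@cvgr_gt _ _ _ _ (fun s => n%:R * s) (n%:R * t)) => //.
by apply: cvgMr; apply: cvg_within.
Unshelve. all: by end_near. Qed.

(* t |-> S_{[nt]} on [0,1] *)
Definition cadlag_step : cadlag R :=
  @Cadlag R (step_fun S n) step_out step_right step_left.

End cadlag_constructions.

Section skorohod.
Variable R : realType.

Definition time_change (l : R -> R) : Prop :=
  [/\ l 0 = 0, l 1 = 1, {in `[0, 1] &, {homo l : s t / s < t}} &
      {within `[0, 1], continuous l}].

Lemma time_change_itv l t : time_change l -> t \in `[0, 1] -> l t \in `[0, 1].
Proof.
move=> [l0 l1 ml _]; rewrite !in_itv/= => /andP[t0 t1].
have /le_mono_in mono := ml.
rewrite -{1}l0 -l1 !mono ?in_itv/= ?lexx ?ler01 ?t0 ?t1//.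
Qed.

Lemma time_change_surj l t : time_change l -> t \in `[0, 1] ->
  exists2 s, s \in `[0, 1] & l s = t.
Proof.
move=> [l0 l1 ml cl] t01.
by apply: (IVT _ cl) => //; rewrite l0 l1 /Num.min /Num.max ltr01.
Qed.

Lemma time_changeP l : l 0 = 0 -> l 1 = 1 ->
  {in `[0, 1] &, {homo l : s t / s < t}} ->
  (forall t, t \in `[0, 1] -> exists2 s, s \in `[0, 1] & l s = t) ->
  time_change l.
Proof.
move=> l0 l1 ml sl; split => //.
apply: segment_inc_surj_continuous; first exact: le_mono_in.
by rewrite l0 l1 => t /sl[s s01 <-]; exists s.
Qed.

Lemma time_change_id : time_change id.
Proof. by apply: time_changeP => // t t01; exists t. Qed.

Lemma time_change_comp l1 l2 : time_change l1 -> time_change l2 ->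
  time_change (l2 \o l1).
Proof.
move=> tl1 tl2; have [l10 l11 ml1 _] := tl1; have [l20 l21 ml2 _] := tl2.
apply: time_changeP => /=; rewrite ?l10 ?l11//.
- by move=> s t s01 t01 st; apply: ml2; rewrite ?time_change_itv// ml1.
- move=> t /(time_change_surj tl2)[s /(time_change_surj tl1)[r r01 <-] <-].
  by exists r.
Qed.

Lemma time_change_inv l : time_change l -> exists l', [/\ time_change l',
  forall t, t \in `[0, 1] -> l (l' t) = t &
  forall t, t \in `[0, 1] -> l' t \in `[0, 1]].
Proof.
move=> tl; have [l0 l1 ml _] := tl.
have /choice[l' l'P] : forall t, exists s,
    t \in `[0, 1] -> s \in `[0, 1] /\ l s = t.
  move=> t; have [t01|] := boolP (t \in `[0, 1]); last by exists 0.
  by have [s s01 <-] := time_change_surj tl t01; exists s.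
have l'01 t : t \in `[0, 1] -> l' t \in `[0, 1] by move=> /l'P[].
have l'K t : t \in `[0, 1] -> l (l' t) = t by move=> /l'P[].
have mono := le_mono_in ml.
have inj : {in `[0, 1] &, injective l} := inc_inj_in mono.
have i0 : (0 : R) \in `[0, 1] by rewrite in_itv/= lexx ler01.
have i1 : (1 : R) \in `[0, 1] by rewrite in_itv/= lexx ler01.
exists l'; split => //; apply: time_changeP.
- by apply: inj; rewrite ?l'01// l'K// l0.
- by apply: inj; rewrite ?l'01// l'K// l1.
- move=> s t s01 t01; rewrite -{1}(l'K _ s01) -{1}(l'K _ t01).
  by rewrite (leW_mono_in mono)// l'01.
- move=> t t01; exists (l t); first exact: time_change_itv.
  by apply: inj; rewrite ?l'01 ?l'K ?time_change_itv.
Qed.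

(* d(x, y) < e for the Skorohod metric
   d(x, y) = inf_l max(sup_t |l t - t|, sup_t |x t - y (l t)|),
   where l ranges over the time changes and t over [0,1]. *)
Definition skorohod_ball (x : cadlag R) (e : R) (y : cadlag R) : Prop :=
  exists2 l, time_change l &
    exists2 e', e' < e &
      forall t, t \in `[0, 1] -> `|l t - t| <= e' /\ `|x t - y (l t)| <= e'.

Lemma skorohod_ball_center x (e : R) : 0 < e -> skorohod_ball x e x.
Proof.
move=> e0; exists id; first exact: time_change_id.
by exists 0 => // t _; rewrite !subrr normr0.
Qed.

Lemma skorohod_ball_sym x y (e : R) :
  skorohod_ball x e y -> skorohod_ball y e x.
Proof.
move=> [l /time_change_inv[l' [tl' l'K l'01]] [e' e'e xy]].
exists l' => //; exists e' => // t t01.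
have [] := xy (l' t) (l'01 _ t01); rewrite l'K// => h1 h2.
by rewrite distrC h1 distrC h2.
Qed.

Lemma skorohod_ball_triangle x y z (e1 e2 : R) :
  skorohod_ball x e1 y -> skorohod_ball y e2 z -> skorohod_ball x (e1 + e2) z.
Proof.
move=> [l1 tl1 [d1 de1 h1]] [l2 tl2 [d2 de2 h2]].
exists (l2 \o l1); first exact: time_change_comp.
exists (d1 + d2); first exact: ltrD.
move=> t t01; have [a1 b1] := h1 _ t01.
have [a2 b2] := h2 _ (time_change_itv tl1 t01); split => /=.
  by rewrite -(subrKA (l1 t)) (le_trans (ler_normD _ _))// addrC lerD.
by rewrite -(subrKA (y (l1 t))) (le_trans (ler_normD _ _))// lerD.
Qed.

HB.instance Definition _ := gen_eqMixin (cadlag R).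
HB.instance Definition _ := gen_choiceMixin (cadlag R).
HB.instance Definition _ := isPointed.Build (cadlag R) (cadlag_step (fun=> 0) 0).
HB.instance Definition _ := hasNbhs.Build (cadlag R)
  (nbhs_ (entourage_ skorohod_ball)).
HB.instance Definition _ := Nbhs_isPseudoMetric.Build R (cadlag R) erefl
  skorohod_ball_center skorohod_ball_sym skorohod_ball_triangle erefl.

End skorohod.

Section mdp.
Variable R : realType.

Definition good_rate_function (I : cadlag R -> \bar R) : Prop :=
  forall alpha : R, compact [set x | (I x <= alpha%:E)%E].

Definition MDP d (Omega : measurableType d) (P : probability Omega R)
    (W : nat -> Omega -> cadlag R) (a : nat -> R) (I : cadlag R -> \bar R) :
    Prop :=
  let p (G : set (cadlag R)) (n : nat) : \bar R :=
    ((a n)%:E *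
     lne (P [set w | G (cadlag_scale (Num.sqrt (a n)) (W n w))]))%E in
  good_rate_function I /\
  (forall G : set (cadlag R), <<s (@open (cadlag R)) >> G ->
    [/\ (- ereal_inf (I @` G°) <= limn_einf (p G))%E,
        (limn_einf (p G) <= limn_esup (p G))%E &
        (limn_esup (p G) <= - ereal_inf (I @` closure G))%E]).

Definition absolutely_continuous01 (h : R -> R) : Prop :=
  forall e : R, 0 < e -> exists2 delta : R, 0 < delta &
    forall (n : nat) (u v : 'I_n -> R),
      (forall i, 0 <= u i <= v i /\ v i <= 1) ->
      trivIset setT (fun i => `]u i, v i[%classic) ->
      \sum_i (v i - u i) < delta -> \sum_i `|h (v i) - h (u i)| < e.

(* On [0,1] the derivative of an absolutely continuous h exists almost
   everywhere; its value on the remaining null set does not affect the integral. *)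
Definition rate (sigma : R) (h : cadlag R) : \bar R :=
  if sigma == 0 then
    if `[< forall t, t \in `[0, 1] -> h t = 0 >] then 0%E else +oo%E
  else
    if `[< h 0 = 0 /\ absolutely_continuous01 h >] then
      ((2 * sigma ^+ 2)^-1%:E *
       \int[lebesgue_measure]_(u in `[0%R, 1%R]) ((derive1 h u) ^+ 2)%:E)%E
    else +oo%E.

Definition partial_sum_process d (Omega : measurableType d) (f : torus R -> R)
    (xi : int -> Omega -> torus R) (n : nat) (w : Omega) : cadlag R :=
  cadlag_step
    (fun k => (Num.sqrt n%:R)^-1 *
              \sum_(1 <= i < k.+1) (f (xi i%:Z w) - mean f)) n.

End mdp.

(* Main.v *)
From HB Require Import structures.
Require Import Defs.
From mathcomp Require Import all_boot all_order all_algebra.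
From mathcomp Require Import all_classical all_reals all_analysis.
From mathcomp Require Import complex.
From mathcomp Require Import measurable_realfun ring lra zify.

Set Implicit Arguments.
Unset Strict Implicit.
Unset Printing Implicit Defensive.

Import Order.TTheory GRing.Theory Num.Theory.
Import numFieldNormedType.Exports.

Local Open Scope classical_set_scope.
Local Open Scope ring_scope.

(** The Fourier coefficients of f are O(|k|^(-1-eps)). As a is badly
approximable, the points k a, 0 < k < N, are separated on the circle by
N^(-1-e) for every e > 0, and the sum of the |f^(k)| / |sin (pi k a)| converges
([small_divisors]). An integrable function whose Fourier coefficients vanish is
null ([fourier_uniqueness]), so that f is almost everywhere the sum of its
absolutely convergent Fourier series ([fourier_expansion]), on which the kernel
K acts diagonally, with eigenvalues cos (2 pi k a). This computes the
autocovariances, and sigma^2 is the sum of the 2 (A_k^2 + B_k^2) cot^2 (pi k a),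
where A_k and B_k are the real Fourier coefficients, k > 0
([asymptotic_varianceE]). If sigma = 0 then f is almost everywhere constant and
the partial sums vanish ([degenerate_case], [MDP_degenerate]).

The Poisson equation f - m(f) = h - K h has the divisors
1 - cos (2 pi k a) = 2 sin^2 (pi k a), of which only the square root is
controlled: a bounded solution need not exist. The idea is to solve the equation
approximately, by the resolvent h_n of K at 1 + 1/(n+1). It satisfies
|h_n| <= C sqrt n and solves the equation up to C / sqrt n, so that over n steps
the partial sum differs from a martingale by O(sqrt n), which is negligible in
moderate deviations. The differences of this martingale are D_n or - D_n,
according to the step of the walk, where D_n is bounded and converges uniformly,
since sin (2 pi k a) / (2 sin^2 (pi k a)) is of order 1 / |sin (pi k a)| only.
Up to eta, the square of D_n is a trigonometric polynomial, that is, the sum of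
its mean, close to sigma^2, and of a coboundary u - K u with u bounded
([martingale_approximation]).

By the Markov property ([markov_step]) exponential functionals of the chain are
integrated one step at a time. The coboundary added to the exponent at second
order makes the conditional Laplace transform of each step constant up to eta
([two_point_exponential]), and the increments of the martingale over successive
blocks have almost Gaussian Laplace transforms ([martingale_blocks]); stopping
the exponential gives a maximal inequality ([maximal_martingale]).

Large deviations follow from these two estimates in general
([MDP_of_estimates]). The Laplace transforms give the large deviations of the
increments on a finite grid, by Chernoff bounds for the upper bound and by
tilting for the lower one ([ldp_upper], [ldp_lower]). The maximal inequality
makes the path close to the polygon through its values on the grid, except with
a probability that is negligible at the speed considered. The rate function is
handled through a bound on the increments of a path that is equivalent to a bound
on its energy ([energy_le_rate]), because absolutely continuous functions are
primitives of their derivatives ([absolutely_continuous01_density]). In this form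
the level sets are compact ([compact_energy_le]), and polygons have the energy
that is read on the grid ([polygonal_approximation]). *)

(** * Absolutely continuous functions as primitives *)

Section absolute_continuity.
Variable R : realType.
Implicit Types (h : R -> R) (J : finType).
Local Notation mu := (@lebesgue_measure R).

(** The families of intervals that define absolute continuity are numbered; the
points of several subdivisions at once are numbered by pairs. *)
Lemma absolutely_continuous01_fin h : absolutely_continuous01 h ->
  forall e : R, 0 < e -> exists2 delta : R, 0 < delta &
    forall J (u v : J -> R),
      (forall i, 0 <= u i <= v i /\ v i <= 1) ->
      trivIset setT (fun i => `]u i, v i[%classic) ->
      \sum_i (v i - u i) < delta -> \sum_i `|h (v i) - h (u i)| < e.
Proof.
move=> ach e e0; have [dl dl0 H] := ach e e0; exists dl => // J u v uv tuv s.
have E (F : J -> R) : \sum_i F i = \sum_(j < #|J|) F (enum_val j).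
  by rewrite (reindex (@enum_val J predT))//; exists enum_rank => i _; [exact: enum_valK|exact: enum_rankK].
rewrite E; apply: (H _ (u \o enum_val) (v \o enum_val)) => /=.
- by move=> i; exact: uv.
- move=> i j _ _ ij; apply: enum_val_inj; exact: (tuv _ _ I I).
- by rewrite -(E (fun i => v i - u i)).
Qed.

(** A bound on all the sums of elements of the A i bounds the sum of the suprema:
pick elements that are optimal up to a small error. *)
Lemma sum_ereal_sup_le n (A : 'I_n -> set R) (e : R) :
  (forall i, A i !=set0) -> (forall i x, A i x -> 0 <= x) ->
  (forall x : 'I_n -> R, (forall i, A i (x i)) -> \sum_i x i <= e) ->
  (\sum_i ereal_sup [set x%:E | x in A i] <= e%:E)%E.
Proof.
move=> A0 Age0 H; have [x0 Ax0] := choice A0.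
have ubA i : has_ubound (A i).
  exists e => x Aix; pose y j := if j == i then x else x0 j.
  have /H : forall j, A j (y j) by move=> j; rewrite /y; case: eqP => [->|].
  rewrite (bigD1 i)//= {1}/y eqxx; apply: le_trans; rewrite lerDl.
  apply: sumr_ge0 => j _; rewrite /y.
  by case: ifP => _; [exact: Age0 Aix|exact: Age0 (Ax0 j)].
have -> : (\sum_i ereal_sup [set x%:E | x in A i] = (\sum_i sup (A i))%:E)%E.
  rewrite -sumEFin; apply: eq_bigr => i _.
  by rewrite ereal_sup_EFin.
rewrite lee_fin; apply/ler_addgt0Pr => _/posnumP[eta].
have /choice[x Hx] : forall i, exists x, A i x /\ sup (A i) - eta%:num / n.+1%:R < x.
  move=> i; have [] := @sup_adherent R (A i) (eta%:num / n.+1%:R).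
  - by rewrite divr_gt0.
  - by split.
  - by move=> x Ax xs; exists x.
have := H x (fun i => (Hx i).1); rewrite -(lerD2r eta%:num); apply: le_trans.
apply: (@le_trans _ _ (\sum_i (x i + eta%:num / n.+1%:R))).
  by apply: ler_sum => i _; rewrite -lerBlDr ltW// (Hx i).2.
rewrite big_split/= lerD2l sumr_const card_ord -(mulr_natl (_ / _)) mulrA ler_pdivrMr// mulrC.
by rewrite ler_pM2l// ler_nat.
Qed.

(** Absolute continuity passes from the increments of h to its variation, since
the subintervals of all the subdivisions form one family with the same length. *)
Lemma total_variation_small h : absolutely_continuous01 h ->
  forall e : R, 0 < e -> exists2 delta : R, 0 < delta &
    forall n (u v : 'I_n -> R),
      (forall i, 0 <= u i <= v i /\ v i <= 1) ->
      trivIset setT (fun i => `]u i, v i[%classic) ->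
      \sum_i (v i - u i) < delta ->
      (\sum_i total_variation (u i) (v i) h <= e%:E)%E.
Proof.
move=> ach e e0; have [dl dl0 H] := absolutely_continuous01_fin ach e0.
exists dl => // n u v uv tuv s; apply: sum_ereal_sup_le.
- move=> i; have [/andP[_ +] _] := uv i; rewrite le_eqVlt => /predU1P[->|].
    by rewrite variationsxx; exists 0.
  exact: variations_neq0.
- by move=> i _ [s' _ <-]; exact: variation_ge0.
move=> x /= xv.
have /choice[p Hp] : forall i, exists p, itv_partition (u i) (v i) p /\
    variation (u i) (v i) h p = x i.
  by move=> i; have [p ? ?] := xv i; exists p.
have {}pathp i : path <%O (u i) (p i) by have [[]] := Hp i.
pose U (k : {i : 'I_n & 'I_(size (p i))}) :=
  nth (v (tag k)) (u (tag k) :: p (tag k)) (tagged k).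
pose V (k : {i : 'I_n & 'I_(size (p i))}) :=
  nth (v (tag k)) (u (tag k) :: p (tag k)) (tagged k).+1.
have UVE F : \sum_k F (U k) (V k) =
    \sum_i \sum_(0 <= j < size (p i))
      F (nth (v i) (u i :: p i) j) (nth (v i) (u i :: p i) j.+1) :> R.
  rewrite /= (eq_bigr (fun i => \sum_(j < size (p i))
    F (nth (v i) (u i :: p i) j) (nth (v i) (u i :: p i) j.+1))).
    by rewrite sig_big_dep/=; apply: eq_bigr => -[i j].
  by move=> i _; rewrite big_mkord.
have incr i j k : (j <= k)%N -> (k <= size (p i))%N ->
    nth (v i) (u i :: p i) j <= nth (v i) (u i :: p i) k.
  move=> jk ks.
  have sp : sorted <=%O (u i :: p i).
    by apply: (sub_sorted (fun _ _ => @ltW _ _ _ _)) => /=; exact: pathp.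
  by apply: (sorted_leq_nth le_trans lexx) => //; rewrite inE/= ltnS// (leq_trans jk).
have leU k : u (tag k) <= U k.
  by have := @incr (tag k) 0%N (tagged k); apply=> //; rewrite ltnW.
have leV k : V k <= v (tag k).
  have [[_ /eqP <-] _] := Hp (tag k).
  by rewrite (last_nth (v (tag k))); apply: incr => //; exact: ltn_ord.
have UV k : U k <= V k by apply: incr => //; exact: ltn_ord.
have := H _ U V; have -> : \sum_i `|h (V i) - h (U i)| = \sum_i x i.
  rewrite (UVE (fun a b => `|h b - h a|)); apply: eq_bigr => i _.
  by have [_ <-] := Hp i.
move=> HH; apply/ltW/HH.
- move=> k; rewrite UV andbT (le_trans _ (leU k)) ?(le_trans (leV k))//.
    by have [] := uv (tag k).
  by have [/andP[]] := uv (tag k).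
- move=> [i j] [i' j'] _ _ [z []] /=; rewrite !in_itv/= => /andP[z1 z2] /andP[z3 z4].
  have ii' : i = i'.
    apply: (tuv _ _ I I); exists z; split; rewrite /= in_itv/=.
      by rewrite (le_lt_trans (leU _) z1)/= (lt_le_trans z2 (leV _)).
    by rewrite (le_lt_trans (leU _) z3)/= (lt_le_trans z4 (leV _)).
  subst i'; congr (existT _ _ _); apply/val_inj => /=; apply/eqP.
  rewrite eqn_leq leqNgt andbC leqNgt; apply/andP; split; apply/negP => jj.
    have := incr i _ _ jj (ltnW (ltn_ord j')).
    by rewrite leNgt (lt_trans z3 z2).
  have := incr i _ _ jj (ltnW (ltn_ord j)).
  by rewrite leNgt (lt_trans z1 z4).
- rewrite (UVE (fun a b => b - a)); apply: le_lt_trans s.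
  apply: ler_sum => i _; rewrite telescope_sumr//=.
  have [[_ /eqP lp] _] := Hp i; rewrite lerD2r.
  by rewrite -[in leRHS]lp (last_nth (v i)).
Qed.

(** On an interval shorter than the delta that absolute continuity gives for 1 the
variation is at most 1, and finitely many such intervals cover [0, 1]. *)
Lemma absolutely_continuous01_BV h : absolutely_continuous01 h ->
  bounded_variation 0 1 h.
Proof.
move=> ach; apply/bounded_variationP => //.
have [dl dl0 H] := total_variation_small ach ltr01.
have small s t : 0 <= s -> s <= t -> t <= 1 -> t - s < dl -> 
    (total_variation s t h <= 1%:E)%E.
  move=> s0 st t1 std; have := H 1%N (fun=> s) (fun=> t).
  rewrite !big_ord1; apply=> //; first by rewrite s0 st.
  by move=> i j; rewrite !ord1.
pose m := (Num.truncn dl^-1).+1.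
have m0 : 0 < m%:R :> R by rewrite ltr0n.
have md : m%:R^-1 < dl.
  by rewrite invf_plt ?posrE// truncnS_gt// invr_ge0 ltW.
suff K (k : nat) : (k <= m)%N -> (total_variation 0 (k%:R / m%:R) h <= k%:R%:E)%E.
  have := K m (leqnn _); rewrite divff ?gt_eqF// => {}K.
  by rewrite ge0_fin_numE ?total_variation_ge0// (le_lt_trans K)// ltry.
elim: k => [_|k IH km]; first by rewrite mul0r total_variationxx.
have kk : k%:R / m%:R <= k.+1%:R / m%:R :> R by rewrite ler_pM2r ?invr_gt0// ler_nat.
rewrite (@total_variationD _ _ _ (k%:R / m%:R))//.
rewrite -[X in (_ <= X%:E)%E]natr1 EFinD leeD//; first by apply: IH; exact: ltnW.
apply: small => //.
  by rewrite ler_pdivrMr// mul1r ler_nat.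
by rewrite -mulrBl -natrB ?leqnSn// subSnn mul1r.
Qed.

(** The components of an open set come without their endpoints; the half-open
intervals, on which Stieltjes measures are computed, enclose them. *)
Lemma open_itv_sandwich (J : set R) (c : R) : open J -> is_interval J -> J !=set0 ->
  (forall x y, J x -> J y -> y - x <= c) ->
  exists a b, [/\ a <= b, `]a, b[ `<=` J & J `<=` `]a, b]].
Proof.
move=> oJ iJ J0 bJ; have [z Jz] := J0.
have hs : has_sup J.
  split=> //; exists (z + c) => x Jx; have := bJ _ _ Jz Jx.
  by rewrite lerBlDl.
have hi : has_inf J.
  split=> //; exists (z - c) => x Jx; have := bJ _ _ Jx Jz.
  by rewrite lerBlDr lerBlDl.
exists (inf J), (sup J); split.
- by rewrite (@le_trans _ _ z)// ?ge_inf//; [exact: hi.2|exact: (ub_le_sup hs.2)].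
- move=> t; rewrite /= in_itv/= => /andP[it ts].
  have [x Jx xt] : exists2 x, J x & x < t.
    have := @inf_adherent _ _ (t - inf J) _ hi; rewrite subr_gt0 => /(_ it).
    by rewrite addrC subrK.
  have [y Jy ty] : exists2 y, J y & t < y.
    have := @sup_adherent _ _ (sup J - t) _ hs; rewrite subr_gt0 => /(_ ts).
    by rewrite subKr.
  by apply: (iJ x y) => //; rewrite !ltW.
- move=> x Jx /=; rewrite in_itv/= (ub_le_sup hs.2)// andbT.
  move: (oJ _ Jx) => [e /= e0 He].
  have Jy : J (x - e / 2).
    apply: He => /=; rewrite opprB addrC subrK gtr0_norm ?divr_gt0//.
    by rewrite ltr_pdivrMr// ltr_pMr// ltr1n.
  by rewrite (le_lt_trans (ge_inf hi.2 Jy))// gtrBl divr_gt0.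
Qed.

Let small_increments (G : R -> R) := forall e : R, 0 < e -> exists2 delta : R, 0 < delta &
    forall n (u v : 'I_n -> R), (forall i, u i <= v i) ->
      trivIset setT (fun i => `]u i, v i[%classic) ->
      \sum_i (v i - u i) < delta -> \sum_i (G (v i) - G (u i)) <= e.

(** A Lebesgue null set lies in an open set of measure less than delta. The
Stieltjes measure of the latter is the sum of the increments of G over its
components, of total length less than delta: it is at most e. *)
Lemma lebesgue_stieltjes_dominated (G : cumulativeBounded (0 : R) (1 : R)) :
  small_increments G -> lebesgue_stieltjes_measure G `<< mu.
Proof.
move=> smallG; apply/null_content_dominatesP => A mA A0.
pose nu := lebesgue_stieltjes_measure G.
apply/eqP; rewrite eq_le measure_ge0 andbT; apply/lee_addgt0Pr => e e0; rewrite add0e.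
have [dl dl0 Hdl] := smallG e e0.
have [U [oU AU UA]] : exists U : set R, [/\ open U, A `<=` U & (mu (U `\` A) < dl%:E)%E].
  by apply: lebesgue_regularity_outer => //; rewrite A0 ltry.
have mU : measurable U by exact: open_measurable.
have {UA}muU : (mu U < dl%:E)%E.
  rewrite -(setDUK AU) measureU//; last by rewrite setDIK.
  - by rewrite [X in (X + _)%E]A0 add0e.
  - exact: measurableD.
pose J := open_disjoint_itv oU.
have mJ i : measurable (J i) by apply: open_measurable; exact: open_disjoint_itv_open.
have JU i : J i `<=` U.
  by rewrite [X in _ `<=` X](open_disjoint_itv_bigcup oU); exact: bigcup_sup.
have tJ : trivIset setT J by exact: open_disjoint_itv_trivIset.
have /choice[a /choice[b Hab]] : forall i, exists a b, [/\ a <= b,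
    `]a, b[ `<=` J i & J i `<=` `]a, b]].
  move=> i; have [J0|/set0P J0] := eqVneq (J i) set0.
    by exists 0, 0; split => //; rewrite ?J0// set_itv_ge ?bnd_simp// sub0set.
  apply: (@open_itv_sandwich _ dl); [exact: open_disjoint_itv_open
    |exact: open_disjoint_itv_is_interval|by []|].
  move=> x y Jx Jy; rewrite leNgt; apply/negP => dxy.
  have : (mu `[x, y] <= mu U)%E.
    apply: le_measure; rewrite ?inE// => t /=; rewrite in_itv/= => xty.
    by apply: (JU i); exact: (open_disjoint_itv_is_interval Jx Jy).
  have xy : x < y by rewrite -subr_gt0 (lt_trans dl0).
  rewrite lebesgue_measure_itv/= lte_fin xy -EFinD => /le_lt_trans/(_ muU).
  by rewrite lte_fin ltNge (ltW dxy).
have tab : trivIset setT (fun i => `]a i, b i[%classic).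
  move=> i j _ _ [t [ti tj]]; have [_ ai _] := Hab i; have [_ aj _] := Hab j.
  by apply: tJ => //; exists t; split; [exact: ai|exact: aj].
apply: (@le_trans _ _ (nu U)); first by apply: le_measure; rewrite ?inE.
have -> : nu U = nu (\bigcup_i J i) by congr (nu _); exact: open_disjoint_itv_bigcup.
rewrite /nu measure_bigcup//; last by move=> i _; exact: mJ.
apply: lime_le; first by apply: is_cvg_nneseries => *; exact: measure_ge0.
apply: nearW => n.
apply: (@le_trans _ _ (\sum_(i < n) (G (b i) - G (a i)))%:E).
  rewrite -sumEFin big_mkord; under eq_bigl do rewrite in_setT.
  apply: lee_sum => i _; have [ab _ Ji] := Hab i.
  apply: (@le_trans _ _ (nu `]a i, b i]%classic)).
    apply: le_measure => //; rewrite inE; first exact: mJ.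
    by apply: sub_sigma_algebra; exact: is_ocitv.
  rewrite /nu/= /lebesgue_stieltjes_measure/measure_extension.
  rewrite measurable_mu_extE/=; last exact: is_ocitv.
  by rewrite wlength_itv_bnd.
rewrite lee_fin; apply: Hdl => //.
- by move=> i; have [] := Hab i.
- by move=> i j _ _ /(tab i j I I)/val_inj.
rewrite -lte_fin; apply: le_lt_trans muU.
rewrite -sumEFin [leLHS](_ : _ = \sum_(i < n) mu `]a i, b i[%classic)%E; last first.
  apply: eq_bigr => i _; have [+ _ _] := Hab i.
  rewrite lebesgue_measure_itv/= lte_fin le_eqVlt => /predU1P[->|->].
    by rewrite subrr ltxx.
  by rewrite EFinB.
rewrite -(measure_bigsetU_ord mu xpredT) //=; last first.
  by move=> i j _ _ /(tab i j I I)/val_inj.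
apply: le_measure; rewrite ?inE//.
  by apply: bigsetU_measurable.
rewrite -(bigcup_mkord n (fun i => `]a i, b i[%classic)) => t [i _] ti; apply: (JU i).
by have [_ + _] := Hab i; apply.
Qed.

(** Radon-Nikodym: the density of the Stieltjes measure of G. *)
Lemma density_of_small_increments (G : R -> R) : {homo G : x y / x <= y} ->
  (forall x, x <= 0 -> G x = 0) -> (forall x, 1 <= x -> G x = 1) ->
  small_increments G ->
  exists2 g : R -> R, mu.-integrable setT (EFin \o g) &
    forall t, 0 <= t -> G t = \int[mu]_(x in `]0, t]) g x.
Proof.
move=> ndG G0 G1 smallG.
have rcG : right_continuous G.
  move=> x; apply/cvgrPdist_le => e e0; have [dl dl0 H] := smallG e e0.
  near=> y.
  have xy : x < y by near: y; exact: nbhs_right_gt.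
  have yd : y - x < dl by rewrite ltrBlDl; near: y; apply: nbhs_right_lt; rewrite ltrDl.
  have := H 1%N (fun=> x) (fun=> y); rewrite !big_ord1 => HH.
  rewrite distrC ger0_norm ?subr_ge0 ?ndG ?(ltW xy)//; apply: HH => //.
  by move=> i j ? ? ?; rewrite !ord1.
have cNy : G @ -oo --> (0 : R).
  apply: cvg_near_cst; near=> x; apply: G0; near: x.
  exact: nbhs_ninfty_le.
have cy : G @ +oo --> (1 : R).
  apply: cvg_near_cst; near=> x; apply: G1; near: x.
  exact: nbhs_pinfty_ge.
pose G' : cumulativeBounded (0 : R) (1 : R) := HB.pack G
  (isCumulative.Build R _ R G ndG rcG) (isCumulativeBounded.Build R 0 1 G cNy cy).
have [f [f0 ffin fint fE]] := radon_nikodym_sigma_finite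
  (@lebesgue_stieltjes_dominated G' smallG).
have fineK x : (fine (f x))%:E = f x by rewrite fineK.
exists (fine \o f).
  by apply: eq_integrable fint => // x _ /=; rewrite fineK.
move=> t t0; rewrite /Rintegral; under eq_integral do rewrite /= fineK.
rewrite -fE; last by apply: sub_sigma_algebra; exact: is_ocitv.
rewrite /=/lebesgue_stieltjes_measure /measure_extension.
rewrite measurable_mu_extE/=; last exact: is_ocitv.
by rewrite wlength_itv_bnd//= (G0 0)// subr0.
Unshelve. all: by end_near. Qed.

(** Projection on [0, 1]: composed with it, a function on [0, 1] becomes constant
outside, and normalized by V 1 it is the distribution function of a
probability. *)
Let clamp (x : R) : R := Num.min 1 (Num.max 0 x).

Let clampE x : clamp x = if x <= 0 then 0 else if x <= 1 then x else 1.
Proof.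
rewrite /clamp; case: (leP x 0) => x0; first by rewrite min_r.
by case: (leP x 1).
Qed.

Let clamp_itv x : 0 <= clamp x <= 1.
Proof. by rewrite clampE; case: (leP x 0) => ?; case: (leP x 1) => ?; lra. Qed.

Let clamp_id x : 0 <= x <= 1 -> clamp x = x.
Proof. by rewrite clampE; case: (leP x 0) => ?; case: (leP x 1) => ?; lra. Qed.

Let clamp_homo x y : x <= y -> clamp x <= clamp y.
Proof.
rewrite !clampE; case: (leP x 0) => ?; case: (leP x 1) => ?;
case: (leP y 0) => ?; case: (leP y 1) => ?; lra.
Qed.

Let clamp_lip x y : x <= y -> clamp y - clamp x <= y - x.
Proof.
rewrite !clampE; case: (leP x 0) => ?; case: (leP x 1) => ?;
case: (leP y 0) => ?; case: (leP y 1) => ?; lra.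
Qed.

Let clamp_in x y z : clamp x < z < clamp y -> x < z < y.
Proof.
rewrite !clampE; case: (leP x 0) => ?; case: (leP x 1) => ?;
case: (leP y 0) => ?; case: (leP y 1) => ?; lra.
Qed.

Lemma density_nondecreasing (V : R -> R) :
  (forall s t, 0 <= s -> s <= t -> t <= 1 -> V s <= V t) ->
  V 0 = 0 -> 0 < V 1 ->
  (forall e : R, 0 < e -> exists2 delta : R, 0 < delta &
    forall n (u v : 'I_n -> R), (forall i, 0 <= u i <= v i /\ v i <= 1) ->
      trivIset setT (fun i => `]u i, v i[%classic) ->
      \sum_i (v i - u i) < delta -> \sum_i (V (v i) - V (u i)) <= e) ->
  exists2 g : R -> R, mu.-integrable setT (EFin \o g) &
    forall t, 0 <= t <= 1 -> V t = \int[mu]_(x in `]0, t]) g x.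
Proof.
move=> ndV V0 V1 smallV.
pose G x := V (clamp x) / V 1.
have [|||e e0|g gint gE] := @density_of_small_increments G.
- move=> x y xy; rewrite ler_pM2r ?invr_gt0//.
  by have /andP[? ?] := clamp_itv x; have /andP[? ?] := clamp_itv y; apply: ndV => //; exact: clamp_homo.
- by move=> x x0; rewrite /G /clamp max_l// min_r// V0 mul0r.
- by move=> x x1; rewrite /G /clamp max_r ?(le_trans ler01)// min_l// divff ?gt_eqF.
- have [dl dl0 H] := smallV (e * V 1) (mulr_gt0 e0 V1).
  exists dl => // n u v uv tuv s.
  rewrite -(ler_pM2r V1); apply: le_trans (H n (clamp \o u) (clamp \o v) _ _ _).
  + rewrite mulr_suml; apply: ler_sum => i _ /=.
    by rewrite mulrBl !divfK ?gt_eqF.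
  + move=> i /=; have /andP[-> _] := clamp_itv (u i); have /andP[_ ->] := clamp_itv (v i).
    by rewrite clamp_homo.
  + move=> i j _ _ [z [/= /clamp_in zi /clamp_in zj]].
    by apply: (tuv i j I I); exists z.
  + by apply: le_lt_trans s; apply: ler_sum => i _; exact: clamp_lip.
exists (fun x => V 1 * g x).
  have := integrableZl measurableT (V 1) gint.
  by apply: eq_integrable.
move=> t /[dup] t01 /andP[t0 t1]; rewrite RintegralZl//; last exact: integrableS gint.
by rewrite -gE// /G clamp_id// mulrC divfK ?gt_eqF.
Qed.

(** Both V and V + h - h 0, where V t is t plus the variation of h on [0, t], are
nondecreasing with small increments, so that they are primitives; h is their
difference. The summand t makes them nonzero at 1 even for a constant h. *)
Lemma absolutely_continuous01_density h : absolutely_continuous01 h ->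
  exists2 g : R -> R, mu.-integrable setT (EFin \o g) &
    forall t, 0 <= t <= 1 -> h t - h 0 = \int[mu]_(x in `]0, t]) g x.
Proof.
move=> ach; have bvh := absolutely_continuous01_BV ach.
have small := total_variation_small ach.
have TVfin s t : 0 <= s -> s <= t -> t <= 1 -> total_variation s t h \is a fin_num.
  move=> s0 st t1; apply/(bounded_variationP _ st).
  exact: (bounded_variationr s0 st (bounded_variationl (le_trans s0 st) t1 bvh)).
pose TV t := fine (total_variation 0 t h).
have TV0 : TV 0 = 0 by rewrite /TV total_variationxx.
have TVB s t : 0 <= s -> s <= t -> t <= 1 -> TV t - TV s = fine (total_variation s t h).
  move=> s0 st t1; rewrite /TV (total_variationD h s0 st) fineD ?TVfin//.
    by rewrite addrC addKr.
  by rewrite (le_trans st).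
have hTV s t : 0 <= s -> s <= t -> t <= 1 -> `|h t - h s| <= TV t - TV s.
  move=> s0 st t1; rewrite TVB//.
  have := @total_variation_ge _ _ _ h st.
  by rewrite -{1}(fineK (TVfin s t s0 st t1)) lee_fin.
have smallTV : forall e : R, 0 < e -> exists2 delta : R, 0 < delta &
    forall n (u v : 'I_n -> R), (forall i, 0 <= u i <= v i /\ v i <= 1) ->
      trivIset setT (fun i => `]u i, v i[%classic) ->
      \sum_i (v i - u i) < delta -> \sum_i (TV (v i) - TV (u i)) <= e.
  move=> e e0; have [dl dl0 H] := small e e0; exists dl => // n u v uv tuv s.
  have := H n u v uv tuv s; rewrite -lee_fin -sumEFin; apply: le_trans.
  apply: lee_sum => i _; have [/andP[? ?] ?] := uv i.
  by rewrite TVB// fineK ?TVfin.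
have dens (c : R) : `|c| <= 1 -> exists2 g : R -> R, mu.-integrable setT (EFin \o g) &
    forall t, 0 <= t <= 1 -> TV t + t + c * (h t - h 0) = \int[mu]_(x in `]0, t]) g x.
  move=> c1; apply: density_nondecreasing.
  - move=> s t s0 st t1; have hh := hTV s t s0 st t1.
    have : `|c * (h t - h s)| <= TV t - TV s.
      by rewrite normrM (le_trans _ hh)// ler_piMl.
    by rewrite ler_norml => /andP[]; lra.
  - by rewrite TV0 subrr mulr0 !addr0.
  - have hh := hTV 0 1 (lexx _) ler01 (lexx _).
    have : `|c * (h 1 - h 0)| <= TV 1 - TV 0.
      by rewrite normrM (le_trans _ hh)// ler_piMl.
    by rewrite ler_norml => /andP[]; lra.
  - move=> e e0; have e30 : 0 < e / 3 by rewrite divr_gt0.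
    have [dl dl0 H] := smallTV _ e30.
    exists (Num.min dl (e / 3)); first by rewrite lt_min dl0.
    move=> n u v uv tuv; rewrite lt_min => /andP[/(H n u v uv tuv) H1 H2].
    rewrite (_ : e = e / 3 + e / 3 + e / 3); last by field.
    apply: le_trans (lerD (lerD H1 (ltW H2)) H1); rewrite -!big_split/=.
    apply: ler_sum => i _; have [/andP[? ?] ?] := uv i.
    have hh := hTV (u i) (v i) _ _ _.
    have : `|c * (h (v i) - h (u i))| <= TV (v i) - TV (u i).
      by rewrite normrM (le_trans _ (hh _ _ _))// ler_piMl.
    by rewrite ler_norml => /andP[]; lra.
have [g1 i1 E1] := dens 1 ltac:(by rewrite normr1).
have [g0 i0 E0] := dens 0 ltac:(by rewrite normr0).
exists (g1 \- g0); first by have := integrableB measurableT i1 i0; apply: eq_integrable.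
move=> t t01; rewrite RintegralB//; [|exact: integrableS i1|exact: integrableS i0].
by rewrite -E1// -E0//; lra.
Qed.

End absolute_continuity.

(** * The rate function as a bound on the energy *)

Section null_sets.
Context d (T : measurableType d) (R : realType) (m : {measure set T -> \bar R}).
Local Open Scope ereal_scope.
Import HBNNSimple.

(** The derivative of an absolutely continuous function is only controlled off a
null set, and its measurability is not at hand: the comparison is made on the
simple functions below f, which may be set to zero on N. *)
Lemma ge0_le_integral_off_null (D N : set T) (f g : T -> \bar R) :
  measurable N -> m N = 0 ->
  (forall x, D x -> 0 <= f x) -> (forall x, D x -> 0 <= g x) ->
  (forall x, D x -> ~ N x -> f x <= g x) ->
  \int[m]_(x in D) f x <= \int[m]_(x in D) g x.
Proof.
move=> mN N0 f0 g0 fg; rewrite (ge0_integralE _ f0) (ge0_integralE _ g0).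
apply: ge_ereal_sup => _ [h /= hf <-].
have mNC : measurable (~` N) by exact: measurableC.
pose h' := proj_nnsfun h mNC.
have -> : sintegral m h = sintegral m h'.
  rewrite -!integralT_nnsfun; apply: ae_eq_integral => //.
  - by apply/measurable_EFinP.
  - by apply/measurable_EFinP.
  - exists N; split => // x /= /not_implyP[_]; apply: contra_notP => Nx.
    by rewrite /h'/= mindicE mem_set// mulr1.
apply: ereal_sup_ubound; exists h' => // x /=; rewrite mindicE.
have := hf x; rewrite !patchE; case: ifPn => [/set_mem Dx|_] hx.
  have [Nx|Nx] := pselect (N x).
    by rewrite memNset ?mulr0 ?g0//; exact.
  by rewrite mem_set// mulr1 (le_trans hx)// fg.
apply: le_trans hx; rewrite lee_fin.
by case: (_ \in _); rewrite ?mulr1// mulr0.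
Qed.

End null_sets.

Section increments.
Variable R : realType.

(** By induction on the number of intervals: remove the nondegenerate one whose
right end is last, the others lie before its left end. *)
Lemma sum_increments_disjoint (phi : R -> R) (n : nat) (u v : 'I_n -> R) (p q : R) :
  (forall s t, p <= s -> s <= t -> t <= q -> phi s <= phi t) ->
  (forall i, p <= u i /\ u i <= v i /\ v i <= q) ->
  trivIset setT (fun i => `]u i, v i[%classic) ->
  p <= q ->
  \sum_i (phi (v i) - phi (u i)) <= phi q - phi p.
Proof.
move=> nd uv tuv pq.
suff H k : forall (A : {set 'I_n}) (r : R), (#|A| <= k)%N -> p <= r -> r <= q ->
    (forall i, i \in A -> v i <= r) ->
    \sum_(i in A) (phi (v i) - phi (u i)) <= phi r - phi p.
  have := H n [set i : 'I_n | true]%SET q; rewrite big_mkcond/=; under eq_bigr do rewrite inE.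
  by apply=> //; [rewrite -[leqRHS]card_ord max_card|move=> i _; have [_ []] := uv i].
elim: k => [A r|k IH A r].
  rewrite leqn0 cards_eq0 => /eqP-> pr rq _; rewrite big_set0 subr_ge0.
  exact: nd.
move=> Ak pr rq Ar.
have [A0|[i0 iA0]] := set_0Vmem [set i in A | u i < v i]%SET.
  rewrite big1 ?subr_ge0 ?nd// => i iA; have := finset.in_set0 i.
  rewrite -A0 inE iA/= => /negbT; rewrite -leNgt => vu.
  have [_ [uvi _]] := uv i.
  by rewrite (@le_anti _ _ (u i) (v i)) ?subrr// uvi vu.
rewrite inE in iA0.
have [i /andP[iA uvi] imax] :=
  @arg_maxP _ _ _ i0 (fun i => (i \in A) && (u i < v i)) v iA0.
rewrite (bigID (fun j => u j < v j))/= [X in _ + X]big1 ?addr0; last first.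
  move=> j /andP[_]; rewrite -leNgt => vu; have [_ [uvj _]] := uv j.
  by rewrite (@le_anti _ _ (u j) (v j)) ?subrr// uvj vu.
rewrite (bigD1 i)/=; last by rewrite iA.
have [pui [_ viq]] := uv i.
have : \sum_(j in [set j in A | (u j < v j) && (j != i)]%SET) (phi (v j) - phi (u j)) <=
    phi (u i) - phi p.
  apply: IH => //.
  - rewrite -ltnS (leq_trans _ Ak)// proper_card//; apply/properP; split.
      by apply/fintype.subsetP => j; rewrite inE => /andP[].
    by exists i => //; rewrite inE iA eqxx !andbF.
  - by rewrite (le_trans (ltW uvi)).
  - move=> j; rewrite inE => /and3P[jA uvj ji]; rewrite leNgt; apply/negP => uivj.
    move/eqP: ji; apply; apply: (tuv _ _ I I).
    have vji : v j <= v i by apply: imax; rewrite jA.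
    exists ((Num.max (u i) (u j) + v j) / 2); rewrite /= !in_itv/=.
    have m1 : u i <= Num.max (u i) (u j) by rewrite le_max lexx.
    have m2 : u j <= Num.max (u i) (u j) by rewrite le_max lexx orbT.
    have m3 : Num.max (u i) (u j) < v j by rewrite gt_max uivj.
    by split; apply/andP; split; lra.
have -> : \sum_(j in [set j in A | (u j < v j) && (j != i)]%SET) (phi (v j) - phi (u j)) =
  \sum_(j | (j \in A) && (u j < v j) && (j != i)) (phi (v j) - phi (u j)).
  by apply: eq_bigl => j; rewrite inE andbA.
have := nd (v i) r (le_trans pui (ltW uvi)) (Ar _ iA) rq.
by lra.
Qed.

(** The bound on |D| minimized over k: a Cauchy-Schwarz inequality obtained from
the pointwise inequality of arithmetic and geometric means. *)
Lemma sqr_le_of_forall_am_gm (D L E : R) : 0 <= L -> 0 <= E ->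
  (L = 0 -> D = 0) -> (forall k, 0 < k -> `|D| <= k * L / 2 + E / (2 * k)) ->
  D ^+ 2 <= L * E.
Proof.
move=> L0 E0 LD H.
have [/LD->|Ln0] := eqVneq L 0; first by rewrite expr0n/= mulr_ge0.
have Lp : 0 < L by rewrite lt_def Ln0.
have [->|Dn0] := eqVneq D 0; first by rewrite expr0n/= mulr_ge0.
have Dp : 0 < `|D| by rewrite normr_gt0.
(* The minimum of the right-hand side would be at sqrt (E / L); at k = |D| / L the
unknown sides recombine into the claim. *)
have := H (`|D| / L) (divr_gt0 Dp Lp).
rewrite -real_normK ?num_real//; set x := `|D| in Dp *.
have -> : x / L * L / 2 + E / (2 * (x / L)) = x / 2 + E * L / (2 * x).
  by field; rewrite !gt_eqF.
move=> h; have : x / 2 <= E * L / (2 * x) by lra.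
rewrite ler_pdivlMr ?mulr_gt0//; rewrite (mulrC L).
by rewrite (_ : x / 2 * (2 * x) = x ^+ 2)//; field.
Qed.

End increments.

Section limits.
Variable R : realType.
Local Open Scope ereal_scope.

Lemma limn_esup_le (u : (\bar R)^nat) (l : \bar R) :
  (\forall n \near \oo, u n <= l) -> limn_esup u <= l.
Proof.
move=> ul; rewrite /limn_esup/limf_esup; apply: ereal_inf_le.
exists (ereal_sup [set u n | n in [set n | u n <= l]]).
  by exists [set n | u n <= l].
by apply: ge_ereal_sup => _ [n /= ? <-].
Qed.

Lemma limn_einf_ge (u : (\bar R)^nat) (l : \bar R) :
  (\forall n \near \oo, l <= u n) -> l <= limn_einf u.
Proof.
move=> lu; rewrite -[u](_ : -%E \o (-%E \o u) = u); last first.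
  by apply/funext => n /=; rewrite oppeK.
rewrite limn_einfN leeNr; apply: limn_esup_le.
by apply: filterS lu => n /= ?; rewrite leeN2.
Qed.

End limits.

Section energy.
Variable R : realType.
Local Notation mu := (@lebesgue_measure R).
Implicit Types (x h phi : R -> R).

Lemma derivable_near_shift (F h : R -> R) (c t : R) : derivable F t 1 ->
  (\forall y \near t, F y + c = h y) -> derivable h t 1 /\ derive1 h t = derive1 F t.
Proof.
move=> dF E; have dFc : derivable (F + cst c) t 1 by apply: derivableD.
have E' : \forall y \near t, (F + cst c) y = h y by [].
split; first exact: near_eq_derivable E' dFc.
by rewrite !derive1E -(near_eq_derive _ E') deriveD// derive_cst addr0.
Qed.

(** Lebesgue's differentiation theorem for the primitive of the density of h. *)
Lemma absolutely_continuous01_derivable h : absolutely_continuous01 h ->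
  exists g : R -> R, [/\ mu.-integrable setT (EFin \o g),
    forall t, 0 <= t <= 1 -> h t - h 0 = \int[mu]_(y in `]0, t]) g y &
    exists N : set R, [/\ measurable N, mu N = 0%E &
      forall t, 0 < t < 1 -> ~ N t -> derivable h t 1 /\ derive1 h t = g t]].
Proof.
move=> /absolutely_continuous01_density[g gint gE]; exists g; split => //.
have gintS (y : R) : mu.-integrable [set` Interval (BRight 0) (BRight y)] (EFin \o g).
  exact: integrableS gint.
have [N [mN N0 HN]] := FTC1 gintS (open_integrable_locally openT gint).
exists N; split => // t /andP[t0 t1] Nt.
pose F y := \int[mu]_(z in `]0, y]) g z.
have [dF F'] : derivable F t 1 /\ derive1 F t = g t.
  by apply: contrapT => nd; apply/Nt/HN => K; apply: nd; exact: K.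
have E : \forall y \near t, F y + h 0 = h y.
  near=> y; rewrite /F -gE ?subrK//; apply/andP; split; near: y.
    exact: lt_le_nbhsr.
  exact: lt_le_nbhsl.
have [dh ->] := derivable_near_shift dF E; split => //.
Unshelve. all: by end_near. Qed.

(** [energy_le x c] says that x starts at 0 and that the integral of the square
of its derivative is at most c, without mentioning the derivative: phi plays
the part of the primitive of that square. In this form the bound passes to
pointwise limits. *)
Definition energy_le x (c : R) : Prop := x 0 = 0 /\ exists phi : R -> R,
  [/\ phi 0 = 0, phi 1 <= c & forall s t, 0 <= s -> s <= t -> t <= 1 ->
    phi s <= phi t /\ (x t - x s) ^+ 2 <= (t - s) * (phi t - phi s)].

Lemma energy_le_absolutely_continuous x c : energy_le x c ->
  absolutely_continuous01 x.
Proof.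
move=> [x0 [phi [phi0 phi1 H]]] e e0.
have c0 : 0 <= c by have [+ _] := H 0 1 (lexx _) ler01 (lexx _); lra.
pose k := e / (c + 1); have k0 : 0 < k by rewrite divr_gt0//; lra.
exists (e * k) => [|n u v uv tuv s]; first exact: mulr_gt0.
have uv' i : 0 <= u i /\ u i <= v i /\ v i <= 1 by have [/andP[]] := uv i.
(* Arithmetic-geometric mean with weight k: the increments of phi add up to at
most c, which k compensates, and the total length is made small against k. *)
have step i : `|x (v i) - x (u i)| <=
    (v i - u i) / (2 * k) + k * (phi (v i) - phi (u i)) / 2.
  have [u0 [uvi v1]] := uv' i; have [phii Hi] := H _ _ u0 uvi v1.
  rewrite -(@ler_pXn2r _ 2) ?nnegrE//; last first.
    by apply: addr_ge0; apply: divr_ge0 => //; rewrite ?subr_ge0// mulr_ge0// ?subr_ge0// ltW.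
  rewrite real_normK ?num_real// (le_trans Hi)//.
  rewrite -subr_ge0 (_ : _ - _ =
    ((v i - u i) / (2 * k) - k * (phi (v i) - phi (u i)) / 2) ^+ 2).
    exact: sqr_ge0.
  by field; rewrite gt_eqF.
apply: (@le_lt_trans _ _ (\sum_i ((v i - u i) / (2 * k) + k * (phi (v i) - phi (u i)) / 2))).
  exact: ler_sum.
rewrite big_split/= -mulr_suml.
under [X in _ + X]eq_bigr do rewrite mulrAC.
rewrite -mulr_sumr.
have S : \sum_i (phi (v i) - phi (u i)) <= c.
  have := @sum_increments_disjoint _ phi n u v 0 1 _ uv' tuv ler01.
  by rewrite phi0 subr0 => /(_ (fun s t s0 st t1 => (H s t s0 st t1).1))/le_trans; apply.
have A : (\sum_i (v i - u i)) / (2 * k) < e / 2.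
  have -> : e / 2 = e * k / (2 * k) by field; rewrite gt_eqF.
  by rewrite ltr_pM2r// invr_gt0 mulr_gt0.
have B : (\sum_i (phi (v i) - phi (u i))) * (k / 2) <= e / 2.
  apply: (@le_trans _ _ (c * (k / 2))); first by rewrite ler_wpM2r// divr_ge0// ltW.
  rewrite (_ : c * (k / 2) = (c / (c + 1)) * (e / 2)); last by rewrite /k; field; lra.
  by rewrite ler_piMl ?divr_ge0// ?ltW// ltr_pdivrMr; lra.
have -> : e = e / 2 + e / 2 by field.
by rewrite ltr_leD// mulrC.
Qed.

(** The points u n and v n enclose t, so that the quotient is a convex combination
of the two quotients based at t. *)
Lemma cvg_difference_quotient (x : R -> R) (t : R) (u v : nat -> R) :
  derivable x t 1 ->
  (forall n, u n <= t < v n) -> (v n - u n @[n --> \oo] --> 0) ->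
  (x (v n) - x (u n)) / (v n - u n) @[n --> \oo] --> derive1 x t.
Proof.
move=> dx uv vu0; set D := derive1 x t.
have lin e : 0 < e -> exists2 dl, 0 < dl &
    forall y, `|y - t| < dl -> `|x y - x t - D * (y - t)| <= e * `|y - t|.
  move=> e0; have : h^-1 *: (x (h *: 1 + t) - x t) @[h --> 0^'] --> D.
    by rewrite /D derive1E; exact: dx.
  move=> /cvgrPdist_le/(_ e e0)[dl /= dl0 H]; exists dl => // y yt.
  have [->|ynt] := eqVneq y t; first by rewrite !subrr mulr0 subr0 normr0 mulr0.
  have yt0 : y - t != 0 by rewrite subr_eq0.
  have := H (y - t); rewrite /ball_/= sub0r normrN => /(_ yt yt0).
  rewrite /GRing.scale/= mulr1 subrK => HH.
  rewrite -ler_pdivrMr ?normr_gt0// -normfV -normrM.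
  by rewrite mulrBl mulfK// distrC mulrC.
apply/cvgrPdist_le => e e0; have [dl dl0 H] := lin e e0.
have : \forall n \near \oo, `|v n - u n| < dl.
  by move/cvgr0Pnorm_lt : vu0; exact.
apply: filterS => n vun; have /andP[ut tv] := uv n.
have L : 0 < v n - u n by rewrite subr_gt0 (le_lt_trans ut).
rewrite gtr0_norm// in vun.
have h1 : `|v n - t| = v n - t by rewrite ger0_norm// subr_ge0 ltW.
have h2 : `|u n - t| = t - u n by rewrite distrC ger0_norm// subr_ge0.
have := H (v n); have := H (u n); rewrite h1 h2 => H1 H2.
have {}H1 := H1 ltac:(lra); have {}H2 := H2 ltac:(lra).
rewrite -(@ler_pM2r _ (v n - u n))//.
have -> : `|D - (x (v n) - x (u n)) / (v n - u n)| * (v n - u n) =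
    `|D * (v n - u n) - (x (v n) - x (u n))|.
  by rewrite -[X in _ * X](gtr0_norm L) -normrM mulrBl divfK ?gt_eqF.
apply: le_trans (_ : `|x (v n) - x t - D * (v n - t)| + `|x (u n) - x t - D * (u n - t)| <= _).
  rewrite (_ : D * _ - _ = x (u n) - x t - D * (u n - t) - (x (v n) - x t - D * (v n - t))).
    by rewrite [leRHS]addrC ler_normB.
  by ring.
by lra.
Qed.

(** The square of the difference quotient of x on the cell of a regular grid that
contains t: a step function, hence measurable. *)
Let grid_quotient (x : R -> R) (m : nat) (t : R) : R :=
  \sum_(j < m.+1) ((x (j.+1%:R / m.+1%:R) - x (j%:R / m.+1%:R)) * m.+1%:R) ^+ 2
    * \1_(`[j%:R / m.+1%:R, j.+1%:R / m.+1%:R[%classic : set R) t.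

Let grid_quotientE x m t : 0 <= t < 1 ->
  let j := Num.truncn (t * m.+1%:R) in
  (j%:R / m.+1%:R <= t < j.+1%:R / m.+1%:R) /\
  grid_quotient x m t =
    ((x (j.+1%:R / m.+1%:R) - x (j%:R / m.+1%:R)) / (j.+1%:R / m.+1%:R - j%:R / m.+1%:R)) ^+ 2.
Proof.
move=> /andP[t0 t1] j; have m0 : 0 < m.+1%:R :> R by rewrite ltr0n.
have tm0 : 0 <= t * m.+1%:R by rewrite mulr_ge0.
have jt : j%:R / m.+1%:R <= t < j.+1%:R / m.+1%:R.
  by rewrite ler_pdivrMr// ltr_pdivlMr// truncn_itv.
split => //.
have jm : (j < m.+1)%N.
  by rewrite truncn_lt_nat// -[ltRHS]mul1r ltr_pM2r.
rewrite /grid_quotient (bigD1 (Ordinal jm))//= big1 ?addr0; last first.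
  move=> i ij; rewrite indicE memNset ?mulr0//= in_itv/= => /andP[it ti].
  move/eqP : ij; apply; apply/val_inj => /=; apply/esym/eqP.
  rewrite /j truncn_eq//; apply/andP; split.
    by rewrite -ler_pdivrMr.
  by rewrite -ltr_pdivlMr.
rewrite indicE mem_set ?mulr1//=.
by rewrite -mulrBl -natrB// subSnn mul1r invrK.
Qed.

(** The squares of the difference quotients on the regular grids tend to the
square of the derivative almost everywhere, and their integrals are at most c by
the bound on the increments of x: Fatou's lemma concludes. *)
Lemma integral_derive1_sqr_le x c : energy_le x c ->
  (\int[mu]_(u in `[0%R, 1%R]) ((derive1 x u) ^+ 2)%:E <= c%:E)%E.
Proof.
move=> ex; have [g [gint _ [N [mN N0 HN]]]] :=
  absolutely_continuous01_derivable (energy_le_absolutely_continuous ex).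
have [x0 [phi [phi0 phi1 H]]] := ex.
have q_ge0 m t : 0 <= grid_quotient x m t.
  by apply: sumr_ge0 => j _; rewrite mulr_ge0 ?sqr_ge0// indicE.
have mq m : measurable_fun setT (grid_quotient x m).
  apply: measurable_sum => j; apply: measurable_funM => //.
pose N' := N `|` [set 0%R] `|` [set 1%R].
have mN' : measurable N' by do 2?apply: measurableU.
have N'0 : mu N' = 0%E.
  have m1 (a : R) : mu.-negligible [set a].
    by exists [set a]; split => //; exact: lebesgue_measure_set1.
  apply: measure_negligible => //; apply: negligibleU => //.
  by apply: negligibleU; [exists N; split|exact: m1].
apply: (@le_trans _ _ (\int[mu]_(u in `[0%R, 1%R])
    limn_einf (fun m => (grid_quotient x m u)%:E)))%E.
  apply: (@ge0_le_integral_off_null _ _ _ mu _ N') => //.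
  - by move=> t _; rewrite lee_fin sqr_ge0.
  - by move=> t _; apply: limn_einf_ge; apply: nearW => m; rewrite lee_fin.
  - move=> t /=; rewrite in_itv/= => /andP[t0 t1] tN'.
    have {}t0 : 0 < t.
      by rewrite lt_neqAle t0 andbT; apply/eqP => t0'; apply: tN'; left; right.
    have {}t1 : t < 1.
      by rewrite lt_neqAle t1 andbT; apply/eqP => t1'; apply: tN'; right.
    have tN : ~ N t by move=> Nt; apply: tN'; left; left.
    have [dx _] := HN t (introT andP (conj t0 t1)) tN.
    have t01 : 0 <= t < 1 by rewrite ltW.
    pose j m := Num.truncn (t * m.+1%:R).
    suff cv : (grid_quotient x m t)%:E @[m --> \oo] --> (derive1 x t ^+ 2)%:E.
      by rewrite (cvg_limn_einf_sup cv).1.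
    apply: cvg_EFin; first exact: nearW.
    rewrite [X in X @ _ --> _](_ : _ = fun m => 
      ((x ((j m).+1%:R / m.+1%:R) - x ((j m)%:R / m.+1%:R)) /
       ((j m).+1%:R / m.+1%:R - (j m)%:R / m.+1%:R)) ^+ 2); last first.
      by apply/funext => m /=; rewrite (grid_quotientE x _ t01).2.
    under eq_fun do rewrite expr2.
    rewrite expr2; apply: cvgM; apply: (@cvg_difference_quotient x t
      (fun m => (j m)%:R / m.+1%:R) (fun m => (j m).+1%:R / m.+1%:R)) => //.
    + by move=> m; have [] := grid_quotientE x m t01.
    + under eq_fun do rewrite -mulrBl -natrB// subSnn mul1r.
      exact: cvg_harmonic.
    + by move=> m; have [] := grid_quotientE x m t01.
    + under eq_fun do rewrite -mulrBl -natrB// subSnn mul1r.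
      exact: cvg_harmonic.
apply: le_trans (fatou _ _ _ _) _ => //.
- by move=> m; apply/measurable_EFinP; apply: measurable_funS (mq m).
- by move=> m t _; rewrite lee_fin.
apply: le_trans (limn_einf_sup _) _; apply: limn_esup_le; apply: nearW => m.
have m0 : 0 < m.+1%:R :> R by rewrite ltr0n.
under eq_integral do rewrite /grid_quotient -sumEFin.
rewrite ge0_integral_sum//; last 2 first.
- move=> j; apply/measurable_EFinP; apply: measurable_funM => //.
- by move=> j t _; rewrite lee_fin mulr_ge0 ?sqr_ge0// indicE.
apply: (@le_trans _ _ (\sum_(j < m.+1) (phi (j.+1%:R / m.+1%:R) - phi (j%:R / m.+1%:R))%:E)%E).
  apply: lee_sum => j _.
  have jj : j%:R / m.+1%:R < j.+1%:R / m.+1%:R :> R by rewrite ltr_pM2r ?invr_gt0// ltr_nat.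
  under eq_integral do rewrite EFinM.
  rewrite ge0_integralZl//; last by rewrite lee_fin sqr_ge0.
  + rewrite integral_indic// (@le_trans _ _ ((((x (j.+1%:R / m.+1%:R) - x (j%:R / m.+1%:R)) * m.+1%:R) ^+ 2)%:E * (m.+1%:R^-1)%:E)%E)//.
      apply: lee_wpmul2l; first by rewrite lee_fin sqr_ge0.
      apply: (@le_trans _ _ (mu `[j%:R / m.+1%:R, j.+1%:R / m.+1%:R[%classic)).
        by apply: le_measure; rewrite ?inE//; exact: measurableI.
      by rewrite lebesgue_measure_itv/= lte_fin jj -EFinB -mulrBl -natrB// subSnn mul1r.
    rewrite -EFinM lee_fin.
    have [_] := H (j%:R / m.+1%:R) (j.+1%:R / m.+1%:R) ltac:(by rewrite divr_ge0) (ltW jj)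
      ltac:(by rewrite ler_pdivrMr// mul1r ler_nat).
    rewrite -mulrBl -natrB// subSnn mul1r => hh.
    rewrite exprMn expr2 -[leLHS]mulrA expr2 -(mulrA m.+1%:R) divff ?gt_eqF// mulr1.
    by rewrite -expr2 -ler_pdivlMr// [leRHS]mulrC.
  + by apply/measurable_EFinP.
rewrite sumEFin -(big_mkord xpredT (fun j => phi (j.+1%:R / m.+1%:R) - phi (j%:R / m.+1%:R))).
rewrite (telescope_sumr (fun j => phi (j%:R / m.+1%:R)))//.
by rewrite mul0r phi0 subr0 divff ?gt_eqF// lee_fin.
Qed.

(** The witness phi is the primitive of the square of the density of x; the bound
on the increments is the Cauchy-Schwarz inequality. *)
Lemma energy_le_of_integral x c : x 0 = 0 -> absolutely_continuous01 x ->
  (\int[mu]_(u in `[0%R, 1%R]) ((derive1 x u) ^+ 2)%:E <= c%:E)%E ->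
  energy_le x c.
Proof.
move=> x0 ac; have [g [gint gE [N [mN N0 HN]]]] := absolutely_continuous01_derivable ac.
move=> intx.
have mg : measurable_fun setT g.
  by have /integrableP[/measurable_EFinP] := gint.
have mg2 : measurable_fun setT (fun t => g t ^+ 2) by exact: measurable_funX.
have mg2E D : measurable D -> measurable_fun D (EFin \o (fun t => g t ^+ 2)).
  by move=> mD; apply/measurable_EFinP; exact: measurable_funTS.
have g2c : (\int[mu]_(u in `]0%R, 1%R]) (g u ^+ 2)%:E <= c%:E)%E.
  apply: le_trans intx; rewrite -[leLHS]integral_itv_bndo_bndc; last exact: mg2E.
  apply: (@le_trans _ _ (\int[mu]_(u in `]0%R, 1%R[) ((derive1 x u) ^+ 2)%:E)%E).
    apply: (@ge0_le_integral_off_null _ _ _ mu _ N) => //.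
    - by move=> t _; rewrite lee_fin sqr_ge0.
    - by move=> t _; rewrite lee_fin sqr_ge0.
    - by move=> t /=; rewrite in_itv/= => t01 /(HN _ t01)[_ ->].
  rewrite integral_mkcond [leRHS]integral_mkcond.
  apply: (@ge0_le_integral_off_null _ _ _ mu _ set0) => //.
  - by move=> t _; rewrite patchE; case: ifP => // _; rewrite lee_fin sqr_ge0.
  - by move=> t _; rewrite patchE; case: ifP => // _; rewrite lee_fin sqr_ge0.
  - move=> t _ _; rewrite !patchE; case: ifPn => [|_].
      rewrite inE/= in_itv/= => /andP[t0 t1].
      by rewrite ifT// inE/= in_itv/= !ltW.
    by case: ifP => // _; rewrite lee_fin sqr_ge0.
have g2int : mu.-integrable `]0%R, 1%R] (EFin \o (fun t => g t ^+ 2)).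
  apply/integrableP; split; first exact: mg2E.
  rewrite (le_lt_trans _ (ltry c))// (le_trans _ g2c)//.
  by under eq_integral do rewrite /= ger0_norm ?sqr_ge0//.
pose phi t := \int[mu]_(u in `]0%R, t]) (g u ^+ 2).
split => //; exists phi; split.
- by rewrite /phi set_itv_ge ?Rintegral_set0// bnd_simp ltxx.
- rewrite /phi /Rintegral -lee_fin fineK//.
  exact: integrable_fin_num.
move=> s t s0 st t1.
have sub1 (r r' : R) : 0 <= r -> r' <= 1 -> `]r, r']%classic `<=` `]0%R, 1%R]%classic.
  move=> r0 r1 y; rewrite /= !in_itv/= => /andP[ry yt].
  by rewrite (le_lt_trans r0)//= (le_trans yt).
have t0 := le_trans s0 st; have s1 := le_trans st t1.
have phiB : phi t - phi s = \int[mu]_(u in `]s, t]) (g u ^+ 2).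
  rewrite /phi Rintegral_itvB//; [|by rewrite bnd_simp..].
  by apply: integrableS g2int => //; exact: sub1.
have xB : x t - x s = \int[mu]_(u in `]s, t]) g u.
  have -> : x t - x s = (x t - x 0) - (x s - x 0) by ring.
  rewrite !gE ?s0 ?t0//; rewrite Rintegral_itvB//; [|by rewrite bnd_simp..].
  exact: integrableS gint.
have E0 : 0 <= phi t - phi s.
  by rewrite phiB; apply: Rintegral_ge0 => y _; exact: sqr_ge0.
split; first by rewrite -subr_ge0.
have gi : mu.-integrable `]s, t] (EFin \o g) by exact: integrableS gint.
have g2i : mu.-integrable `]s, t] (EFin \o (fun t => g t ^+ 2)).
  by apply: integrableS g2int => //; exact: sub1.
apply: sqr_le_of_forall_am_gm => //.
- by rewrite subr_ge0.
- by move/eqP; rewrite subr_eq0 => /eqP ->; rewrite subrr.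
move=> k k0; rewrite xB (le_trans (le_normr_Rintegral _ _))//.
have ci : mu.-integrable `]s, t] (EFin \o cst (k / 2)).
  apply: measurable_bounded_integrable => //.
  - rewrite -/mu [X in (X < _)%E]lebesgue_measure_itv/=.
    by case: ifP => _; rewrite -?EFinB ltry.
  - by exists `|k / 2|; split; rewrite ?num_real// => M kM u _; exact: ltW.
have L : \int[mu]_(u in `]s, t]) cst (k / 2) u = k * (t - s) / 2.
  rewrite Rintegral_cst//= [X in fine X]lebesgue_measure_itv/= lte_fin.
  case: ltP => [_|ts]; first by rewrite -EFinB/=; ring.
  by rewrite (@le_anti _ _ s t) ?st//= subrr mulr0 mulr0 mul0r.
rewrite -L phiB [X in _ + X]mulrC -RintegralZl//.
rewrite -RintegralD//; last exact: (integrableZl _ (2 * k)^-1 g2i).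
apply: le_Rintegral => //.
- by apply: (integrable_norm gi).
- have mI : measurable (`]s, t]%classic : set (measurableTypeR R)) by exact: measurable_itv.
  have kg2 := integrableZl mI (2 * k)^-1 g2i.
  by have := integrableD mI ci kg2; apply: eq_integrable.
move=> u _ /=; rewrite -subr_ge0 -real_normK ?num_real//.
rewrite (_ : _ - _ = (2 * k)^-1 * (`|g u| - k) ^+ 2); last by field; rewrite gt_eqF.
by rewrite mulr_ge0 ?sqr_ge0// invr_ge0 mulr_ge0// ltW.
Qed.

(** This replaces the rate function, defined by a derivative, by a condition on
increments that can be read on a grid and passes to the limit. *)
Lemma energy_le_rate sigma (x : cadlag R) (alpha : R) : sigma != 0 ->
  (rate sigma x <= alpha%:E)%E <-> energy_le x (2 * sigma ^+ 2 * alpha).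
Proof.
move=> s0; have s2 : 0 < 2 * sigma ^+ 2 by rewrite mulr_gt0// exprn_even_gt0.
rewrite /rate (negbTE s0); split.
  case: asboolP => [[x0 ac]|_]; last by rewrite leNgt ltry.
  rewrite lee_pdivrMl// => H; apply: energy_le_of_integral => //.
move=> ex; have ac := energy_le_absolutely_continuous ex.
rewrite asboolT; last by split => //; case: ex.
by rewrite lee_pdivrMl//; exact: integral_derive1_sqr_le.
Qed.

End energy.

(** * Compactness of the level sets, and polygons *)

Section skorohod_level_sets.
Variable R : realType.
Implicit Types (c : R).

Lemma energy_le_ge0 x c : energy_le x c -> 0 <= c.
Proof.
move=> [_ [phi [p0 p1 H]]]; have [+ _] := H 0 1 (lexx _) ler01 (lexx _).
by rewrite p0; lra.
Qed.

Lemma energy_le_hoelder x c s t : energy_le x c -> 0 <= s <= 1 -> 0 <= t <= 1 ->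
  (x t - x s) ^+ 2 <= c * `|t - s|.
Proof.
move=> [_ [phi [p0 p1 H]]].
wlog st : s t / s <= t => [W s01 t01|/andP[s0 s1] /andP[t0 t1]].
  have [|/ltW] := leP s t; first by move=> /W; apply.
  by rewrite distrC -sqrrN opprB => /W; apply.
have [a b] := H s t s0 st t1; have [a0 _] := H 0 s (lexx _) s0 s1.
have [a1 _] := H t 1 t0 t1 (lexx _).
rewrite ger0_norm ?subr_ge0// (le_trans b)// mulrC ler_wpM2r ?subr_ge0//.
by lra.
Qed.

(** The scale at which all the paths of a level set are constant up to e. *)
Lemma energy_le_close x c (m : nat) (e : R) s t : energy_le x c -> 0 < e ->
  0 <= s <= 1 -> 0 <= t <= 1 -> c < e ^+ 2 * m%:R -> (0 < m)%N -> `|t - s| <= m%:R^-1 ->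
  `|x t - x s| <= e.
Proof.
move=> ex e0 s01 t01 cm m0 ts.
rewrite -(@ler_pXn2r _ 2) ?nnegrE// ?(ltW e0)// real_normK ?num_real//.
apply: le_trans (energy_le_hoelder ex s01 t01) _.
have mp : 0 < m%:R :> R by rewrite ltr0n.
apply: (@le_trans _ _ (c * m%:R^-1)).
  by rewrite ler_wpM2l// (energy_le_ge0 ex).
by rewrite ler_pdivrMr// ltW.
Qed.

Lemma energy_le_cadlag y c : energy_le y c ->
  exists z : cadlag R, forall t, 0 <= t <= 1 -> z t = y t.
Proof.
move=> ey; pose z t := if t \in `[0, 1] then y t else 0.
have zE t : 0 <= t <= 1 -> z t = y t by rewrite /z in_itv/= => ->.
have cont t : 0 <= t <= 1 -> forall e, 0 < e -> exists2 dl, 0 < dl &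
    forall s, 0 <= s <= 1 -> `|s - t| < dl -> `|z t - z s| <= e.
  move=> t01 e e0; pose m := (Num.truncn (c / e ^+ 2)).+1.
  exists m%:R^-1; first by rewrite invr_gt0.
  move=> s s01 st; rewrite !zE//; apply: (energy_le_close ey e0 s01 t01 (m := m)) => //.
    rewrite mulrC -ltr_pdivrMr ?exprn_gt0//.
    by rewrite truncnS_gt// divr_ge0 ?sqr_ge0// (energy_le_ge0 ey).
  by rewrite distrC ltW.
have out t : t \notin `[0, 1] -> z t = 0 by rewrite /z => /negbTE ->.
have right t : 0 <= t < 1 -> z s @[s --> t^'+] --> z t.
  move=> /andP[t0 t1]; apply/cvgrPdist_le => e e0.
  have [dl dl0 H] := cont t (introT andP (conj t0 (ltW t1))) e e0.
  near=> s.
  have ts : t < s by near: s; exact: nbhs_right_gt.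
  have s1 : s <= 1 by near: s; exact: nbhs_right_le.
  have sd : s < t + dl by near: s; apply: nbhs_right_lt; rewrite ltrDl.
  apply: H; first by rewrite s1 (le_trans t0)// ltW.
  by rewrite gtr0_norm ?subr_gt0//; lra.
have left t : 0 < t <= 1 -> cvg (z s @[s --> t^'-]).
  move=> /andP[t0 t1]; apply/cvg_ex; exists (z t); apply/cvgrPdist_le => e e0.
  have [dl dl0 H] := cont t (introT andP (conj (ltW t0) t1)) e e0.
  near=> s.
  have ts : s < t by near: s; exact: nbhs_left_lt.
  have s1 : 0 <= s by near: s; exact: nbhs_left_ge.
  have sd : t - dl < s by near: s; apply: nbhs_left_gt; rewrite gtrBl.
  apply: H; first by rewrite s1 (le_trans _ t1)// ltW.
  by rewrite ltr0_norm ?subr_lt0//; lra.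
by exists (Cadlag out right left).
Unshelve. all: by end_near. Qed.

Lemma eq_energy_le x y c : (forall t, 0 <= t <= 1 -> x t = y t) ->
  energy_le x c -> energy_le y c.
Proof.
move=> xy [x0 [phi [p0 p1 H]]]; split; first by rewrite -xy ?lexx ?ler01.
exists phi; split => // s t s0 st t1; rewrite -!xy; first exact: H.
  by rewrite s0 (le_trans st).
by rewrite t1 andbT (le_trans s0).
Qed.

(** Uniform closeness is Skorohod closeness: use the identity change of time. *)
Lemma skorohod_ball_sup (x y : cadlag R) (e e' : R) : e' < e ->
  (forall t, 0 <= t <= 1 -> `|x t - y t| <= e') -> ball x e y.
Proof.
move=> ee H; exists id; first exact: time_change_id.
have e'0 : 0 <= e' by apply: le_trans (H 0 _); rewrite ?normr_ge0// lexx ler01.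
by exists e' => // t; rewrite in_itv/= => t01; rewrite subrr normr0; split => //; exact: H.
Qed.

(** The image of an ultrafilter is an ultrafilter, and bounded intervals are
relatively compact. *)
Lemma ultra_cvg (T : Type) (F : set_system T) (f : T -> R) (A : set T) (B : R) :
  UltraFilter F -> F A -> (forall p, A p -> `|f p| <= B) -> exists l : R, f @ F --> l.
Proof.
move=> uF FA fB.
have cK : compact `[- B, B] by exact: segment_compact.
rewrite compact_ultra in cK.
have pF : ProperFilter F by exact: ultra_proper.
have uF' : UltraFilter (f @ F).
  apply: Build_UltraFilter => G pG FG; apply/seteqP; split => // C GC.
  have [//|FnC] := in_ultra_setVsetC (f @^-1` C) uF.
  have GnC : G (~` C) by exact: FG.
  by have [z []] := filter_ex (filterI GC GnC).
have [|l [_ Fl]] := cK (f @ F) uF'.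
  suff : F (f @^-1` `[- B, B]%classic) by [].
  by apply: filterS FA => p /fB; rewrite /= in_itv/= ler_norml.
by exists l.
Qed.

(** Along an ultrafilter of paths of energy at most c, both the paths and their
witnesses phi converge at each point, and the inequalities that define
[energy_le] pass to the limit. By the Hoelder bound the convergence of the paths
on a fine grid is uniform up to e, hence it is a convergence in the Skorohod
space. *)
Lemma compact_energy_le c : compact [set x : cadlag R | energy_le x c].
Proof.
rewrite compact_ultra => F uF FA; have pF : ProperFilter F by exact: ultra_proper.
have /choice[phi Hphi] : forall x : cadlag R, exists phi : R -> R, energy_le x c ->
    [/\ phi 0 = 0, phi 1 <= c & forall s t, 0 <= s -> s <= t -> t <= 1 ->
    phi s <= phi t /\ (x t - x s) ^+ 2 <= (t - s) * (phi t - phi s)].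
  move=> x; have [[_ [phi H]]|] := pselect (energy_le x c); first by exists phi.
  by move=> nx; exists (fun=> 0).
(* Outside [0, 1] the witnesses are arbitrary, and the limits are taken at a point
of [0, 1] instead. *)
have clip (t : R) : {u : R | 0 <= u <= 1 /\ (0 <= t <= 1 -> u = t)}.
  have [t01|t01] := boolP (0 <= t <= 1); first by exists t.
  by exists 0; split; [rewrite lexx ler01|].
pose cl t := sval (clip t).
have cl01 t : 0 <= cl t <= 1 by have [] := svalP (clip t).
have clE t : 0 <= t <= 1 -> cl t = t by have [] := svalP (clip t).
have /choice[y Hy] : forall t, exists l : R, (fun x : cadlag R => x (cl t)) @ F --> l.
  move=> t; apply: (@ultra_cvg _ F _ _ (c + 1) _ FA) => x ex.
  have z01 : 0 <= (0 : R) <= 1 by rewrite lexx ler01.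
  have c0 := energy_le_ge0 ex.
  have := energy_le_hoelder ex z01 (cl01 t).
  have [-> _] := ex; rewrite !subr0 => h.
  rewrite -(@ler_pXn2r _ 2) ?nnegrE//; last by rewrite addr_ge0.
  rewrite real_normK ?num_real// (le_trans h)//.
  have /andP[u0 u1] := cl01 t; rewrite ger0_norm//.
  by nra.
have /choice[psi Hpsi] : forall t, exists l : R, (fun x : cadlag R => phi x (cl t)) @ F --> l.
  move=> t; apply: (@ultra_cvg _ F _ _ c _ FA) => x ex.
  have [p0 p1 H] := Hphi x ex; have /andP[u0 u1] := cl01 t.
  have [a _] := H 0 _ (lexx _) u0 u1; have [b _] := H _ 1 u0 u1 (lexx _).
  by rewrite ger0_norm; lra.
have lim_le (f : cadlag R -> R) (l r : R) : f @ F --> l -> (forall x : cadlag R, energy_le x c -> f x <= r) ->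
    l <= r.
  move=> fl fr; apply: (cvgr_to_le fl).
  by apply: filterS FA => x /fr.
have ey : energy_le y c.
  split.
    have := Hy 0; rewrite clE ?lexx ?ler01// => /cvg_lim.
    move=> /(_ (@Rhausdorff R)) <-; apply: lim_near_cst => //.
    by apply: filterS FA => x [].
  exists psi; split.
  - have := Hpsi 0; rewrite clE ?lexx ?ler01// => /cvg_lim.
    move=> /(_ (@Rhausdorff R)) <-; apply: lim_near_cst => //.
    by apply: filterS FA => x /Hphi[].
  - apply: (lim_le _ _ _ (Hpsi 1)) => x /Hphi[]; rewrite clE// ler01 lexx//.
  move=> s t s0 st t1.
  have sE : cl s = s by rewrite clE// s0 (le_trans st).
  have tE : cl t = t by rewrite clE// t1 (le_trans s0).
  have hy := Hy s; have hy' := Hy t; have hp := Hpsi s; have hp' := Hpsi t.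
  rewrite sE in hy hp; rewrite tE in hy' hp'.
  split; rewrite -subr_le0.
    apply: (lim_le _ _ _ (cvgB hp hp')) => x /Hphi[_ _ H] /=.
    by rewrite subr_le0; have [] := H s t s0 st t1.
  apply: (lim_le (fun x : cadlag R => (x t - x s) * (x t - x s) - (t - s) * (phi x t - phi x s))).
  - rewrite expr2; apply: cvgB; last by apply: cvgMr; exact: cvgB.
    by apply: cvgM; exact: cvgB.
  - by move=> x /Hphi[_ _ H]; rewrite -expr2 subr_le0; have [] := H s t s0 st t1.
have [z zE] := energy_le_cadlag ey.
have ez : energy_le z c by apply: (eq_energy_le _ ey) => t t01; rewrite zE.
exists z; split => //; apply/cvg_ballP => e e0.
have e40 : 0 < e / 4 by rewrite divr_gt0.
pose m := (Num.truncn (c / (e / 4) ^+ 2)).+1.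
have mp : 0 < m%:R :> R by rewrite ltr0n.
have cm : c < (e / 4) ^+ 2 * m%:R.
  rewrite mulrC -ltr_pdivrMr ?exprn_gt0//.
  by rewrite truncnS_gt// divr_ge0 ?sqr_ge0// (energy_le_ge0 ez).
have near_grid : F [set x : cadlag R | forall j : 'I_m.+1, `|z (j%:R / m%:R) - x (j%:R / m%:R)| <= e / 4].
  apply: filter_forall => j.
  have j01 : 0 <= (j%:R / m%:R : R) <= 1.
    by rewrite divr_ge0//= ler_pdivrMr// mul1r ler_nat -ltnS.
  have := Hy (j%:R / m%:R); rewrite clE// => /cvgrPdist_le/(_ _ e40).
  by rewrite -zE.
near=> x.
have ex : energy_le x c by near: x.
have gx : forall j : 'I_m.+1, `|z (j%:R / m%:R) - x (j%:R / m%:R)| <= e / 4 by near: x.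
apply: (@skorohod_ball_sup _ _ _ (3 * (e / 4))); first by lra.
move=> t /[dup] t01 /andP[t0 t1].
pose j := Num.truncn (t * m%:R).
have tm0 : 0 <= t * m%:R by rewrite mulr_ge0.
have jm : (j < m.+1)%N.
  by rewrite truncn_lt_nat// -natr1 ltr_pwDr// ler_piMl.
have := truncn_itv tm0; rewrite -/j => /andP[j1 j2].
have j01 : 0 <= (j%:R / m%:R : R) <= 1.
  by rewrite divr_ge0//= ler_pdivrMr// mul1r ler_nat -ltnS.
have jt : `|t - j%:R / m%:R| <= m%:R^-1.
  rewrite ger0_norm; last by rewrite subr_ge0 ler_pdivrMr.
  rewrite lerBlDr -{1}(mul1r m%:R^-1) -mulrDl ler_pdivlMr// ltW//.
  by rewrite addrC natr1.
have h1 : `|z t - z (j%:R / m%:R)| <= e / 4 by apply: (energy_le_close ez e40 j01 t01 cm).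
have h2 : `|x t - x (j%:R / m%:R)| <= e / 4 by apply: (energy_le_close ex e40 j01 t01 cm).
have h3 : `|z (j%:R / m%:R) - x (j%:R / m%:R)| <= e / 4.
  exact: gx (Ordinal jm).
move: h1 h2 h3; rewrite !ler_norml => /andP[? ?] /andP[? ?] /andP[? ?].
by apply/andP; split; lra.
Unshelve. all: by end_near. Qed.

End skorohod_level_sets.

(** Each point of K has a ball disjoint from C; compactness makes the radius
uniform. *)
Lemma compact_closed_separated (R : realType) (T : pseudoMetricType R) (K C : set T) :
  compact K -> closed C -> K `&` C = set0 ->
  exists2 r : R, 0 < r & forall x y, K x -> ball x r y -> ~ C y.
Proof.
move=> cK clC KC0.
have oC : open (~` C) by exact: closed_openC.
have /compact_near_coveringP/(_ _ (0 : R)^'+ (fun r x => forall y, ball x r y -> ~ C y)) := cK.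
move=> /(_ _)[].
- move=> x Kx; have nCx : (~` C) x.
    by move=> Cx; have : (K `&` C) x by []; rewrite KC0.
  have /nbhs_ballP[e /= e0 He] := open_nbhs_nbhs (conj oC nCx).
  have e20 : 0 < e / 2 by rewrite divr_gt0.
  near=> p q => /= y py; apply: He.
  have q2 : q < e / 2 by near: q; exact: nbhs_right_lt.
  rewrite (splitr e); apply: (@ball_triangle _ _ p); last exact: (le_ball (ltW q2)).
  by near: p; exact: nbhsx_ballx.
- move=> r r0 H; have : \forall r \near (0 : R)^'+, 0 < r /\ K `<=` (fun x => forall y, ball x r y -> ~ C y).
    near=> q; split; first by near: q; exact: nbhs_right_gt.
    by near: q; exists r.
  by move=> /filter_ex[q [q0 Kq]]; exists q => // x y Kx; exact: Kq.
Unshelve. all: by end_near. Qed.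

Section polygon.
Variable R : realType.

(** The polygon is a sum of ramps, one for each cell of the grid. *)
Definition ramp (s : R) : R := Num.max 0 (Num.min 1 s).

Lemma rampE s : ramp s = if s <= 0 then 0 else if s <= 1 then s else 1.
Proof.
rewrite /ramp; case: (leP 1 s) => s1.
  by rewrite max_r// leNgt (lt_le_trans ltr01 s1)/=; case: (leP s 1) => //; lra.
by rewrite (ltW s1); case: (leP s 0).
Qed.

Lemma ramp_itv s : 0 <= ramp s <= 1.
Proof. by rewrite rampE; case: (leP s 0) => ?; case: (leP s 1) => ?; lra. Qed.

Lemma ramp_homo s t : s <= t -> ramp s <= ramp t.
Proof.
rewrite !rampE; case: (leP s 0) => ?; case: (leP s 1) => ?;
case: (leP t 0) => ?; case: (leP t 1) => ?; lra.
Qed.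

Lemma sum_ramp (m : nat) s : 0 <= s <= m%:R -> \sum_(j < m) ramp (s - j%:R) = s.
Proof.
elim: m s => [|m IH] s /andP[s0 sm].
  by rewrite big_ord0; apply/eqP; rewrite eq_le s0.
rewrite big_ord_recr/=; have [sm'|sm'] := leP s m%:R.
  by rewrite IH ?s0// rampE subr_le0 sm' addr0.
rewrite (eq_bigr (fun=> 1)) => [|j _].
  rewrite sumr_const card_ord rampE subr_le0 leNgt sm'/=.
  by rewrite lerBlDl natr1 sm addrC subrK.
rewrite rampE; have : j.+1%:R <= m%:R :> R by rewrite ler_nat.
rewrite -natr1 => jm; rewrite leNgt ifF; last by apply/negbTE; rewrite negbK; lra.
by case: leP => //; lra.
Qed.

(** The variance of d under the weights w is nonnegative. *)
Lemma sqr_weighted_sum_le (I : finType) (w d : I -> R) : (forall i, 0 <= w i) ->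
  (\sum_i d i * w i) ^+ 2 <= (\sum_i w i) * \sum_i d i ^+ 2 * w i.
Proof.
move=> w0; set A := \sum_i d i * w i; set W := \sum_i w i; set B := \sum_i _.
have W0 : 0 <= W by exact: sumr_ge0.
have [WE|Wn0] := eqVneq W 0.
  have wE i : w i = 0.
    by have /eqP := WE; rewrite psumr_eq0 => [/allP/(_ i (mem_index_enum _))/eqP|].
  by rewrite /A big1 ?expr0n ?WE ?mul0r// => i _; rewrite wE mulr0.
have Wp : 0 < W by rewrite lt_def Wn0.
have : 0 <= \sum_i (d i - A / W) ^+ 2 * w i.
  by apply: sumr_ge0 => i _; rewrite mulr_ge0 ?sqr_ge0.
have -> : \sum_i (d i - A / W) ^+ 2 * w i = B - A ^+ 2 / W.
  rewrite (eq_bigr (fun i => d i ^+ 2 * w i + (- (2 * (A / W)) * (d i * w i) + (A / W) ^+ 2 * w i))).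
    by rewrite !big_split/= -!mulr_sumr -/A -/W -/B; field.
  by move=> i _; ring.
by rewrite subr_ge0 ler_pdivrMr// mulrC.
Qed.

(** The polygon with the values of Z at the points of a regular grid has the
energy that is read on the grid. It brings a path with jumps into a level set
as soon as its increments on the grid are those of such a path. *)
Lemma polygonal_approximation (Z : R -> R) (m : nat) : Z 0 = 0 ->
  exists z : cadlag R,
    energy_le z (\sum_(j < m.+1) m.+1%:R *
      (Z (j.+1%:R / m.+1%:R) - Z (j%:R / m.+1%:R)) ^+ 2) /\
    forall (j : nat) t, (j < m.+1)%N -> j%:R / m.+1%:R <= t <= j.+1%:R / m.+1%:R ->
      `|z t - Z (j%:R / m.+1%:R)| <= `|Z (j.+1%:R / m.+1%:R) - Z (j%:R / m.+1%:R)|.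
Proof.
move=> Z0; set M : R := m.+1%:R; have M0 : 0 < M by rewrite ltr0n.
pose d (j : nat) := Z (j.+1%:R / M) - Z (j%:R / M).
pose P t := \sum_(j < m.+1) d j * ramp (M * t - j%:R).
pose phi t := \sum_(j < m.+1) (M * d j ^+ 2) * ramp (M * t - j%:R).
have rlow (t : R) (j : nat) : M * t <= j%:R -> ramp (M * t - j%:R) = 0.
  by move=> h; rewrite rampE subr_le0 h.
have rhigh (t : R) (j : nat) : j.+1%:R <= M * t -> ramp (M * t - j%:R) = 1.
  rewrite -natr1 => h; rewrite rampE ifF; last by apply/negbTE; rewrite -ltNge; lra.
  by case: leP => //; lra.
have sumw t : 0 <= t <= 1 -> \sum_(j < m.+1) ramp (M * t - j%:R) = M * t.
  by move=> /andP[t0 t1]; rewrite sum_ramp// mulr_ge0 ?(ltW M0)//= ler_piMr// ltW.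
have eP : energy_le P (\sum_(j < m.+1) M * d j ^+ 2).
  split; first by rewrite /P big1// => j _; rewrite rlow ?mulr0.
  exists phi; split.
  - by rewrite /phi big1// => j _; rewrite rlow ?mulr0.
  - rewrite /phi; apply: ler_sum => j _; rewrite rhigh; first by rewrite mulr1.
    by rewrite mulr1 ler_nat.
  move=> s t s0 st t1.
  have w0 (j : 'I_m.+1) : 0 <= ramp (M * t - j%:R) - ramp (M * s - j%:R).
    by rewrite subr_ge0 ramp_homo// lerB// ler_pM2l.
  have phiB : phi t - phi s = M * \sum_(j < m.+1) d j ^+ 2 * (ramp (M * t - j%:R) - ramp (M * s - j%:R)).
    rewrite /phi -sumrB mulr_sumr; apply: eq_bigr => j _; ring.
  split.
    rewrite -subr_ge0 phiB mulr_ge0 ?(ltW M0)// sumr_ge0// => j _.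
    by rewrite mulr_ge0 ?sqr_ge0.
  have -> : P t - P s = \sum_(j < m.+1) d j * (ramp (M * t - j%:R) - ramp (M * s - j%:R)).
    by rewrite /P -sumrB; apply: eq_bigr => j _; rewrite mulrBr.
  apply: le_trans (sqr_weighted_sum_le (fun j : 'I_m.+1 => d j) w0) _.
  rewrite phiB sumrB !sumw; last 2 first.
  - by rewrite s0 (le_trans st).
  - by rewrite t1 andbT (le_trans s0).
  by rewrite le_eqVlt; apply/orP; left; apply/eqP; ring.
have [z zE] := energy_le_cadlag eP.
exists z; split; first by apply: eq_energy_le eP => t /zE.
move=> j t jm /andP[jt tj].
have t01 : 0 <= t <= 1.
  rewrite (le_trans _ jt)/= ?divr_ge0// ?(ltW M0)// (le_trans tj)// ler_pdivrMr// mul1r ler_nat//.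
rewrite zE// /P -(big_mkord xpredT (fun j => d j * ramp (M * t - j%:R))).
rewrite (big_cat_nat (n := j))//=; last exact: ltnW.
have jt' : j%:R <= M * t by rewrite mulrC -ler_pdivrMr.
have tj' : M * t <= j.+1%:R by rewrite mulrC -ler_pdivlMr.
rewrite (eq_big_nat _ _ (F2 := d)); last first.
  by move=> i /andP[_ ij]; rewrite rhigh ?mulr1// (le_trans _ jt')// ler_nat.
rewrite (telescope_sumr (fun j => Z (j%:R / M)))// mul0r Z0 subr0.
rewrite big_ltn// big_nat big1 => [|i /andP[ji _]]; last first.
  by rewrite rlow ?mulr0// (le_trans tj')// ler_nat.
rewrite addr0 [X in X - _]addrC addrK normrM -[leRHS]mulr1 ler_wpM2l//.
by have /andP[a b] := ramp_itv (M * t - j%:R); rewrite ger0_norm.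
Qed.

End polygon.

(** * Large deviations of finitely many increments *)

Section exponential_scale.
Variables (R : realType) (lam : nat -> R).
Hypothesis lam_y : lam n @[n --> \oo] --> +oo.

(** A number of events that does not depend on n costs nothing on the exponential
scale. *)
Lemma near_le_expR_speed (C eta : R) : 0 < eta ->
  \forall n \near \oo, C <= expR (lam n * eta).
Proof.
move=> eta0; have [C0|C0] := leP C 0.
  by apply: nearW => n; rewrite (le_trans C0)// expR_ge0.
have : \forall n \near \oo, ln C / eta <= lam n.
  by move/cvgryPge : lam_y; exact.
apply: filterS => n; rewrite ler_pdivrMr// => h.
by rewrite -[leLHS](lnK C0) ler_expR.
Qed.

End exponential_scale.

Section union_bound.
Context d (Omega : measurableType d) (R : realType) (P : probability Omega R).

Lemma union_bound (I : finType) (G : I -> set Omega) (b : R) :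
  (forall i, measurable (G i)) -> (forall i, (P (G i) <= b%:E)%E) ->
  (P (\big[setU/set0]_i G i) <= (#|I|%:R * b)%:E)%E.
Proof.
move=> mG Gb; have -> : #|I| = size (index_enum I).
  by rewrite -sum1_card -sum1_size; apply: eq_bigl.
elim: (index_enum I) => [|i s IH].
  by rewrite big_nil measure0 mul0r.
rewrite big_cons/= -natr1 mulrDl mul1r EFinD addeC.
apply: le_trans (measureU2 _ _ _) _; [exact: mG|exact: bigsetU_measurable|].
by rewrite leeD ?Gb.
Qed.

End union_bound.

Lemma measurable_set_ltr d (T : measurableType d) (R : realType) (f g : T -> R) :
  measurable_fun setT f -> measurable_fun setT g -> measurable [set w | f w < g w].
Proof.
move=> mf mg; have := measurable_fun_ltr mf mg measurableT (Y := [set true]).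
by rewrite setTI => /(_ I); congr (measurable _); apply/seteqP; split.
Qed.

Section finite_dimensional_ldp.
Context d (Omega : measurableType d) (R : realType) (P : probability Omega R).
Variables (lam : nat -> R) (m : nat) (Y : nat -> 'I_m -> Omega -> R) (v : R).
Hypothesis lam_gt0 : forall n, 0 < lam n.
Hypothesis lam_y : lam n @[n --> \oo] --> +oo.
Hypothesis v_gt0 : 0 < v.
Hypothesis mY : forall n j, measurable_fun setT (Y n j).

(** The Laplace transform of Y at the speed lam; up to
subexponential factors, the hypothesis below makes it that of a centred Gaussian
vector with independent components of variance v / lam. *)
Definition laplace n (theta : 'I_m -> R) : \bar R :=
  (\int[P]_w (expR (lam n * \sum_j theta j * Y n j w))%:E)%E.

Hypothesis laplaceP : forall theta eta, 0 < eta -> \forall n \near \oo,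
  ((expR (lam n * (v / 2 * \sum_j theta j ^+ 2 - eta)))%:E <= laplace n theta)%E /\
  (laplace n theta <= (expR (lam n * (v / 2 * \sum_j theta j ^+ 2 + eta)))%:E)%E.

Let mdot n theta : measurable_fun setT (fun w => \sum_j theta j * Y n j w).
Proof. by apply: measurable_sum => j; exact: measurable_funM. Qed.

Let mexp n theta (c : R) :
  measurable_fun setT (fun w => expR (lam n * (\sum_j theta j * Y n j w + c))).
Proof.
apply: measurableT_comp => //; apply: measurable_funM => //.
by apply: measurable_funD => //; exact: mdot.
Qed.

Let laplace_shift n theta c :
  (\int[P]_w (expR (lam n * (\sum_j theta j * Y n j w + c)))%:E =
   (expR (lam n * c))%:E * laplace n theta)%E.
Proof.
rewrite /laplace -ge0_integralZl//.
- by apply: eq_integral => w _; rewrite -EFinM -expRD -mulrDr addrC.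
- apply/measurable_EFinP; have := mexp n theta 0.
  by under eq_fun do rewrite addr0.
Qed.

Lemma chernoff n theta (c : R) :
  (P [set w | (c <= \sum_j theta j * Y n j w)%R] <=
   (expR (- (lam n * c)))%:E * laplace n theta)%E.
Proof.
have mE : measurable [set w | c <= \sum_j theta j * Y n j w].
  rewrite -[X in measurable X]setTI; apply: measurable_fun_le => //; exact: mdot.
rewrite -mulrN -laplace_shift -[X in P X]setIT -integral_indic//.
apply: ge0_le_integral => //.
- by apply/measurable_EFinP.
- by apply/measurable_EFinP; exact: mexp.
move=> w _; rewrite indicE lee_fin; case: (boolP (w \in _)) => [/set_mem/= h|_].
  by rewrite -[leLHS]expR0 ler_expR mulr_ge0 ?(ltW (lam_gt0 _))// subr_ge0.
exact: expR_ge0.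
Qed.

Lemma near_chernoff theta c eta : 0 < eta -> \forall n \near \oo,
  (P [set w | (c <= \sum_j theta j * Y n j w)%R] <=
   (expR (- (lam n * (c - v / 2 * \sum_j theta j ^+ 2 - eta))))%:E)%E.
Proof.
move=> eta0; have := laplaceP theta eta0; apply: filterS => n [_ h].
apply: le_trans (chernoff n theta c) _.
apply: le_trans (lee_wpmul2l _ h) _; first by rewrite lee_fin expR_ge0.
by rewrite -EFinM -expRD lee_fin ler_expR le_eqVlt; apply/orP; left; apply/eqP; ring.
Qed.

Let dirac_theta (j : 'I_m) (s : R) : 'I_m -> R := fun i => if i == j then s else 0.

Let sum_dirac j s (F : 'I_m -> R) : \sum_i dirac_theta j s i * F i = s * F j.
Proof.
rewrite (bigD1 j)//= /dirac_theta eqxx big1 ?addr0// => i /negbTE ->.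
by rewrite mul0r.
Qed.

(** The rate at y is the supremum over theta of an affine function of y; over a
bounded set a finite grid of theta almost attains it, so that Chernoff's bound
at the points of the grid is enough. *)
Lemma ldp_upper (alpha eta : R) : 0 <= alpha -> 0 < eta -> \forall n \near \oo,
  (P [set w | (2 * v * alpha < \sum_j (Y n j w) ^+ 2)%R] <=
   (expR (- (lam n * (alpha - eta))))%:E)%E.
Proof.
move=> alpha0 eta0; have eta40 : 0 < eta / 4 by rewrite divr_gt0.
pose B := alpha + v / 2 + eta / 4.
have B0 : 0 < B by rewrite /B; have := v_gt0; lra.
(* The mesh of the grid of values of Y is 1/N: the loss at the nearest point of
the grid is at most m / (2 v N), that is eta / 4. *)
pose N := (Num.truncn (m%:R / (2 * v) / (eta / 4))).+1.
have N0 : 0 < N%:R :> R by rewrite ltr0n.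
have Neta : m%:R / (2 * v) <= eta / 4 * N%:R.
  by rewrite [leRHS]mulrC -ler_pdivrMr// ltW// truncnS_gt.
pose K := (Num.truncn (2 * B * N%:R)).+1.
pose th (k : {ffun 'I_m -> 'I_K}) (j : 'I_m) : R := ((k j)%:R / N%:R - B) / v.
(* E k is the half-space cut by the tilt at the point k of the grid; the F sj
cover the complement of the box of size B. *)
pose E n k := [set w | v / 2 * \sum_j th k j ^+ 2 + alpha - eta / 4 <= \sum_j th k j * Y n j w].
pose F n (sj : bool * 'I_m) := [set w | B <= \sum_i dirac_theta sj.2 ((-1) ^+ sj.1) i * Y n i w].
have mE n k : measurable (E n k).
  rewrite -[X in measurable X]setTI; apply: measurable_fun_le => //; exact: mdot.
have mF n sj : measurable (F n sj).
  rewrite -[X in measurable X]setTI; apply: measurable_fun_le => //; exact: mdot.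
have mS n : measurable [set w | (2 * v * alpha < \sum_j (Y n j w) ^+ 2)%R].
  apply: measurable_set_ltr => //.
  by apply: measurable_sum => j; exact: measurable_funX.
have cover n : [set w | (2 * v * alpha < \sum_j (Y n j w) ^+ 2)%R] `<=`
    (\big[setU/set0]_k E n k) `|` (\big[setU/set0]_sj F n sj).
  move=> w /= Sw; have [YB|] := pselect (forall j, `|Y n j w| < B); last first.
    move=> /existsNP[j /negP]; rewrite -leNgt => Bj; right.
    rewrite -bigcup_seq; exists ((Y n j w < 0)%R, j); first by rewrite /= mem_index_enum.
    by rewrite /F/= sum_dirac/= -normrEsign.
  left; have Yj j : 0 <= (Y n j w + B) * N%:R /\ (Num.truncn ((Y n j w + B) * N%:R) < K)%N.
    have := YB j; rewrite ltr_norml => /andP[b1 b2].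
    have h : 0 <= (Y n j w + B) * N%:R by rewrite mulr_ge0//; lra.
    split => //; rewrite ltnS; apply: le_truncn.
    by rewrite ler_pM2r//; lra.
  pose k := [ffun j => Ordinal (Yj j).2].
  rewrite -bigcup_seq; exists k; first by rewrite /= mem_index_enum.
  have close j : (Y n j w - v * th k j) ^+ 2 <= N%:R^-1.
    have := truncn_itv (Yj j).1; rewrite -natr1 => /andP[h1 h2].
    rewrite /th mulrC divfK ?gt_eqF// /k ffunE/=.
    set t := (Num.truncn _)%:R in h1 h2 *.
    have e0 : 0 <= Y n j w - (t / N%:R - B).
      by rewrite subr_ge0 lerBlDr ler_pdivrMr.
    have e1 : Y n j w - (t / N%:R - B) <= N%:R^-1.
      rewrite opprB addrA lerBlDr -{1}(mul1r N%:R^-1) -mulrDl ler_pdivlMr//.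
      by rewrite [leRHS]addrC ltW.
    rewrite expr2 -[leRHS]mulr1; apply: ler_pM => //.
    by rewrite (le_trans e1)// invf_le1// ler1n.
  rewrite /E/=.
  (* The affine functions of Y in the definition of E are tangent to Y^2 / (2 v) at
  the points of the grid. *)
  have id j : th k j * Y n j w - v / 2 * th k j ^+ 2 =
      (Y n j w) ^+ 2 / (2 * v) - (Y n j w - v * th k j) ^+ 2 / (2 * v).
    by field; rewrite gt_eqF.
  rewrite -addrA addrC -lerBrDr mulr_sumr -sumrB (eq_bigr _ (fun j _ => id j)) sumrB -!mulr_suml.
  have : (\sum_j (Y n j w - v * th k j) ^+ 2) / (2 * v) <= eta / 4.
    apply: (@le_trans _ _ ((\sum_(j < m) N%:R^-1) / (2 * v))).
      by rewrite ler_pM2r ?invr_gt0 ?mulr_gt0//; apply: ler_sum => j _; exact: close.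
    by rewrite sumr_const card_ord -(mulr_natl N%:R^-1 m) mulrAC ler_pdivrMr.
  have : alpha <= (\sum_j (Y n j w) ^+ 2) / (2 * v).
    by rewrite ler_pdivlMr ?mulr_gt0// mulrC ltW.
  by lra.
have nearE : \forall n \near \oo, forall k, (P (E n k) <= (expR (- (lam n * (alpha - eta / 2))))%:E)%E.
  apply: filter_forall => k.
  have := near_chernoff (th k) (v / 2 * \sum_j th k j ^+ 2 + alpha - eta / 4) eta40.
  apply: filterS => n /le_trans; apply; rewrite lee_fin ler_expR lerN2.
  by rewrite ler_pM2l//; lra.
have nearF : \forall n \near \oo, forall sj, (P (F n sj) <= (expR (- (lam n * (alpha - eta / 2))))%:E)%E.
  apply: filter_forall => sj.
  have := near_chernoff (dirac_theta sj.2 ((-1) ^+ sj.1)) B eta40.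
  apply: filterS => n /le_trans; apply; rewrite lee_fin ler_expR lerN2.
  rewrite ler_pM2l//.
  rewrite (eq_bigr (fun i => dirac_theta sj.2 ((-1) ^+ sj.1) i * dirac_theta sj.2 ((-1) ^+ sj.1) i)); last by move=> i _; rewrite expr2.
  rewrite sum_dirac /dirac_theta eqxx -expr2 sqrr_sign mulr1 /B; lra.
pose C : R := (#|{ffun 'I_m -> 'I_K}| + #|{: bool * 'I_m}|)%N%:R.
have nearC := near_le_expR_speed lam_y C (divr_gt0 eta0 (ltr0Sn _ 1)).
near=> n; have hE := near nearE n; have hF := near nearF n.
have {}hE : forall k, (P (E n k) <= (expR (- (lam n * (alpha - eta / 2))))%:E)%E by near: n.
have {}hF : forall sj, (P (F n sj) <= (expR (- (lam n * (alpha - eta / 2))))%:E)%E by near: n.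
have hC : C <= expR (lam n * (eta / 2)) by near: n.
apply: le_trans (le_measure _ _ _ (cover n)) _; rewrite ?inE//.
  by apply: measurableU; apply: bigsetU_measurable.
apply: le_trans (measureU2 _ _ _) _; [exact: bigsetU_measurable..|].
apply: le_trans (leeD (union_bound (mE n) hE) (union_bound (mF n) hF)) _.
rewrite -EFinD -mulrDl -natrD -/C lee_fin.
apply: le_trans (ler_wpM2r (expR_ge0 _) hC) _.
by rewrite -expRD ler_expR le_eqVlt; apply/orP; left; apply/eqP; field.
Unshelve. all: by end_near. Qed.

(** Under the tilt by theta = y / v the vector Y concentrates at y: the tilted
mass of the complement of the ball has a smaller exponential rate, by a Chernoff
bound with a slightly larger or smaller tilt in one coordinate. On the ball the
tilt is nearly constant, and its cost is the rate at y. *)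
Lemma ldp_lower (y : 'I_m -> R) (r eta : R) : 0 < r -> 0 < eta -> \forall n \near \oo,
  ((expR (- (lam n * ((\sum_j y j ^+ 2) / (2 * v) + eta))))%:E <=
   P [set w | forall j, (`|Y n j w - y j| < r)%R])%E.
Proof.
move=> r0 eta0; pose th j := y j / v; pose S := \sum_j `|th j|.
have S0 : 0 <= S by exact: sumr_ge0.
have v8 : 0 < (8 * v)^-1 by rewrite invr_gt0 mulr_gt0.
pose D := S + (8 * v)^-1 + 1; have D0 : 0 < D by rewrite /D; lra.
pose r' := Num.min r (Num.min 1 (eta / 4 / D)).
have r'0 : 0 < r' by rewrite !lt_min r0 ltr01 !divr_gt0.
have r'r : r' <= r by rewrite ge_min lexx.
have r'1 : r' <= 1 by rewrite !ge_min lexx orbT.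
have r'D : r' * D <= eta / 4 by rewrite -ler_pdivlMr// !ge_min lexx !orbT.
pose e' := r' ^+ 2 / (8 * v).
have e'0 : 0 < e' by rewrite divr_gt0 ?exprn_gt0// mulr_gt0.
have small : r' * S + e' <= eta / 4.
  apply: le_trans r'D; rewrite /D !mulrDr mulr1 -addrA lerD2l.
  rewrite -[leLHS]addr0 lerD ?(ltW r'0)// /e' ler_wpM2r ?(ltW v8)//.
  by rewrite expr2 ler_piMr// ltW.
pose Q := v / 2 * \sum_j th j ^+ 2.
have QE : Q = (\sum_j y j ^+ 2) / (2 * v).
  rewrite /Q mulr_sumr mulr_suml; apply: eq_bigr => j _; rewrite /th.
  by field; rewrite gt_eqF.
have thyE : \sum_j th j * y j = 2 * Q.
  rewrite /Q !mulr_sumr; apply: eq_bigr => j _; rewrite /th.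
  by field; rewrite gt_eqF.
pose sg (sj : bool * 'I_m) : R := (-1) ^+ sj.1.
(* The tilt is increased by r' / v in the signed direction sj of a coordinate; c is
chosen so that the exponent is increased as soon as Y leaves the ball in this
direction, and its Laplace transform loses 4 e' against that of the tilt th. *)
pose th' sj i := th i + dirac_theta sj.2 (sg sj * (r' / v)) i.
pose c sj := - (r' / v * (r' + sg sj * y sj.2)).
pose G n sj w := expR (lam n * (\sum_i th' sj i * Y n i w + c sj)).
have dotE sj n w : \sum_i th' sj i * Y n i w =
    \sum_i th i * Y n i w + sg sj * (r' / v) * Y n sj.2 w.
  rewrite -(sum_dirac sj.2 (sg sj * (r' / v)) (fun i => Y n i w)) -big_split/=.
  by apply: eq_bigr => i _; rewrite -mulrDl.
have sqE sj : v / 2 * (\sum_i th' sj i ^+ 2) + c sj = Q - 4 * e'.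
  have -> : \sum_i th' sj i ^+ 2 = \sum_i th i ^+ 2 +
      (sg sj * (r' / v) * (2 * th sj.2) + sg sj * (r' / v) * (sg sj * (r' / v))).
    have -> : sg sj * (r' / v) * (sg sj * (r' / v)) =
        sg sj * (r' / v) * dirac_theta sj.2 (sg sj * (r' / v)) sj.2.
      by rewrite /dirac_theta eqxx.
    rewrite -(sum_dirac sj.2 (sg sj * (r' / v)) (fun i => 2 * th i)).
    rewrite -(sum_dirac sj.2 (sg sj * (r' / v)) (dirac_theta sj.2 (sg sj * (r' / v)))).
    by rewrite -!big_split/=; apply: eq_bigr => i _; rewrite /th'; ring.
  have sg2 : sg sj * sg sj = 1 by rewrite -expr2 sqrr_sign.
  rewrite mulrDr -/Q /c /e' /th.
  rewrite (_ : v / 2 * _ = sg sj * y sj.2 * r' / v + (sg sj * sg sj) * r' ^+ 2 / (2 * v)).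
    by rewrite sg2; field; rewrite gt_eqF.
  by field; rewrite gt_eqF.
pose A n := [set w | forall j, `|Y n j w - y j| < r'].
have mA n : measurable (A n).
  rewrite (_ : A n = \bigcap_(j in [set: 'I_m]) [set w | `|Y n j w - y j| < r']).
    apply: fin_bigcap_measurable => // j _; apply: measurable_set_ltr => //.
    by apply: measurableT_comp => //; exact: measurable_funB.
  by apply/seteqP; split => [w Aw j _|w Aw j]; [exact: Aw|exact: (Aw j I)].
pose C n := expR (lam n * (2 * Q + r' * S)).
have dom n w : expR (lam n * \sum_j th j * Y n j w) <= C n * \1_(A n) w + \sum_sj G n sj w.
  have G0 : 0 <= \sum_sj G n sj w by apply: sumr_ge0 => sj _; exact: expR_ge0.
  have [Aw|] := pselect (A n w).
    rewrite indicE mem_set// mulr1 -[leLHS]addr0 lerD// ler_expR ler_pM2l//.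
    rewrite -thyE /S mulr_sumr -big_split/=; apply: ler_sum => j _.
    rewrite -lerBlDl -mulrBr (le_trans (ler_norm _))// normrM mulrC ler_wpM2r//.
    by rewrite ltW//; exact: Aw.
  move=> /existsNP[j /negP]; rewrite -leNgt => h.
  pose sj : bool * 'I_m := ((Y n j w - y j < 0)%R, j).
  rewrite (bigD1 sj)//= addrCA -[leLHS]addr0 lerD//; last first.
    rewrite addr_ge0 ?sumr_ge0// => [|i _]; last exact: expR_ge0.
    by rewrite mulr_ge0 ?expR_ge0.
  rewrite ler_expR ler_pM2l// dotE/= -addrA lerDl /c/=.
  rewrite normrEsign -/(sg sj) in h.
  rewrite (_ : _ + _ = r' / v * (sg sj * (Y n j w - y j) - r')); last by ring.
  by rewrite mulr_ge0 ?divr_ge0 ?(ltW r'0) ?(ltW v_gt0)// subr_ge0.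
pose K : R := #|{: bool * 'I_m}|%:R.
have nearG : \forall n \near \oo, forall sj,
    (\int[P]_w (G n sj w)%:E <= (expR (lam n * (Q - 3 * e')))%:E)%E.
  apply: filter_forall => sj; have := laplaceP (th' sj) e'0.
  apply: filterS => n [_ h]; rewrite laplace_shift.
  apply: le_trans (lee_wpmul2l _ h) _; first by rewrite lee_fin expR_ge0.
  rewrite -EFinM -expRD lee_fin ler_expR -mulrDr ler_pM2l//.
  by have := sqE sj; lra.
have nearL := laplaceP th e'0.
have nearK := near_le_expR_speed lam_y (2 * K) (mulr_gt0 (ltr0Sn R 1) e'0).
have near2 := near_le_expR_speed lam_y 2 (divr_gt0 eta0 (ltr0Sn R 1)).
near=> n.
have hG : forall sj, (\int[P]_w (G n sj w)%:E <= (expR (lam n * (Q - 3 * e')))%:E)%E by near: n.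
have hL : ((expR (lam n * (Q - e')))%:E <= laplace n th)%E by near: n; apply: filterS nearL => n [].
have hK : 2 * K <= expR (lam n * (2 * e')) by near: n.
have h2 : 2 <= expR (lam n * (eta / 2)) by near: n.
have mG sj : measurable_fun setT (fun w => (G n sj w)%:E).
  by apply/measurable_EFinP; exact: mexp.
pose p := fine (P (A n)).
have pE : P (A n) = p%:E by rewrite /p fineK ?fin_num_measure.
have main : expR (lam n * (Q - e')) <= C n * p + K * expR (lam n * (Q - 3 * e')).
  rewrite -lee_fin; apply: le_trans hL _.
  apply: (@le_trans _ _ (\int[P]_w ((C n * \1_(A n) w)%:E + \sum_sj (G n sj w)%:E))%E).
    apply: ge0_le_integral => //.
    - by apply/measurable_EFinP; have := mexp n th 0; under eq_fun do rewrite addr0.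
    - apply: emeasurable_funD; first by apply/measurable_EFinP; exact: measurable_funM.
      exact: emeasurable_sum.
    - by move=> w _; rewrite sumEFin -EFinD lee_fin; exact: dom.
  have Gs0 w : (0 <= \sum_sj (G n sj w)%:E)%E.
    by apply: sume_ge0 => sj _; rewrite lee_fin expR_ge0.
  have mC : measurable_fun setT (fun w => (C n * \1_(A n) w)%:E).
    by apply/measurable_EFinP; exact: measurable_funM.
  have C1 w : setT w -> (0 <= (C n * \1_(A n) w)%:E)%E.
    by rewrite lee_fin mulr_ge0 ?expR_ge0.
  rewrite ge0_integralD//; last exact: emeasurable_sum.
  rewrite EFinD; apply: leeD.
    under eq_integral do rewrite EFinM.
    rewrite ge0_integralZl//; [|by apply/measurable_EFinP|by rewrite lee_fin expR_ge0].
    by rewrite integral_indic// setIT [X in (_ * X)%E]pE -EFinM.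
  rewrite ge0_integral_sum//; last by move=> sj x _; rewrite lee_fin expR_ge0.
  apply: (@le_trans _ _ (\sum_(sj : bool * 'I_m) (expR (lam n * (Q - 3 * e')))%:E)%E).
    by apply: lee_sum => sj _; exact: hG.
  by rewrite sumEFin sumr_const lee_fin -[leLHS]mulr_natl.
apply: (@le_trans _ _ (P (A n))); last first.
  apply: le_measure; rewrite ?inE//; last first.
    by move=> w /= Aw j; rewrite (lt_le_trans (Aw j)).
  rewrite [X in measurable X](_ : _ = \bigcap_(j in [set: 'I_m]) [set w | `|Y n j w - y j| < r]).
    apply: fin_bigcap_measurable => // j _; apply: measurable_set_ltr => //.
    by apply: measurableT_comp => //; exact: measurable_funB.
  by apply/seteqP; split => [w Aw j _|w Aw j]; [exact: Aw|exact: (Aw j I)].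
rewrite pE lee_fin -QE.
have C0 : 0 < C n := expR_gt0 _.
rewrite -(@ler_pM2l _ (2 * C n)) ?mulr_gt0//.
apply: (@le_trans _ _ (expR (lam n * (Q - e')))).
  rewrite -(@ler_pM2r _ (expR (lam n * (eta / 2)))) ?expR_gt0//.
  apply: (@le_trans _ _ (2 * expR (lam n * (Q - e')))); last first.
    by rewrite mulrC ler_wpM2l ?expR_ge0.
  rewrite -!mulrA ler_pM2l// /C -!expRD ler_expR -mulrN -!mulrDr ler_pM2l//.
  by lra.
have hh : K * expR (lam n * (Q - 3 * e')) <= expR (lam n * (Q - e')) / 2.
  rewrite ler_pdivlMr// mulrAC mulrC mulrA mulrC (_ : lam n * (Q - e') = lam n * (Q - 3 * e') + lam n * (2 * e')); last by ring.
  by rewrite expRD mulrCA ler_wpM2l ?expR_ge0.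
by move: main hh; set a := C n * p; rewrite -mulrA -/a; lra.
Unshelve. all: by end_near. Qed.

End finite_dimensional_ldp.

(** * From increments to processes *)

Section process_ldp.
Context d (Omega : measurableType d) (R : realType) (P : probability Omega R).
Variables (lam : nat -> R) (Z : nat -> Omega -> cadlag R) (sigma : R).
Hypothesis lam_gt0 : forall n, 0 < lam n.
Hypothesis lam_y : lam n @[n --> \oo] --> +oo.
Hypothesis sigma_gt0 : 0 < sigma.
Hypothesis Z0 : forall n w, Z n w 0 = 0.
Hypothesis mZt : forall n t, measurable_fun setT (fun w => Z n w t).
Hypothesis mZ : forall n (G : set (cadlag R)), <<s (@open (cadlag R)) >> G ->
  measurable [set w | G (Z n w)].

Definition grid_increment m n (j : 'I_m.+1) w : R :=
  Z n w (j.+1%:R / m.+1%:R) - Z n w (j%:R / m.+1%:R).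

(** The increments of the limiting Brownian motion with variance sigma^2 on a
regular grid, on the level of Laplace transforms. *)
Definition laplace_asymptotics := forall m (theta : 'I_m.+1 -> R) (eta : R), 0 < eta ->
  \forall n \near \oo,
    ((expR (lam n * (sigma ^+ 2 / m.+1%:R / 2 * \sum_j theta j ^+ 2 - eta)))%:E <=
     laplace P lam (@grid_increment m) n theta)%E /\
    (laplace P lam (@grid_increment m) n theta <=
     (expR (lam n * (sigma ^+ 2 / m.+1%:R / 2 * \sum_j theta j ^+ 2 + eta)))%:E)%E.

(** Replacing a path by its values on a grid costs no probability at the speed
lam: the grid is refined first, depending on the accuracy r and on the rate K,
and n tends to infinity afterwards. *)
Definition small_oscillations := forall r K : R, 0 < r -> \forall m \near \oo,
  \forall n \near \oo, exists E : set Omega,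
    [/\ measurable E, (P E <= (expR (- (lam n * K)))%:E)%E &
      forall w, ~ E w -> forall (j : nat) t, (j < m.+1)%N ->
        j%:R / m.+1%:R <= t <= j.+1%:R / m.+1%:R ->
        `|Z n w t - Z n w (j%:R / m.+1%:R)| <= r].

Hypothesis laplaceZ : laplace_asymptotics.
Hypothesis oscZ : small_oscillations.

Let mY m n (j : 'I_m.+1) : measurable_fun setT (grid_increment n j).
Proof. exact: measurable_funB. Qed.

Let v m := sigma ^+ 2 / m.+1%:R.

Let v_gt0 m : 0 < v m.
Proof. by rewrite divr_gt0 ?exprn_gt0. Qed.

(** The last cell is closed: it contains t = 1. *)
Let unit_cell m (t : R) : 0 <= t <= 1 -> exists2 j : nat, (j < m.+1)%N &
  j%:R / m.+1%:R <= t <= j.+1%:R / m.+1%:R.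
Proof.
move=> /andP[t0 t1]; have m0 : 0 < m.+1%:R :> R by rewrite ltr0n.
have [->|tn1] := eqVneq t 1.
  exists m => //; rewrite divff ?gt_eqF// lexx andbT.
  by rewrite ler_pdivrMr// mul1r ler_nat.
have tm0 : 0 <= t * m.+1%:R by rewrite mulr_ge0.
exists (Num.truncn (t * m.+1%:R)).
  by rewrite truncn_lt_nat// -[ltRHS]mul1r ltr_pM2r// lt_neqAle tn1.
have /andP[a b] := truncn_itv tm0.
by rewrite ler_pdivrMr// ler_pdivlMr// a ltW.
Qed.

(** The level set and C are at a positive distance r. When Z oscillates little on
the cells, it is within r of the polygon through its values on the grid; if Z is
in C this polygon is out of the level set, so that the energy of the increments
on the grid is large, which [ldp_upper] makes unlikely. *)
Lemma process_upper (C G : set (cadlag R)) (alpha eta : R) :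
  closed C -> <<s (@open (cadlag R)) >> G -> G `<=` C -> 0 <= alpha -> 0 < eta ->
  (forall x, C x -> (alpha%:E < rate sigma x)%E) ->
  \forall n \near \oo,
    (P [set w | G (Z n w)] <= (expR (- (lam n * (alpha - eta))))%:E)%E.
Proof.
move=> clC mG GC alpha0 eta0 rC; pose c := 2 * sigma ^+ 2 * alpha.
have s0 : sigma != 0 by rewrite gt_eqF.
have [r r0 Hr] : exists2 r : R, 0 < r & forall x y : cadlag R,
    energy_le x c -> ball x r y -> ~ C y.
  apply: (compact_closed_separated (@compact_energy_le R c) clC).
  apply/seteqP; split => // x [/= /(energy_le_rate x alpha s0) rx /rC].
  by rewrite ltNge rx.
have r40 : 0 < r / 4 by rewrite divr_gt0.
have [m Hosc] := filter_ex (oscZ alpha r40).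
have m0 : 0 < m.+1%:R :> R by rewrite ltr0n.
have Hfd := ldp_upper lam_gt0 lam_y (v_gt0 m) (@mY m) (@laplaceZ m) alpha0
  (divr_gt0 eta0 (ltr0Sn R 1)).
have H2 := near_le_expR_speed lam_y 2 (divr_gt0 eta0 (ltr0Sn R 1)).
near=> n.
have [E [mE PE HE]] : exists E : set Omega,
    [/\ measurable E, (P E <= (expR (- (lam n * alpha)))%:E)%E &
      forall w, ~ E w -> forall (j : nat) t, (j < m.+1)%N ->
        j%:R / m.+1%:R <= t <= j.+1%:R / m.+1%:R ->
        `|Z n w t - Z n w (j%:R / m.+1%:R)| <= r / 4] by near: n.
have PF : (P [set w | (2 * v m * alpha < \sum_(j < m.+1) (grid_increment n j w) ^+ 2)%R] <=
   (expR (- (lam n * (alpha - eta / 2))))%:E)%E by near: n.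
have h2 : 2 <= expR (lam n * (eta / 2)) by near: n.
set F := [set w | _] in PF.
have mF : measurable F.
  apply: measurable_set_ltr => //.
  by apply: measurable_sum => j; apply: measurable_funX; exact: mY.
have sub : [set w | G (Z n w)] `<=` E `|` F.
  move=> w /= /GC CZ; apply: contrapT => /not_orP[nE nF].
  have [z [ez zZ]] := polygonal_approximation m (Z0 n w).
  have cz : energy_le z c.
    case: ez => z0 [phi [p0 p1 H]]; split => //; exists phi; split => //.
    apply: le_trans p1 _; rewrite -mulr_sumr /c.
    move: nF; rewrite /F/= => /negP; rewrite -leNgt => nF.
    rewrite mulrC -ler_pdivlMr//; apply: le_trans nF _.
    by rewrite /v le_eqVlt; apply/orP; left; apply/eqP; field; rewrite nat1r gt_eqF.
  apply: (Hr z (Z n w)) => //; apply: (@skorohod_ball_sup _ _ _ _ (r / 2)); first by lra.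
  move=> t /(unit_cell m)[j jm jt].
  have h1 := zZ j t jm jt; have h3 := HE w nE j t jm jt.
  have h4 := HE w nE j (j.+1%:R / m.+1%:R) jm.
  have {}h4 := h4 ltac:(by rewrite lexx andbT ler_pM2r ?invr_gt0// ler_nat).
  have {}h1 := le_trans h1 h4.
  move: h1 h3; rewrite !ler_norml => /andP[? ?] /andP[? ?].
  by apply/andP; split; lra.
apply: le_trans (le_measure P _ _ sub) _; rewrite ?inE; first exact: mZ.
  exact: measurableU.
apply: le_trans (measureU2 _ mE mF) _; apply: le_trans (leeD PE PF) _.
rewrite -EFinD lee_fin.
apply: (@le_trans _ _ (2 * expR (- (lam n * (alpha - eta / 2))))).
  rewrite mulrDl !mul1r lerD2r ler_expR lerN2 ler_pM2l//.
  by rewrite gerBl divr_ge0// ltW.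
apply: le_trans (ler_wpM2r (expR_ge0 _) h2) _.
by rewrite -expRD ler_expR le_eqVlt; apply/orP; left; apply/eqP; field.
Unshelve. all: by end_near. Qed.

(** The increments of x on a grid have a rate at most that of x. If those of Z are
close to them and Z oscillates little on the cells, then Z is close to x. *)
Lemma process_lower (U G : set (cadlag R)) (x : cadlag R) (alpha eta : R) :
  open U -> <<s (@open (cadlag R)) >> G -> U `<=` G -> U x ->
  (rate sigma x <= alpha%:E)%E -> 0 < eta ->
  \forall n \near \oo,
    ((expR (- (lam n * (alpha + eta))))%:E <= P [set w | G (Z n w)])%E.
Proof.
move=> oU mG UG Ux rx eta0; have s0 : sigma != 0 by rewrite gt_eqF.
have ex := (energy_le_rate x alpha s0).1 rx; set c := 2 * sigma ^+ 2 * alpha in ex.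
have [r /= r0 Hr] : exists2 r : R, 0 < r & ball x r `<=` U.
  have /nbhs_ballP[r /= r0 Hr] := open_nbhs_nbhs (conj oU Ux).
  by exists r.
have r50 : 0 < r / 5 by rewrite divr_gt0.
have alpha0 : 0 <= alpha.
  have := energy_le_ge0 ex; rewrite /c pmulr_rge0// mulr_gt0// exprn_gt0//.
have nearm : \forall m \near \oo, c < (r / 5) ^+ 2 * m.+1%:R.
  near=> m; rewrite mulrC -ltr_pdivrMr ?exprn_gt0//.
  have : c / (r / 5) ^+ 2 < m%:R by near: m; exact: nbhs_infty_gtr.
  by move/lt_trans; apply; rewrite ltr_nat.
have [m [cm Hosc]] := filter_ex (filterI nearm (oscZ (alpha + eta) r50)).
have m0 : 0 < m.+1%:R :> R by rewrite ltr0n.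
pose y (j : 'I_m.+1) := x (j.+1%:R / m.+1%:R) - x (j%:R / m.+1%:R).
have rm0 : 0 < r / 5 / m.+1%:R by rewrite divr_gt0.
(* The m+1 errors on the increments add up to at most r / 5. *)
have Hfd := ldp_lower lam_gt0 lam_y (v_gt0 m) (@mY m) (@laplaceZ m) y rm0
  (divr_gt0 eta0 (ltr0Sn R 1)).
have H2 := near_le_expR_speed lam_y 2 (divr_gt0 eta0 (ltr0Sn R 1)).
have yJ : (\sum_j y j ^+ 2) / (2 * v m) <= alpha.
  have [_ [phi [p0 p1 H]]] := ex.
  rewrite ler_pdivrMr ?mulr_gt0//.
  have -> : alpha * (2 * v m) = m.+1%:R^-1 * c by rewrite /v /c; field; rewrite nat1r gt_eqF.
  apply: (@le_trans _ _ (\sum_(j < m.+1) m.+1%:R^-1 * (phi (j.+1%:R / m.+1%:R) - phi (j%:R / m.+1%:R)))).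
    apply: ler_sum => j _.
    have [_] := H (j%:R / m.+1%:R) (j.+1%:R / m.+1%:R) ltac:(by rewrite divr_ge0)
      ltac:(by rewrite ler_pM2r ?invr_gt0// ler_nat)
      ltac:(by rewrite ler_pdivrMr// mul1r ler_nat).
    by rewrite -mulrBl -natrB// subSnn mul1r.
  rewrite -mulr_sumr ler_pM2l ?invr_gt0//.
  rewrite -(big_mkord xpredT (fun j => phi (j.+1%:R / m.+1%:R) - phi (j%:R / m.+1%:R))).
  by rewrite (telescope_sumr (fun j => phi (j%:R / m.+1%:R)))// mul0r p0 subr0 divff ?gt_eqF.
near=> n.
have [E [mE PE HE]] : exists E : set Omega,
    [/\ measurable E, (P E <= (expR (- (lam n * (alpha + eta))))%:E)%E &
      forall w, ~ E w -> forall (j : nat) t, (j < m.+1)%N ->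
        j%:R / m.+1%:R <= t <= j.+1%:R / m.+1%:R ->
        `|Z n w t - Z n w (j%:R / m.+1%:R)| <= r / 5] by near: n.
have PA : ((expR (- (lam n * ((\sum_j y j ^+ 2) / (2 * v m) + eta / 2))))%:E <=
   P [set w | forall j, (`|grid_increment n j w - y j| < r / 5 / m.+1%:R)%R])%E by near: n.
have h2 : 2 <= expR (lam n * (eta / 2)) by near: n.
set A := [set w | _] in PA.
have mA : measurable A.
  rewrite (_ : A = \bigcap_(j in [set: 'I_m.+1]) [set w | `|grid_increment n j w - y j| < r / 5 / m.+1%:R]).
    apply: fin_bigcap_measurable => // j _; apply: measurable_set_ltr => //.
    by apply: measurableT_comp => //; apply: measurable_funB => //; exact: mY.
  by apply/seteqP; split => [w Aw j _|w Aw j]; [exact: Aw|exact: (Aw j I)].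
have sub : A `<=` [set w | G (Z n w)] `|` E.
  move=> w Aw; have [Ew|nE] := pselect (E w); [by right|left].
  apply/UG/Hr; apply: (@skorohod_ball_sup _ _ _ _ (3 * (r / 5))); first by lra.
  move=> t /[dup] t01 /(unit_cell m)[j jm jt].
  have h3 := HE w nE j t jm jt.
  have jle : (j <= m.+1)%N by exact: ltnW.
  have grid : `|x (j%:R / m.+1%:R) - Z n w (j%:R / m.+1%:R)| <= r / 5.
    have : `|x (j%:R / m.+1%:R) - Z n w (j%:R / m.+1%:R)| <= j%:R * (r / 5 / m.+1%:R).
      elim: j {jm jt h3} jle => [_|j IH jm]; first by rewrite !mul0r Z0 (ex.1) subrr normr0.
      have hA := Aw (Ordinal jm); rewrite /grid_increment /y/= in hA.
      rewrite -[j.+1%:R * (r / 5 / m.+1%:R)](_ : (r / 5 / m.+1%:R) + j%:R * (r / 5 / m.+1%:R) = _); last by rewrite -natr1; ring.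
      apply: le_trans (lerD (ltW hA) (IH (ltnW jm))).
      rewrite -normrN; apply: le_trans (ler_normB _ _).
      by rewrite le_eqVlt; apply/orP; left; apply/eqP; congr (`|_|); ring.
    move/le_trans; apply; rewrite mulrCA ler_piMr ?(ltW r50)//.
    by rewrite ler_pdivrMr// mul1r ler_nat.
  have xt : `|x t - x (j%:R / m.+1%:R)| <= r / 5.
    apply: (energy_le_close ex r50 _ t01 cm) => //.
      by rewrite divr_ge0//= ler_pdivrMr// mul1r ler_nat.
    move: jt => /andP[jt tj]; rewrite ger0_norm ?subr_ge0// lerBlDl (le_trans tj)//.
    by rewrite -natr1 mulrDl mul1r.
  move: h3 grid xt; rewrite !ler_norml => /andP[? ?] /andP[? ?] /andP[? ?].
  by apply/andP; split; lra.
have mG' : measurable [set w | G (Z n w)] by exact: mZ.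
have : (P A <= P [set w | G (Z n w)] + P E)%E.
  apply: le_trans (measureU2 _ mG' mE); apply: le_measure; rewrite ?inE//.
  exact: measurableU.
have pE : P [set w | G (Z n w)] = (fine (P [set w | G (Z n w)]))%:E.
  by rewrite fineK ?fin_num_measure.
have eE : P E = (fine (P E))%:E by rewrite fineK ?fin_num_measure.
have aE : P A = (fine (P A))%:E by rewrite fineK ?fin_num_measure.
move: PE PA; rewrite pE eE aE -EFinD !lee_fin => PE PA hsum.
have : 2 * expR (- (lam n * (alpha + eta))) <= fine (P A).
  apply: le_trans PA; rewrite -[leRHS]mul1r.
  apply: le_trans (ler_wpM2r (expR_ge0 _) h2) _.
  rewrite -expRD mul1r ler_expR -mulrN -mulrN -mulrDr ler_pM2l//.
  by lra.
by lra.
Unshelve. all: by end_near. Qed.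

End process_ldp.

Lemma eq_cadlag (R : realType) (x y : cadlag R) :
  cadlag_fun x = cadlag_fun y -> x = y.
Proof.
case: x y => f p1 p2 p3 [g q1 q2 q3] /= E; subst g.
by rewrite (Prop_irrelevance p1 q1) (Prop_irrelevance p2 q2) (Prop_irrelevance p3 q3).
Qed.

Lemma rate_ge0 (R : realType) (sigma : R) (x : cadlag R) : (0 <= rate sigma x)%E.
Proof.
rewrite /rate; case: ifPn => [_|s0]; case: asboolP => // _.
rewrite mule_ge0//; last by apply: integral_ge0 => t _; rewrite lee_fin sqr_ge0.
by rewrite lee_fin invr_ge0 mulr_ge0 ?sqr_ge0.
Qed.

Section mdp_conclusion.
Context d (Omega : measurableType d) (R : realType) (P : probability Omega R).
Variables (W : nat -> Omega -> cadlag R) (a_ : nat -> R).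
Hypothesis a_gt0 : forall n, 0 < a_ n.
Local Notation Z := (fun n w => cadlag_scale (Num.sqrt (a_ n)) (W n w)).
Hypothesis mZ : forall n (G : set (cadlag R)), <<s (@open (cadlag R)) >> G ->
  measurable [set w | G (Z n w)].
Local Open Scope ereal_scope.

Let scaled_log_le (a b : R) (p : \bar R) : (0 < a)%R -> p <= (expR (- (a^-1 * b)))%:E ->
  a%:E * lne p <= (- b)%:E.
Proof.
move=> a0; have [p0 _|p0] := leP p 0.
  by rewrite le0_lneNy// gt0_muleNy ?lte_fin// leNye.
case: p p0 => [p| |]//; rewrite lte_fin lee_fin => p0 ple.
rewrite lne_EFin// -EFinM lee_fin mulrC -ler_pdivlMr// mulrC mulrN.
by rewrite -[leRHS]expRK ler_ln// posrE expR_gt0.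
Qed.

Let scaled_log_ge (a b : R) (p : \bar R) : (0 < a)%R -> (expR (- (a^-1 * b)))%:E <= p ->
  (- b)%:E <= a%:E * lne p.
Proof.
move=> a0 ple; have p0 : 0 < p by rewrite (lt_le_trans _ ple)// lte_fin expR_gt0.
case: p p0 ple => [p| |]//; last by rewrite gt0_muley ?leey// lte_fin.
rewrite lte_fin lee_fin => p0 ple.
rewrite lne_EFin// -EFinM lee_fin mulrC -ler_pdivrMr// mulrC mulrN.
by rewrite -[leLHS]expRK ler_ln// posrE expR_gt0.
Qed.

Let p_le0 n (G : set (cadlag R)) : <<s (@open (cadlag R)) >> G ->
  (a_ n)%:E * lne (P [set w | G (Z n w)]) <= 0.
Proof.
move=> mG; rewrite -[leRHS]/(0%:E) -[X in _ <= X%:E]oppr0; apply: scaled_log_le => //.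
by rewrite mulr0 oppr0 expR0; apply: probability_le1; exact: mZ.
Qed.

(** The two bounds at all levels alpha and all accuracies eta, and the level sets of
the rate as level sets of the energy. *)
Lemma MDP_of_estimates (sigma : R) : (0 < sigma)%R ->
  a_ n @[n --> \oo] --> 0%R -> (forall n w, W n w 0 = 0)%R ->
  (forall n t, measurable_fun setT (fun w => Z n w t)) ->
  laplace_asymptotics P (fun n => (a_ n)^-1)%R Z sigma ->
  small_oscillations P (fun n => (a_ n)^-1)%R Z ->
  MDP P W a_ (rate sigma).
Proof.
move=> sigma0 a0 W0 mZt lapZ oscZ; have s0 : sigma != 0%R by rewrite gt_eqF.
have lam0 n : (0 < (a_ n)^-1)%R by rewrite invr_gt0.
have lamy : ((a_ n)^-1)%R @[n --> \oo] --> +oo%R.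
  apply/cvgryPge => A; have A0 : (0 < (`|A| + 1)^-1)%R by rewrite invr_gt0 ltr_wpDl.
  have : \forall n \near \oo, (`|a_ n| < (`|A| + 1)^-1)%R.
    by move/cvgr0Pnorm_lt : a0; exact.
  apply: filterS => n; rewrite gtr0_norm// => an.
  have : (`|A| + 1 <= (a_ n)^-1)%R.
    by rewrite -[leLHS]invrK lef_pV2 ?posrE// ltW.
  by apply: le_trans; rewrite (le_trans (ler_norm _))// lerDl.
have Z0 n w : Z n w 0%R = 0%R by rewrite /= W0 mulr0.
split.
  move=> alpha; rewrite (_ : [set x | _] = [set x : cadlag R | energy_le x (2 * sigma ^+ 2 * alpha)]).
    exact: compact_energy_le.
  by apply/seteqP; split => x /= /(energy_le_rate x alpha s0).
move=> G mG; split; last 1 first.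
- suff up (alpha : R) : alpha%:E < ereal_inf (rate sigma @` closure G) ->
      limn_esup (fun n => (a_ n)%:E * lne (P [set w | G (Z n w)])) <= (- alpha)%:E.
    rewrite leeNr; case E : (ereal_inf _) => [b| |]; last by rewrite leNye.
      apply/lee_addgt0Pr => e e0; rewrite -leeBlDr// leeNr -EFinB -EFinN.
      by apply: up; rewrite E lte_fin gtrBl.
    rewrite leye_eq; apply/eqP/eqyP => A A0; rewrite leeNr -EFinN.
    by apply: up; rewrite E ltry.
  move=> ltx; have [alpha0|alpha0] := leP 0%R alpha; last first.
    apply: limn_esup_le; apply: nearW => n; apply: le_trans (p_le0 n mG) _.
    by rewrite lee_fin oppr_ge0 ltW.
  apply/lee_addgt0Pr => e e0; apply: limn_esup_le.
  have := process_upper lam0 lamy sigma0 Z0 mZt mZ lapZ oscZ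
    (@closed_closure _ G) mG (@subset_closure _ G) alpha0 e0.
  move=> /(_ _)[|N _ HN].
    by move=> x Gx; apply: lt_le_trans ltx _; apply: ereal_inf_lbound; exists x.
  exists N => // n /= /HN /(scaled_log_le (a_gt0 n)); rewrite opprB addrC.
  by rewrite -EFinD.
- rewrite leeNl; apply: le_ereal_inf_tmp => /= _ [x Gx <-]; rewrite leeNl.
  case E : (rate sigma x) => [b| |]; last 2 first.
  + by rewrite leNye.
  + by have := rate_ge0 sigma x; rewrite E.
  apply/lee_addgt0Pr => e e0; rewrite -leeBlDr// -EFinN -EFinB; apply: limn_einf_ge.
  have := process_lower lam0 lamy sigma0 Z0 mZt mZ lapZ oscZ
    (@open_interior _ G) mG (@interior_subset _ G) Gx _ e0.
  move=> /(_ b)[|N _ HN]; first by rewrite E.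
  exists N => // n /= /HN /(scaled_log_ge (a_gt0 n)).
  by rewrite opprD.
exact: limn_einf_sup.
Qed.

(** When W vanishes almost surely the law is the Dirac mass at the null path, and
the logarithms of the probabilities are 0 or -oo. *)
Lemma MDP_degenerate (N : set Omega) : measurable N -> P N = 0 ->
  (forall n w t, ~ N w -> (0 <= t <= 1)%R -> (W n w t = 0)%R) ->
  MDP P W a_ (rate (0 : R)).
Proof.
move=> mN N0 W0.
pose zero : cadlag R := cadlag_step (fun=> 0%R) 0.
have zeroE t : zero t = 0%R by rewrite /= /step_fun; case: ifP.
have ext (x : cadlag R) : (forall t, (0 <= t <= 1)%R -> x t = 0%R) -> x = zero.
  move=> H; apply: eq_cadlag; apply/funext => t; rewrite zeroE.
  have [t01|t01] := boolP (t \in `[0%R, 1%R]).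
    by apply: H; rewrite in_itv in t01.
  exact: cadlag_out.
have Z0 n w : ~ N w -> Z n w = zero.
  by move=> Nw; apply: ext => t t01 /=; rewrite (W0 n w)// mulr0.
have rate0 : rate 0%R zero = 0 by rewrite /rate eqxx asboolT// => t _; exact: zeroE.
have rate_oo (x : cadlag R) : rate 0%R x < +oo -> x = zero.
  rewrite /rate eqxx; case: asboolP => // H _; apply: ext => t t01; apply: H.
  by rewrite in_itv.
split.
  move=> alpha; have [A0|/set0P[x Ax]] := eqVneq [set x : cadlag R | rate 0%R x <= alpha%:E] set0.
    by rewrite A0; exact: compact0.
  have xz : x = zero by apply: rate_oo; apply: le_lt_trans Ax _; exact: ltry.
  rewrite (_ : [set x | _] = [set zero]); first exact: compact_set1.
  apply/seteqP; split => [y /= Ay|y /= ->]; last by rewrite -xz.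
  by apply: rate_oo; apply: le_lt_trans Ay _; exact: ltry.
move=> G mG.
have [Gz|Gz] := pselect (G zero).
  have pE n : (a_ n)%:E * lne (P [set w | G (Z n w)]) = 0.
    suff -> : P [set w | G (Z n w)] = 1 by rewrite lne1 mule0.
    apply/eqP; rewrite eq_le probability_le1/=; last exact: mZ.
    have mNC : measurable (~` N) by exact: measurableC.
    have <- : P (~` N) = 1 by rewrite probability_setC// N0 sube0.
    by apply: le_measure; rewrite ?inE//; [exact: mZ|move=> w Nw; rewrite /= Z0].
  rewrite (_ : (fun n => _) = cst 0); last by apply/funext => n; exact: pE.
  have cv : (cst 0 : (\bar R)^nat) n @[n --> \oo] --> 0 by exact: cvg_cst.
  rewrite !(cvg_limn_einf_sup cv); split => //.
    rewrite leeNl oppe0; apply: le_ereal_inf_tmp => _ [x _ <-]; exact: rate_ge0.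
  rewrite leeNr oppe0; apply: ereal_inf_lbound; exists zero => //.
  exact: subset_closure.
have pE n : (a_ n)%:E * lne (P [set w | G (Z n w)]) = -oo.
  suff -> : P [set w | G (Z n w)] = 0 by rewrite le0_lneNy// gt0_muleNy ?lte_fin.
  apply/eqP; rewrite eq_le measure_ge0 andbT -N0.
  apply: le_measure; rewrite ?inE//; first exact: mZ.
  by move=> w /= GZ; apply: contrapT => Nw; move: GZ; rewrite Z0.
rewrite (_ : (fun n => _) = cst -oo); last by apply/funext => n; exact: pE.
have cv : (cst -oo : (\bar R)^nat) n @[n --> \oo] --> -oo by exact: cvg_cst.
rewrite !(cvg_limn_einf_sup cv); split => //; last exact: leNye.
rewrite leeNl; apply: le_ereal_inf_tmp => _ [x Gx <-].
have [|] := ltP (rate 0%R x) +oo; last by [].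
by move=> /rate_oo xz; exfalso; apply: Gz; rewrite -xz; exact: interior_subset.
Qed.

End mdp_conclusion.

(** * The random walk on the torus and its Markov property *)

Section rotation.
Variable R : realType.

(** Universal property of the quotient topology. *)
Lemma continuous_torus (T : topologicalType) (f : torus R -> T) :
  continuous (f \o @torus_pi R) -> continuous f.
Proof.
by move=> cf; apply/quotient_continuous.
Qed.

Lemma continuous_rot (a : R) : continuous (@Defs.rot R a).
Proof.
apply: continuous_torus.
rewrite (_ : _ \o _ = @torus_pi R \o (fun x => x + a)); last first.
  by apply/funext => x /=; rewrite rot_pi.
move=> x; apply: continuous_comp; last exact: pi_continuous.
by apply: cvgD; [exact: cvg_id|exact: cvg_cst].
Qed.

Lemma measurable_rot (a : R) : measurable_fun setT (@Defs.rot R a).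
Proof.
apply: (measurability (@open (torus R))) => //.
move=> _ [A oA <-]; rewrite setTI; apply: sub_sigma_algebra.
by move/continuousP : (@continuous_rot a); apply.
Qed.

Lemma continuous_measurable_torus (f : torus R -> R) : continuous f ->
  measurable_fun setT f.
Proof.
move=> cf; apply: (measurability _ (measurable_realfun.RGenOpens.measurableE R)) => //.
move=> _ [_ [x [y ->]] <-]; rewrite setTI; apply: sub_sigma_algebra.
by move/continuousP : cf; apply; exact: interval_open.
Qed.

End rotation.

Section bounded_measurable.
Context d (T : measurableType d) (R : realType).

Definition bounded_measurable (f : T -> R) : Prop :=
  measurable_fun setT f /\ exists M, forall x, `|f x| <= M.

Lemma bounded_measurableD f g : bounded_measurable f -> bounded_measurable g ->
  bounded_measurable (fun x => f x + g x).
Proof.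
move=> [mf [M Mf]] [mg [N Ng]]; split; first exact: measurable_funD.
by exists (M + N) => x; rewrite (le_trans (ler_normD _ _))// lerD.
Qed.

Lemma bounded_measurableM f g : bounded_measurable f -> bounded_measurable g ->
  bounded_measurable (fun x => f x * g x).
Proof.
move=> [mf [M Mf]] [mg [N Ng]]; split; first exact: measurable_funM.
by exists (M * N) => x; rewrite normrM ler_pM.
Qed.

Lemma bounded_measurable_cst c : bounded_measurable (fun=> c).
Proof. by split; [exact: measurable_cst|exists `|c|]. Qed.

Lemma bounded_measurable_expR f : bounded_measurable f ->
  bounded_measurable (fun x => expR (f x)).
Proof.
move=> [mf [M Mf]]; split; first exact: measurableT_comp.
exists (expR M) => x; rewrite ger0_norm ?expR_ge0// ler_expR.
exact: le_trans (ler_norm _) _.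
Qed.

Lemma bounded_measurable_indic (A : set T) : measurable A ->
  bounded_measurable (\1_A : T -> R).
Proof.
move=> mA; split; first exact: measurable_indic.
by exists 1 => x; rewrite indicE; case: (_ \in _); rewrite ?normr1 ?normr0.
Qed.

Lemma bounded_measurable_sum (I : Type) (s : seq I) (f : I -> T -> R) :
  (forall i, bounded_measurable (f i)) -> bounded_measurable (fun x => \sum_(i <- s) f i x).
Proof.
move=> bf; elim: s => [|i s IH].
  by under eq_fun do rewrite big_nil; exact: bounded_measurable_cst.
by under eq_fun do rewrite big_cons; exact: bounded_measurableD.
Qed.

Lemma bounded_measurable_integrable (P : probability T R) f :
  bounded_measurable f -> P.-integrable setT (EFin \o f).
Proof.
move=> [mf [M Mf]]; apply: measurable_bounded_integrable => //.
  by rewrite (le_lt_trans (probability_le1 _ _))// ltry.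
exists M; split; rewrite ?num_real// => N MN x _.
by apply: le_trans (Mf x) _; exact: ltW.
Qed.

Lemma Rintegral_bounded_le (P : probability T R) f M : bounded_measurable f ->
  (forall x, `|f x| <= M) -> `|\int[P]_x f x| <= M.
Proof.
move=> bf fM; have bi := bounded_measurable_integrable P bf.
apply: le_trans (le_normr_Rintegral _ bi) _ => //.
apply: (@le_trans _ _ (\int[P]_x (cst M x))).
  apply: le_Rintegral => //.
  - by apply: (integrable_norm bi).
  - by apply: bounded_measurable_integrable; exact: bounded_measurable_cst.
rewrite Rintegral_cst// [X in fine X](_ : _ = 1%E) ?mulr1//.
exact: probability_setT.
Qed.

Lemma Rintegral_bounded_sum (P : probability T R) (I : Type) (s : seq I) (f : I -> T -> R) :
  (forall i, bounded_measurable (f i)) ->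
  \int[P]_x (\sum_(i <- s) f i x) = \sum_(i <- s) \int[P]_x f i x.
Proof.
move=> bf; elim: s => [|i s IH].
  rewrite big_nil (_ : (fun x => _) = cst 0); last by apply/funext => x; rewrite big_nil.
  by rewrite Rintegral_cst// mul0r.
rewrite big_cons -IH -RintegralD//.
- by apply: eq_Rintegral => x _; rewrite big_cons.
- exact: bounded_measurable_integrable.
- by apply: bounded_measurable_integrable; exact: bounded_measurable_sum.
Qed.

End bounded_measurable.

Lemma bounded_measurable_comp d1 d2 (T1 : measurableType d1) (T2 : measurableType d2)
    (R : realType) (f : T2 -> R) (X : T1 -> T2) :
  measurable_fun setT X -> bounded_measurable f -> bounded_measurable (f \o X).
Proof.
move=> mX [mf [M Mf]]; split; first exact: measurableT_comp.
by exists M => x; exact: Mf.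
Qed.

Section walk_chain.
Context d (Omega : measurableType d) (R : realType) (P : probability Omega R).
Variables (a : R) (xi : int -> {RV P >-> torus R}).
Hypothesis chain : stationary_markov_chain (walk_kernel a) (@haar R) xi.

Local Notation K := (walk_kernel a).
Definition chain_at (k : nat) : Omega -> torus R := xi k%:Z.
Local Notation X := chain_at.

Lemma bounded_measurable_walk_kernel (g : torus R -> R) :
  bounded_measurable g -> bounded_measurable (K g).
Proof.
move=> bg; have b b' : bounded_measurable (g \o Defs.rot b').
  by apply: bounded_measurable_comp => //; exact: measurable_rot.
rewrite /walk_kernel; apply: bounded_measurableM; last exact: bounded_measurable_cst.
by apply: bounded_measurableD; exact: b.
Qed.

(** The generators of [past xi i], named so that being adapted is measurability for
the sigma-algebra that they generate. *)
Definition past_generators (i : nat) : set (set Omega) :=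
  [set A | exists j : int, exists B : set (torus R),
        [/\ j <= i%:Z, measurable B & A = xi j @^-1` B]].

Definition adapted (i : nat) (Y : Omega -> R) : Prop :=
  measurable_fun setT (Y : g_sigma_algebraType (past_generators i) -> R).

Lemma adapted_le i j Y : (i <= j)%N -> adapted i Y -> adapted j Y.
Proof.
move=> ij mY _ B mB; have := mY measurableT B mB; rewrite !setTI.
apply: sub_smallest2r; first exact: smallest_sigma_algebra.
rewrite /past_generators => A [k [C [ki mC ->]]].
by exists k, C; split => //; apply: le_trans ki _; rewrite lez_nat.
Qed.

Lemma adapted_measurable i Y : adapted i Y -> measurable_fun setT Y.
Proof.
move=> mY _ B mB; have := mY measurableT B mB; rewrite !setTI.
apply: smallest_sub; first exact: sigma_algebra_measurable.
rewrite /past_generators => A [k [C [ki mC ->]]]; rewrite -[X in measurable X]setTI.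
exact: measurable_funPT.
Qed.

Lemma adapted_chain i k (g : torus R -> R) : (k <= i)%N -> measurable_fun setT g ->
  adapted i (g \o X k).
Proof.
move=> ki mg _ B mB; rewrite setTI; apply: sub_sigma_algebra; rewrite /past_generators.
exists k%:Z, (g @^-1` B); split => //.
by rewrite -[X in measurable X]setTI; exact: mg.
Qed.

Lemma measurable_chain k : measurable_fun setT (X k).
Proof. exact: measurable_funPT. Qed.

Let bounded_integrable (f : Omega -> R) : bounded_measurable f ->
  P.-integrable setT (EFin \o f).
Proof. exact: bounded_measurable_integrable. Qed.

Let bounded_chain k (g : torus R -> R) : bounded_measurable g ->
  bounded_measurable (g \o X k).
Proof. by move=> bg; apply: bounded_measurable_comp => //; exact: measurable_chain. Qed.

Lemma adapted_bounded_measurable i (Y : Omega -> R) B : adapted i Y ->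
  (forall w, 0 <= Y w <= B) -> bounded_measurable Y.
Proof.
move=> aY YB; split; first exact: adapted_measurable aY.
by exists B => w; have /andP[Y0 Y1] := YB w; rewrite ger0_norm.
Qed.

(** The Markov property is given for indicators of past events; a bounded past
observable is uniformly close to a combination of the indicators of its level
sets. *)
Lemma markov_step k (Y : Omega -> R) (B : R) (g : torus R -> R) :
  adapted k Y -> (forall w, 0 <= Y w <= B) -> bounded_measurable g ->
  \int[P]_w (Y w * g (X k.+1 w)) = \int[P]_w (Y w * K g (X k w)).
Proof.
move=> aY YB bg; have bY := adapted_bounded_measurable aY YB.
have bKg := bounded_measurable_walk_kernel bg.
have bgX := bounded_chain k.+1 bg; have bKgX := bounded_chain k bKg.
have B1 : 0 < `|B| + 1 by rewrite ltr_wpDl.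
have step A : past xi k%:Z A ->
    \int[P]_w (\1_A w * g (X k.+1 w)) = \int[P]_w (\1_A w * K g (X k w)).
  move=> pA; have := chain.2 k%:Z g A bg.1.
  have [_ [M Mg]] := bg.
  have bnd : bounded_fun g.
    exists M; split; rewrite ?num_real// => N MN x _.
    by apply: le_trans (Mg x) _; exact: ltW.
  move=> /(_ bnd pA); rewrite [LHS]Rintegral_mkcond [RHS]Rintegral_mkcond => h.
  transitivity (\int[P]_w ((fun w => g (xi (k%:Z + 1) w)) \_ A) w).
    apply: eq_Rintegral => w _; rewrite patchE indicE.
    by case: (w \in A); rewrite ?mul0r// mul1r /chain_at -addn1.
  rewrite h; apply: eq_Rintegral => w _; rewrite patchE indicE.
  by case: (w \in A); rewrite ?mul0r// mul1r.
(* The superlevel sets of Y on a regular grid with N+1 cells: the sum of their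
indicators counts the cells below Y. *)
pose A N j := [set w | j.+1%:R / N.+1%:R * (`|B| + 1) <= Y w].
have pA N j : past xi k%:Z (A N j).
  have := aY measurableT `[j.+1%:R / N.+1%:R * (`|B| + 1), +oo[%classic (measurable_itv _).
  rewrite setTI; congr (<<s _ >> _); apply/seteqP; split => w /=; rewrite in_itv/= andbT//.
have mA N j : measurable (A N j).
  rewrite -[X in measurable X]setTI.
  apply: measurable_fun_le => //; exact: bY.1.
pose YN N w := (`|B| + 1) / N.+1%:R * \sum_(j < N.+1) \1_(A N j) w.
have YNE N w : 0 <= Y w - YN N w <= (`|B| + 1) / N.+1%:R.
  have N0 : 0 < N.+1%:R :> R by rewrite ltr0n.
  have /andP[y0 yB] := YB w.
  pose q := Y w / ((`|B| + 1) / N.+1%:R).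
  have q0 : 0 <= q by rewrite divr_ge0// divr_ge0// ltW.
  have qY : Y w = q * ((`|B| + 1) / N.+1%:R) by rewrite /q divfK// gt_eqF// divr_gt0.
  have -> : YN N w = (Num.truncn q)%:R * ((`|B| + 1) / N.+1%:R).
    rewrite /YN mulrC; congr (_ * _).
    have qN : (Num.truncn q < N.+1)%N.
      rewrite truncn_lt_nat// /q ltr_pdivrMr ?divr_gt0// mulrCA divff ?gt_eqF// mulr1.
      by rewrite (le_lt_trans yB)// (le_lt_trans (ler_norm _))// ltrDl.
    have AE j : \1_(A N j) w = (j < Num.truncn q)%N%:R :> R.
      rewrite indicE; congr (_%:R); congr nat_of_bool.
      rewrite ltnNge -ltnS truncn_lt_nat// -leNgt; apply/idP/idP => [/set_mem|h].
        by rewrite /A/= qY mulrAC -mulrA ler_pM2r// divr_gt0.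
      by apply/mem_set; rewrite /A/= qY mulrAC -mulrA ler_pM2r// divr_gt0.
    rewrite (eq_bigr (fun j : 'I_N.+1 => if (j < Num.truncn q)%N then 1 else 0)).
      rewrite -big_mkcond/= -(big_ord_widen N.+1 (fun=> 1) (ltnW qN)).
      by rewrite sumr_const card_ord.
    by move=> j _; rewrite AE; case: ifP.
  have /andP[t1 t2] := truncn_itv q0.
  have dl0 : 0 < (`|B| + 1) / N.+1%:R by rewrite divr_gt0.
  rewrite qY -mulrBl; apply/andP; split.
    by apply: mulr_ge0; [rewrite subr_ge0|exact: ltW].
  apply: ler_piMl; first exact: ltW.
  by rewrite lerBlDl natr1 ltW.
have bA N j : bounded_measurable (\1_(A N j) : Omega -> R).
  exact: bounded_measurable_indic.
have bYN N : bounded_measurable (YN N).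
  apply: bounded_measurableM; first exact: bounded_measurable_cst.
  by apply: bounded_measurable_sum => j; exact: bA.
have YNint N : \int[P]_w (YN N w * g (X k.+1 w)) = \int[P]_w (YN N w * K g (X k w)).
  have E (f : Omega -> R) : bounded_measurable f -> \int[P]_w (YN N w * f w) =
      (`|B| + 1) / N.+1%:R * \sum_(j < N.+1) \int[P]_w (\1_(A N j) w * f w).
    move=> bf; rewrite -Rintegral_bounded_sum; last first.
      by move=> j; apply: bounded_measurableM => //; exact: bA.
    rewrite -RintegralZl//; last first.
      apply: bounded_integrable; apply: bounded_measurable_sum => j.
      by apply: bounded_measurableM => //; exact: bA.
    by apply: eq_Rintegral => w _; rewrite /YN -mulrA mulr_suml.
  rewrite (E (g \o X k.+1))// (E (K g \o X k))//; congr (_ * _).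
  by apply: eq_bigr => j _; apply: step; exact: pA.
have close (f : Omega -> R) M N : bounded_measurable f -> (forall w, `|f w| <= M) ->
    `|\int[P]_w (Y w * f w) - \int[P]_w (YN N w * f w)| <= (`|B| + 1) / N.+1%:R * M.
  move=> bf fM; rewrite -RintegralB//; last 2 first.
  - by apply: bounded_integrable; exact: bounded_measurableM.
  - by apply: bounded_integrable; apply: bounded_measurableM.
  apply: Rintegral_bounded_le => [|w].
    rewrite (_ : (fun w => _) = (fun w => (Y w + -1 * YN N w) * f w)); last first.
      by apply/funext => w; ring.
    apply: bounded_measurableM => //; apply: bounded_measurableD => //.
    by apply: bounded_measurableM => //; exact: bounded_measurable_cst.
  rewrite -mulrBl normrM; have /andP[h0 h1] := YNE N w.
  by rewrite ler_pM// ger0_norm.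
have [_ [M Mg]] := bg; have [_ [M' Mg']] := bKg.
apply/eqP; rewrite -subr_eq0 -normr_le0; apply/ler_addgt0Pr => e e0; rewrite add0r.
pose N := Num.truncn ((`|B| + 1) * (`|M| + `|M'|) / e).
have N0 : 0 < N.+1%:R :> R by rewrite ltr0n.
have h1 := close _ `|M| N bgX (fun w => le_trans (Mg _) (ler_norm _)).
have h2 := close _ `|M'| N bKgX (fun w => le_trans (Mg' _) (ler_norm _)).
rewrite -[X in `|X|](subrKA (\int[P]_w (YN N w * g (X k.+1 w)))).
rewrite (le_trans (ler_normD _ _))// {2}YNint.
rewrite distrC in h2; apply: le_trans (lerD h1 h2) _.
rewrite -mulrDr mulrAC ler_pdivrMr// mulrC [leRHS]mulrC -ler_pdivrMr//.
by rewrite mulrC ltW// truncnS_gt.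
Qed.

End walk_chain.

(** * Exponential inequalities for a two-point law *)

Section exponential_inequalities.
Variable R : realType.
Implicit Types (x b : R).

(** The terms of degree 3 + n of the series are at most |x|^3 / 2^(n+1). *)
Lemma expR_taylor2 x : `|x| <= 1 -> `|expR x - (1 + x + x ^+ 2 / 2)| <= `|x| ^+ 3.
Proof.
move=> x1.
have cv : (series (exp_coeff x) n.+3 - (1 + x + x ^+ 2 / 2)) @[n --> \oo] -->
    expR x - (1 + x + x ^+ 2 / 2).
  apply: cvgB; last exact: cvg_cst.
  have /cvg_ex[l Hl] := is_cvg_series_exp_coeff x.
  have -> : expR x = l by rewrite /expR; exact: cvg_lim.
  have -> : (fun n => series (exp_coeff x) n.+3) = (fun n => series (exp_coeff x) (n + 3)%N).
    by apply/funext => n; rewrite addn3.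
  by rewrite cvg_shiftn.
have fact_ge n : (2 ^ n.+1 <= n.+3`!)%N.
  elim: n => // n IH; rewrite factS expnS leq_mul//.
have bnd n : `|series (exp_coeff x) n.+3 - (1 + x + x ^+ 2 / 2)| <= `|x| ^+ 3 * (1 - 2 ^- n).
  elim: n => [|n IH].
    rewrite expr0 invr1 subrr mulr0 /series/= !big_nat_recr//= big_nil /exp_coeff/=.
    have -> : 0 + x ^+ 0 / 0`!%:R + x ^+ 1 / 1`!%:R + x ^+ 2 / 2`!%:R = 1 + x + x ^+ 2 / 2 :> R.
      by rewrite add0r expr0 expr1 fact0 !divr1.
    by rewrite subrr normr0.
  rewrite /series/= big_nat_recr//= -/(series (exp_coeff x) n.+3) addrAC.
  rewrite (le_trans (ler_normD _ _))//.
  have -> : `|x| ^+ 3 * (1 - 2 ^- n.+1) = `|x| ^+ 3 * (1 - 2 ^- n) + `|x| ^+ 3 * 2 ^- n.+1.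
    by rewrite (exprS 2 n); field; rewrite expf_neq0.
  apply: lerD => //; rewrite /exp_coeff/= normrM normrX normfV normr_nat.
  rewrite -addn3 addnC exprD -mulrA ler_wpM2l ?exprn_ge0//.
  rewrite -[leRHS]mul1r ler_pM ?exprn_ge0 ?invr_ge0//; first exact: exprn_ile1.
  by rewrite addnC addn3 lef_pV2 ?posrE ?exprn_gt0 ?ltr0n ?fact_gt0// -natrX ler_nat.
apply: (cvgr_to_le (cvg_norm cv)); apply: nearW => n.
apply: le_trans (bnd n) _; by rewrite ler_piMr ?exprn_ge0// gerBl invr_ge0 exprn_ge0.
Qed.

(** Near 0 the bound follows from the expansion of order 2, and for |x| > 1 from
|x| <= 2 x^2. *)
Lemma cosh_le x : (expR x + expR (- x)) / 2 <= expR (2 * x ^+ 2).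
Proof.
have [x1|x1] := leP `|x| 1.
  have h (y : R) : `|y| <= 1 -> expR y <= 1 + y + 3 / 2 * y ^+ 2.
    move=> y1; have := expR_taylor2 y1; rewrite ler_norml => /andP[_ h].
    have : `|y| ^+ 3 <= y ^+ 2.
      by rewrite exprS real_normK ?num_real// ler_piMl ?sqr_ge0.
    by lra.
  have h1 := h x x1; have h2 := h (- x); rewrite normrN sqrrN in h2.
  have := h2 x1; have := sqr_ge0 x; have := expR_ge1Dx (2 * x ^+ 2); lra.
have hx : `|x| <= 2 * x ^+ 2.
  apply: (@le_trans _ _ (x ^+ 2)); last by rewrite ler_peMl ?sqr_ge0// ler1n.
  by rewrite -real_normK ?num_real// expr2 ler_peMl// ltW.
have : expR x <= expR (2 * x ^+ 2) by rewrite ler_expR (le_trans (ler_norm _)).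
have : expR (- x) <= expR (2 * x ^+ 2).
  by rewrite ler_expR (le_trans (ler_norm _))// normrN.
by lra.
Qed.

(** The mean of the exponential over the two steps of the walk. The square of D
varies from point to point; the corrections p and q, which enter with the
factor b^2/2, turn it into the constant v up to eta. They contribute to the expansion at
second order by their mean, and at third order otherwise. *)
Lemma two_point_exponential (C U v eta : R) : 0 <= C -> 0 <= U -> 0 < eta ->
  exists2 b0 : R, 0 < b0 & forall b D p q, `|b| <= b0 -> `|D| <= C ->
    `|p| <= 2 * U -> `|q| <= 2 * U -> `|D ^+ 2 + (p + q) / 2 - v| <= eta ->
    expR (b ^+ 2 / 2 * (v - 2 * eta)) <=
      (expR (b * D + b ^+ 2 / 2 * p) + expR (- (b * D) + b ^+ 2 / 2 * q)) / 2 <=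
    expR (b ^+ 2 / 2 * (v + 2 * eta)).
Proof.
move=> C0 U0 eta0.
(* A bounds the coefficient of |b|^3 in the error of the expansion of order 2; b0
is small enough for the exponents to be at most 1 and for A |b| and the square of
the final exponent to be absorbed by eta. *)
pose A := C * U + U ^+ 2 / 2 + (C + U) ^+ 3.
have A0 : 0 <= A by rewrite !addr_ge0 ?mulr_ge0 ?divr_ge0 ?exprn_ge0 ?addr_ge0.
pose w := `|v| + 2 * eta; have w0 : 0 < w by rewrite ltr_wpDl// mulr_gt0.
pose b0 := Num.min (Num.min 1 (C + U + 1)^-1) (Num.min (eta / (4 * (A + 1))) (eta / 2 / (w ^+ 2 + 1)))
  : R.
have b0p : 0 < Num.min b0 (w + 1)^-1.
  have h1 : 0 < C + U + 1 by rewrite ltr_wpDl// addr_ge0.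
  have h2 : 0 < 4 * (A + 1) by rewrite mulr_gt0// ltr_wpDl.
  have h3 : 0 < w ^+ 2 + 1 by rewrite ltr_wpDl ?sqr_ge0.
  have h4 : 0 < w + 1 by rewrite addr_gt0.
  by rewrite /b0 !lt_min ltr01 !invr_gt0 h1 h4 !divr_gt0.
exists (Num.min b0 (w + 1)^-1) => // b D p q.
rewrite !le_min => /andP[/andP[/andP[b1 b2] /andP[b3 b4]] b5] DC pU qU Gv.
set B := `|b| in b1 b2 b3 b4 b5; have B0 : 0 <= B by exact: normr_ge0.
have bB : b ^+ 2 = B ^+ 2 by rewrite /B real_normK ?num_real.
have b2' : B * (C + U) <= 1.
  move: b2; rewrite -[_^-1]mul1r ler_pdivlMr; last by rewrite ltr_wpDl// addr_ge0.
  by nra.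
have b3' : A * B <= eta / 4.
  move: b3; rewrite ler_pdivlMr; last by rewrite mulr_gt0// ltr_wpDl.
  by nra.
have b4' : B * w ^+ 2 <= eta / 2.
  move: b4; rewrite ler_pdivlMr; last by rewrite ltr_wpDl ?sqr_ge0.
  by nra.
have b5' : B * w <= 1.
  move: b5; rewrite -[_^-1]mul1r ler_pdivlMr; last by rewrite addr_gt0.
  by nra.
pose x := b * D + b ^+ 2 / 2 * p; pose y := - (b * D) + b ^+ 2 / 2 * q.
have small (s r : R) : `|s| <= 1 -> `|r| <= 2 * U -> `|s * (b * D) + b ^+ 2 / 2 * r| <= B * (C + U).
  move=> s1 rU; rewrite (le_trans (ler_normD _ _))// mulrDr lerD//.
    rewrite normrM -[leRHS]mul1r ler_pM// normrM ler_wpM2l//.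
  rewrite normrM (ger0_norm (divr_ge0 (sqr_ge0 b) _))// bB.
  have : B ^+ 2 / 2 * `|r| <= B ^+ 2 / 2 * (2 * U) by rewrite ler_wpM2l// divr_ge0// sqr_ge0.
  move/le_trans; apply; rewrite expr2 -!mulrA ler_wpM2l//.
  by rewrite (_ : B * (2^-1 * (2 * U)) = B * U); [rewrite ler_piMl|field].
have xs : `|x| <= B * (C + U) by have := small 1 p; rewrite normr1 mul1r; apply.
have ys : `|y| <= B * (C + U) by have := small (-1) q; rewrite normrN1 mulN1r; apply.
have tx := expR_taylor2 (le_trans xs b2').
have ty := expR_taylor2 (le_trans ys b2').
have cube (z : R) : `|z| <= B * (C + U) -> `|z| ^+ 3 <= B ^+ 2 * (B * (C + U) ^+ 3).
  move=> zs; apply: (@le_trans _ _ ((B * (C + U)) ^+ 3)).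
    by rewrite lerXn2r ?nnegrE// (le_trans _ zs).
  by rewrite exprMn le_eqVlt; apply/orP; left; apply/eqP; ring.
have cx := le_trans tx (cube x xs); have cy := le_trans ty (cube y ys).
set G := D ^+ 2 + (p + q) / 2 in Gv.
have quad : (1 + x + x ^+ 2 / 2 + (1 + y + y ^+ 2 / 2)) / 2 = 1 + b ^+ 2 / 2 * G +
    (b ^+ 2 * (b * D) * (p - q) / 4 + b ^+ 2 * b ^+ 2 * (p ^+ 2 + q ^+ 2) / 16).
  by rewrite /x /y /G; field.
have r1 : `|b ^+ 2 * (b * D) * (p - q) / 4| <= B ^+ 2 * (B * (C * U)).
  rewrite bB 3!normrM (normrM b D) normfV !normr_nat -/B (ger0_norm (sqr_ge0 B)).
  have pq : `|p - q| <= 4 * U by rewrite (le_trans (ler_normB _ _))//; lra.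
  rewrite -!mulrA ler_wpM2l ?sqr_ge0// ler_wpM2l//.
  have pq4 : `|p - q| / 4 <= U by lra.
  by apply: ler_wpM2l => //; apply: ler_pM; rewrite ?divr_ge0.
have r2 : `|b ^+ 2 * b ^+ 2 * (p ^+ 2 + q ^+ 2) / 16| <= B ^+ 2 * (B * (U ^+ 2 / 2)).
  have p2 : p ^+ 2 <= 4 * U ^+ 2.
    by rewrite -real_normK ?num_real// (_ : 4 * U ^+ 2 = (2 * U) ^+ 2) ?lerXn2r ?nnegrE ?mulr_ge0//; ring.
  have q2 : q ^+ 2 <= 4 * U ^+ 2.
    by rewrite -real_normK ?num_real// (_ : 4 * U ^+ 2 = (2 * U) ^+ 2) ?lerXn2r ?nnegrE ?mulr_ge0//; ring.
  rewrite bB ger0_norm; last by rewrite !mulr_ge0 ?sqr_ge0 ?addr_ge0 ?sqr_ge0.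
  have BB : B ^+ 2 * B ^+ 2 <= B ^+ 2 * B by rewrite ler_wpM2l ?sqr_ge0// expr2 ler_piMl.
  rewrite -[leLHS]mulrA [leRHS]mulrA; apply: ler_pM => //.
  - by rewrite mulr_ge0 ?sqr_ge0.
  - by rewrite divr_ge0// addr_ge0 ?sqr_ge0.
  - by lra.
set E := (expR x + expR y) / 2.
have EG : `|E - (1 + b ^+ 2 / 2 * G)| <= B ^+ 2 * (A * B).
  have -> : E - (1 + b ^+ 2 / 2 * G) = (expR x - (1 + x + x ^+ 2 / 2)) / 2 +
     (expR y - (1 + y + y ^+ 2 / 2)) / 2 + (b ^+ 2 * (b * D) * (p - q) / 4 + b ^+ 2 * b ^+ 2 * (p ^+ 2 + q ^+ 2) / 16).
    have := quad; rewrite /E; lra.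
  have -> : B ^+ 2 * (A * B) = B ^+ 2 * (B * (C + U) ^+ 3) / 2 + B ^+ 2 * (B * (C + U) ^+ 3) / 2
     + (B ^+ 2 * (B * (C * U)) + B ^+ 2 * (B * (U ^+ 2 / 2))) by rewrite /A; field.
  rewrite (le_trans (ler_normD _ _))// lerD//; last by rewrite (le_trans (ler_normD _ _))// lerD.
  by rewrite (le_trans (ler_normD _ _))// lerD// normrM normfV normr_nat ler_pM2r.
have {}EG : `|E - (1 + b ^+ 2 / 2 * G)| <= B ^+ 2 * (eta / 4).
  by rewrite (le_trans EG)// ler_wpM2l ?sqr_ge0.
have B2 : 0 <= B ^+ 2 := sqr_ge0 _.
move: EG Gv; rewrite bB !ler_norml => /andP[e1 e2] /andP[g1 g2].
have gg1 : B ^+ 2 / 2 * (v - eta) <= B ^+ 2 / 2 * G by rewrite ler_wpM2l ?divr_ge0//; lra.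
have gg2 : B ^+ 2 / 2 * G <= B ^+ 2 / 2 * (v + eta) by rewrite ler_wpM2l ?divr_ge0//; lra.
apply/andP; split; last first.
  apply: le_trans (expR_ge1Dx _).
  have : 0 <= B ^+ 2 * eta by rewrite mulr_ge0// ltW.
  by lra.
set t := B ^+ 2 / 2 * (v - 2 * eta).
have vw : `|v - 2 * eta| <= w.
  by rewrite (le_trans (ler_normB _ _))// /w (gtr0_norm (mulr_gt0 _ eta0)).
have BB : B ^+ 2 <= B by rewrite expr2 ler_piMl.
have t1 : `|t| <= 1.
  rewrite /t normrM (ger0_norm (divr_ge0 B2 _))//.
  apply: (@le_trans _ _ (B * w)) => //; apply: ler_pM => //; first by rewrite divr_ge0.
  by rewrite ler_pdivrMr// ; lra.
have t2 : t ^+ 2 <= B ^+ 2 * (eta / 2) / 4.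
  have -> : t ^+ 2 = B ^+ 2 * (B ^+ 2 * (v - 2 * eta) ^+ 2) / 4 by rewrite /t; field.
  rewrite ler_pM2r// ler_wpM2l// (le_trans _ b4')// ler_pM ?sqr_ge0//.
  by rewrite -real_normK ?num_real// lerXn2r ?nnegrE ?(ltW w0).
have := expR_taylor2 t1; rewrite ler_norml => /andP[_ h].
have : `|t| ^+ 3 <= t ^+ 2.
  by rewrite exprS real_normK ?num_real// ler_piMl ?sqr_ge0.
have tE : t = B ^+ 2 / 2 * v - B ^+ 2 * eta by rewrite /t; lra.
have : 0 <= t ^+ 2 := sqr_ge0 _.
by lra.
Qed.

End exponential_inequalities.

(** * Exponential martingale estimates for the chain *)

Section exponential_increments.
Context d (Omega : measurableType d) (R : realType) (P : probability Omega R).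
Variables (a : R) (xi : int -> {RV P >-> torus R}).
Hypothesis chain : stationary_markov_chain (walk_kernel a) (@haar R) xi.

Local Notation K := (walk_kernel a).
Local Notation X := (chain_at xi).
Implicit Types (H c h u : torus R -> R) (Y : Omega -> R).

(** The sums have a predictable part c of their own, which need not be K H: for
exponential estimates the compensator of H is perturbed at second order. *)
Definition increments H c (s L : nat) (w : Omega) : R :=
  \sum_(i < L) (H (X (s + i).+1 w) - c (X (s + i) w)).

Lemma incrementsS H c s L w :
  increments H c s L.+1 w = increments H c s L w + (H (X (s + L).+1 w) - c (X (s + L) w)).
Proof. by rewrite /increments big_ord_recr. Qed.

Lemma adapted_increments H c s L : measurable_fun setT H -> measurable_fun setT c ->
  adapted xi (s + L) (increments H c s L).
Proof.
move=> mH mc; elim: L => [|L IH].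
  rewrite /adapted (_ : increments H c s 0 = cst 0); first exact: measurable_cst.
  by apply/funext => w; rewrite /increments big_ord0.
rewrite /adapted (_ : increments H c s L.+1 =
    fun w => increments H c s L w + (H (X (s + L).+1 w) - c (X (s + L) w))); last first.
  by apply/funext => w; rewrite incrementsS.
apply: measurable_funD; first by apply: adapted_le IH; lia.
apply: measurable_funB.
  by rewrite -addnS; apply: (adapted_chain (leqnn _) mH).
by apply: (adapted_chain _ mc); lia.
Qed.

Lemma bounded_increments H c s L : bounded_measurable H -> bounded_measurable c ->
  bounded_measurable (increments H c s L).
Proof.
move=> bH bc; apply: bounded_measurable_sum => i.
apply: bounded_measurableD; first exact: (bounded_measurable_comp (measurable_chain xi _)).
rewrite (_ : (fun w => _) = (fun w => -1 * c (X (s + i) w))); last first.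
  by apply/funext => w; rewrite mulN1r.
apply: bounded_measurableM; first exact: bounded_measurable_cst.
exact: (bounded_measurable_comp (measurable_chain xi _)).
Qed.

(** The densities against which conditional expectations at time k are tested;
their nonnegativity allows to integrate pointwise bounds on the transition. *)
Definition past_weight k Y := adapted xi k Y /\ exists B, forall w, 0 <= Y w <= B.

Lemma past_weight_le i j Y : (i <= j)%N -> past_weight i Y -> past_weight j Y.
Proof. by move=> ij [aY bY]; split => //; exact: adapted_le aY. Qed.

Lemma past_weight1 k : past_weight k (cst 1).
Proof. by split; [exact: measurable_cst|exists 1 => w; rewrite ler01 lexx]. Qed.

Lemma past_weight_bounded k Y : past_weight k Y -> bounded_measurable Y.
Proof. by move=> [aY [B YB]]; exact: adapted_bounded_measurable aY YB. Qed.

Lemma past_weightM k Y (e : Omega -> R) : past_weight k Y -> past_weight k e ->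
  past_weight k (fun w => Y w * e w).
Proof.
move=> [aY [B YB]] [ae [M eM]]; split; first exact: measurable_funM.
exists (B * M) => w; have /andP[y0 yB] := YB w; have /andP[e0 eM'] := eM w.
by rewrite mulr_ge0//= ler_pM.
Qed.

Lemma past_weight_expR k (e : Omega -> R) : adapted xi k e -> bounded_measurable e ->
  past_weight k (fun w => expR (e w)).
Proof.
move=> ae be; split; first exact: measurableT_comp.
have [_ [M eM]] := bounded_measurable_expR be.
by exists M => w; rewrite expR_ge0 (le_trans (ler_norm _)).
Qed.

Lemma past_weight_increments H c s L b : bounded_measurable H -> bounded_measurable c ->
  past_weight (s + L) (fun w => expR (b * increments H c s L w)).
Proof.
move=> bH bc; apply: past_weight_expR.
  apply: measurable_funM; first exact: measurable_cst.
  exact: adapted_increments bH.1 bc.1.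
apply: bounded_measurableM; first exact: bounded_measurable_cst.
exact: bounded_increments.
Qed.

Let bounded_integrable (f : Omega -> R) : bounded_measurable f ->
  P.-integrable setT (EFin \o f).
Proof. exact: bounded_measurable_integrable. Qed.

Lemma Rintegral_bounded_ler (f g : Omega -> R) : bounded_measurable f ->
  bounded_measurable g -> (forall w, f w <= g w) -> \int[P]_w f w <= \int[P]_w g w.
Proof. by move=> bf bg fg; apply: le_Rintegral => //; exact: bounded_integrable. Qed.

(** The factor that depends on X k goes into the past weight. *)
Lemma markov_expR k Y H c : past_weight k Y -> bounded_measurable H -> bounded_measurable c ->
  \int[P]_w (Y w * expR (H (X k.+1 w) - c (X k w))) =
  \int[P]_w (Y w * (expR (- c (X k w)) * K (expR \o H) (X k w))).
Proof.
move=> wY bH bc; have bHc := bounded_measurable_expR bH.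
have [aY' [B' YB']] : past_weight k (fun w => Y w * expR (- c (X k w))).
  apply: past_weightM => //; apply: past_weight_expR.
    rewrite /adapted; apply: measurable_funN; exact: (adapted_chain (leqnn k) bc.1).
  rewrite (_ : (fun w => _) = (fun w => -1 * c (X k w))); last first.
    by apply/funext => w; rewrite mulN1r.
  apply: bounded_measurableM; first exact: bounded_measurable_cst.
  exact: (bounded_measurable_comp (measurable_chain xi _)).
have := markov_step chain aY' YB' bHc.
rewrite (_ : (fun w => _ * (expR \o H) (X k.+1 w)) = (fun w => Y w * expR (H (X k.+1 w) - c (X k w)))); last first.
  by apply/funext => w /=; rewrite -mulrA -expRD addrC.
by move=> ->; apply: eq_Rintegral => w _; rewrite mulrA.
Qed.

Let boundedK H c k : bounded_measurable H -> bounded_measurable c ->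
  bounded_measurable (fun w => expR (- c (X k w)) * K (expR \o H) (X k w)).
Proof.
move=> bH bc; apply: bounded_measurableM; last first.
  apply: (bounded_measurable_comp (measurable_chain xi k)).
  exact/bounded_measurable_walk_kernel/bounded_measurable_expR.
apply: bounded_measurable_expR.
rewrite (_ : (fun w => _) = (fun w => -1 * c (X k w))); last first.
  by apply/funext => w; rewrite mulN1r.
apply: bounded_measurableM; first exact: bounded_measurable_cst.
exact: (bounded_measurable_comp (measurable_chain xi _)).
Qed.

(** A bound on the kernel at each point bounds the conditional Laplace transform of
one step. *)
Lemma expR_step_le kappa k Y H c : past_weight k Y ->
  bounded_measurable H -> bounded_measurable c ->
  (forall x, K (expR \o H) x <= expR (kappa + c x)) ->
  \int[P]_w (Y w * expR (H (X k.+1 w) - c (X k w))) <= expR kappa * \int[P]_w Y w.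
Proof.
move=> wY bH bc Hk; rewrite markov_expR// -RintegralZl//; last first.
  exact/bounded_integrable/(past_weight_bounded wY).
apply: Rintegral_bounded_ler.
- by apply: bounded_measurableM; [exact: past_weight_bounded wY|exact: boundedK].
- by apply: bounded_measurableM; [exact: bounded_measurable_cst|exact: past_weight_bounded wY].
move=> w; have [_ [B YB]] := wY; have /andP[Y0 _] := YB w.
rewrite mulrC ler_wpM2r// mulrC.
apply: le_trans (ler_wpM2r _ (Hk _)) _; first exact: expR_ge0.
by rewrite -expRD addrK.
Qed.

Lemma expR_step_ge kappa k Y H c : past_weight k Y ->
  bounded_measurable H -> bounded_measurable c ->
  (forall x, expR (kappa + c x) <= K (expR \o H) x) ->
  expR kappa * \int[P]_w Y w <= \int[P]_w (Y w * expR (H (X k.+1 w) - c (X k w))).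
Proof.
move=> wY bH bc Hk; rewrite markov_expR// -RintegralZl//; last first.
  exact/bounded_integrable/(past_weight_bounded wY).
apply: Rintegral_bounded_ler.
- by apply: bounded_measurableM; [exact: bounded_measurable_cst|exact: past_weight_bounded wY].
- by apply: bounded_measurableM; [exact: past_weight_bounded wY|exact: boundedK].
move=> w; have [_ [B YB]] := wY; have /andP[Y0 _] := YB w.
rewrite [leRHS]mulrC ler_wpM2r// [leRHS]mulrC.
apply: le_trans _ (ler_wpM2r _ (Hk _)); last exact: expR_ge0.
by rewrite -expRD addrK.
Qed.

Let past_weight_expS H c s L Y : past_weight s Y -> bounded_measurable H ->
  bounded_measurable c -> past_weight (s + L) (fun w => Y w * expR (increments H c s L w)).
Proof.
move=> wY bH bc; apply: past_weightM; first by apply: past_weight_le wY; lia.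
apply: past_weight_expR; first exact: adapted_increments bH.1 bc.1.
exact: bounded_increments.
Qed.

Let expS H c s L Y : (fun w => Y w * expR (increments H c s L.+1 w)) =
  (fun w => Y w * expR (increments H c s L w) * expR (H (X (s + L).+1 w) - c (X (s + L) w))).
Proof. by apply/funext => w; rewrite incrementsS expRD mulrA. Qed.

Lemma expR_increments_le kappa s L Y H c : past_weight s Y ->
  bounded_measurable H -> bounded_measurable c ->
  (forall x, K (expR \o H) x <= expR (kappa + c x)) ->
  \int[P]_w (Y w * expR (increments H c s L w)) <= expR (L%:R * kappa) * \int[P]_w Y w.
Proof.
move=> wY bH bc Hk; elim: L => [|L IH].
  rewrite mul0r expR0 mul1r le_eqVlt; apply/orP; left; apply/eqP.
  by apply: eq_Rintegral => w _; rewrite /increments big_ord0 expR0 mulr1.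
rewrite expS; apply: le_trans (expR_step_le (past_weight_expS L wY bH bc) bH bc Hk) _.
apply: le_trans (ler_wpM2l (expR_ge0 _) IH) _.
by rewrite mulrA -expRD -natr1 mulrDl mul1r addrC.
Qed.

Lemma expR_increments_ge kappa s L Y H c : past_weight s Y ->
  bounded_measurable H -> bounded_measurable c ->
  (forall x, expR (kappa + c x) <= K (expR \o H) x) ->
  expR (L%:R * kappa) * \int[P]_w Y w <= \int[P]_w (Y w * expR (increments H c s L w)).
Proof.
move=> wY bH bc Hk; elim: L => [|L IH].
  rewrite mul0r expR0 mul1r le_eqVlt; apply/orP; left; apply/eqP.
  by apply: eq_Rintegral => w _; rewrite /increments big_ord0 expR0 mulr1.
rewrite expS; apply: le_trans (expR_step_ge (past_weight_expS L wY bH bc) bH bc Hk).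
apply: le_trans _ (ler_wpM2l (expR_ge0 _) IH).
by rewrite mulrA -expRD -natr1 mulrDl mul1r addrC.
Qed.

Definition martingale h := increments h (K h).

Lemma kernel_split h x : h (Defs.rot a x) - K h x = (h (Defs.rot a x) - h (Defs.rot (- a) x)) / 2 /\
  h (Defs.rot (- a) x) - K h x = - ((h (Defs.rot a x) - h (Defs.rot (- a) x)) / 2).
Proof. by rewrite /walk_kernel; split; field. Qed.

(** The exponent b M + (b^2/2) u(X) is a sum of increments; its correction part
telescopes and stays bounded. *)
Lemma martingale_expR h u b s L w :
  increments (fun x => b * h x + b ^+ 2 / 2 * u x) (fun x => b * K h x + b ^+ 2 / 2 * u x) s L w
  = b * martingale h s L w + b ^+ 2 / 2 * (u (X (s + L) w) - u (X s w)).
Proof.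
elim: L => [|L IH]; first by rewrite /martingale /increments !big_ord0 addn0 subrr !mulr0 addr0.
by rewrite incrementsS IH /martingale incrementsS addnS; lra.
Qed.

(** The function u corrects the conditional variance of M into the constant v up
to eta, so that b M + (b^2/2) u(X) has almost the Laplace transform of a sum of
independent variables of variance v. Dropping u costs b^2 U, which does not
grow with the number L of steps. *)
Lemma martingale_block (C U v eta : R) : 0 <= C -> 0 <= U -> 0 < eta ->
  exists2 b0 : R, 0 < b0 & forall h u b, bounded_measurable h -> bounded_measurable u ->
    `|b| <= b0 ->
    (forall x, `|(h (Defs.rot a x) - h (Defs.rot (- a) x)) / 2| <= C) ->
    (forall x, `|u x| <= U) ->
    (forall x, `|((h (Defs.rot a x) - h (Defs.rot (- a) x)) / 2) ^+ 2 + (K u x - u x) - v| <= eta) ->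
    forall s L Y, past_weight s Y ->
    expR (L%:R * (b ^+ 2 / 2 * (v - 2 * eta)) - b ^+ 2 * U) * \int[P]_w Y w <=
      \int[P]_w (Y w * expR (b * martingale h s L w)) <=
    expR (L%:R * (b ^+ 2 / 2 * (v + 2 * eta)) + b ^+ 2 * U) * \int[P]_w Y w.
Proof.
move=> C0 U0 eta0; have [b0 b0p Hb] := two_point_exponential v C0 U0 eta0.
exists b0 => // h u b bh bu bb0 DC uU Dv s L Y wY.
pose H x := b * h x + b ^+ 2 / 2 * u x.
pose c x := b * K h x + b ^+ 2 / 2 * u x.
have bM g k : bounded_measurable g -> bounded_measurable (fun x => k * g x).
  by move=> bg; apply: bounded_measurableM => //; exact: bounded_measurable_cst.
have bH : bounded_measurable H by apply: bounded_measurableD; apply: bM.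
have bc : bounded_measurable c.
  by apply: bounded_measurableD; apply: bM => //; exact: bounded_measurable_walk_kernel.
have tp x : expR (b ^+ 2 / 2 * (v - 2 * eta) + c x) <= K (expR \o H) x <=
    expR (b ^+ 2 / 2 * (v + 2 * eta) + c x).
  pose D := (h (Defs.rot a x) - h (Defs.rot (- a) x)) / 2.
  pose p := u (Defs.rot a x) - u x; pose q := u (Defs.rot (- a) x) - u x.
  have u2 y : `|u y - u x| <= 2 * U.
    by rewrite (le_trans (ler_normB _ _))// mulr_natl mulr2n lerD.
  have G : `|D ^+ 2 + (p + q) / 2 - v| <= eta.
    have := Dv x; rewrite (_ : _ + (p + q) / 2 - v = D ^+ 2 + (K u x - u x) - v)//.
    by rewrite /p /q /walk_kernel; field.
  have := Hb b D p q bb0 (DC x) (u2 _) (u2 _) G.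
  have [h1 h2] := kernel_split h x.
  have -> : K (expR \o H) x = (expR (b * D + b ^+ 2 / 2 * p) + expR (- (b * D) + b ^+ 2 / 2 * q)) / 2 * expR (c x).
    rewrite [RHS]mulrAC mulrDl -!expRD [LHS]/walk_kernel/=; congr ((expR _ + expR _) / 2).
      by rewrite /H /c /p /D -h1; ring.
    by rewrite /H /c /q -mulrN -h2; ring.
  by move=> /andP[l1 l2]; rewrite [leLHS]expRD [X in _ && (_ <= X)]expRD !ler_pM2r ?expR_gt0// l1 l2.
have Rb (e : Omega -> R) : bounded_measurable e -> bounded_measurable (fun w => Y w * expR (e w)).
  move=> be; apply: bounded_measurableM; first exact: past_weight_bounded wY.
  exact: bounded_measurable_expR.
have bmart : bounded_measurable (fun w => b * martingale h s L w).
  apply: bounded_measurableM; first exact: bounded_measurable_cst.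
  by apply: bounded_increments => //; exact: bounded_measurable_walk_kernel.
have Y0 w : 0 <= Y w by have [_ [B /(_ w)/andP[]]] := wY.
have cmp w : `|b * martingale h s L w - increments H c s L w| <= b ^+ 2 * U.
  rewrite martingale_expR opprD addNKr normrN normrM ger0_norm ?divr_ge0 ?sqr_ge0//.
  have := uU (X (s + L) w); have := uU (X s w).
  have : `|u (X (s + L) w) - u (X s w)| <= 2 * U.
    by rewrite (le_trans (ler_normB _ _))// mulr_natl mulr2n lerD.
  move=> h1 _ _; apply: (@le_trans _ _ (b ^+ 2 / 2 * (2 * U))).
    by rewrite ler_wpM2l// divr_ge0 ?sqr_ge0.
  by lra.
have bi := bounded_increments s L bH bc.
apply/andP; split.
  rewrite addrC expRD -mulrA.
  have := expR_increments_ge L wY bH bc (fun x => (andP (tp x)).1).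
  move=> /(ler_wpM2l (expR_ge0 (- (b ^+ 2 * U)))) /le_trans; apply.
  rewrite -RintegralZl//; last exact/bounded_integrable/Rb.
  apply: Rintegral_bounded_ler; [|exact: Rb|].
    by apply: bounded_measurableM; [exact: bounded_measurable_cst|exact: Rb].
  move=> w; rewrite mulrCA ler_wpM2l// -expRD ler_expR.
  by have := cmp w; rewrite ler_norml => /andP[+ _]; lra.
rewrite addrC expRD -mulrA.
have := expR_increments_le L wY bH bc (fun x => (andP (tp x)).2).
move=> /(ler_wpM2l (expR_ge0 (b ^+ 2 * U))) /(le_trans _); apply.
rewrite -RintegralZl//; last exact/bounded_integrable/Rb.
apply: Rintegral_bounded_ler; [exact: Rb| |].
  by apply: bounded_measurableM; [exact: bounded_measurable_cst|exact: Rb].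
move=> w; rewrite mulrCA ler_wpM2l// -expRD ler_expR.
by have := cmp w; rewrite ler_norml => /andP[_]; lra.
Qed.

(** The blocks before the last one form a weight that is known when it begins: by
induction the Laplace transforms multiply. *)
Lemma martingale_blocks (C U v eta : R) : 0 <= C -> 0 <= U -> 0 < eta ->
  exists2 b0 : R, 0 < b0 & forall h u (b : nat -> R) (t : nat -> nat),
    bounded_measurable h -> bounded_measurable u ->
    (forall x, `|(h (Defs.rot a x) - h (Defs.rot (- a) x)) / 2| <= C) ->
    (forall x, `|u x| <= U) ->
    (forall x, `|((h (Defs.rot a x) - h (Defs.rot (- a) x)) / 2) ^+ 2 + (K u x - u x) - v| <= eta) ->
    (forall j, `|b j| <= b0) -> {homo t : i j / (i <= j)%N} -> forall m,
    expR (\sum_(j < m) ((t j.+1 - t j)%:R * (b j ^+ 2 / 2 * (v - 2 * eta)) - b j ^+ 2 * U)) <=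
      \int[P]_w expR (\sum_(j < m) b j * martingale h (t j) (t j.+1 - t j) w) <=
    expR (\sum_(j < m) ((t j.+1 - t j)%:R * (b j ^+ 2 / 2 * (v + 2 * eta)) + b j ^+ 2 * U)).
Proof.
move=> C0 U0 eta0; have [b0 b0p Hb] := martingale_block v C0 U0 eta0.
exists b0 => // h u b t bh bu DC uU Dv bb th m.
have bKh := bounded_measurable_walk_kernel a bh.
pose Y m w := expR (\sum_(j < m) b j * martingale h (t j) (t j.+1 - t j) w).
have wY k : past_weight (t k) (Y k).
  elim: k => [|k IH].
    rewrite (_ : Y 0%N = cst 1); first exact: past_weight1.
    by apply/funext => w; rewrite /Y big_ord0 expR0.
  rewrite (_ : Y k.+1 = fun w => Y k w * expR (b k * martingale h (t k) (t k.+1 - t k) w)).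
    have tk : (t k <= t k.+1)%N by apply: th.
    apply: past_weightM; first exact: past_weight_le IH.
    rewrite -[X in past_weight X](subnKC tk).
    exact: past_weight_increments.
  by apply/funext => w; rewrite /Y big_ord_recr expRD.
elim: m => [|m /andP[IH1 IH2]].
  rewrite !big_ord0 expR0 (_ : (fun w => _) = cst 1); last first.
    by apply/funext => w; rewrite big_ord0 expR0.
  rewrite Rintegral_cst// mul1r [X in fine X](_ : _ = 1%E) ?lexx//.
  exact: probability_setT.
have := Hb h u (b m) bh bu (bb m) DC uU Dv (t m) (t m.+1 - t m)%N (Y m) (wY m).
move=> /andP[h1 h2].
rewrite (_ : (fun w => expR (\sum_(j < m.+1) _)) = fun w => Y m w * expR (b m * martingale h (t m) (t m.+1 - t m) w)); last first.
  by apply/funext => w; rewrite /Y big_ord_recr expRD.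
rewrite !big_ord_recr !expRD; apply/andP; split.
  by apply: le_trans h1; rewrite [leLHS]mulrC -expRD ler_wpM2l// expR_ge0.
by apply: le_trans h2 _; rewrite [leRHS]mulrC -expRD ler_wpM2l// expR_ge0.
Qed.

(** Doob's maximal inequality for the exponential of the sum: frozen once it has
reached e^rho, its mean still grows by a factor e^kappa at most at each step, and
it ends above e^rho whenever the sum has reached rho at some time. *)
Lemma maximal_expR kappa rho s L H c : 0 <= kappa ->
  bounded_measurable H -> bounded_measurable c ->
  (forall x, K (expR \o H) x <= expR (kappa + c x)) ->
  exists E : set Omega, [/\ measurable E,
    (P E <= (expR (L%:R * kappa - rho))%:E)%E &
    forall w, ~ E w -> forall k, (k <= L)%N -> increments H c s k w < rho].
Proof.
move=> k0 bH bc Hk.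
pose xs k w := expR (H (X (s + k).+1 w) - c (X (s + k) w)).
(* V k is the exponential of the sum stopped when it first reaches e^rho. *)
pose V := fix V k w : R := match k with 0%N => 1 | k'.+1 =>
  if expR rho <= V k' w then V k' w else V k' w * xs k' w end.
pose A k := [set w | expR rho <= V k w].
have VS k w : V k.+1 w = V k w * \1_(A k) w + V k w * \1_(~` A k) w * xs k w.
  rewrite /= !indicE in_setC; case: ifPn => h.
    by rewrite (mem_set (A := A k) h) mulr1 mulr0 mul0r addr0.
  have -> : (w \in A k) = false by apply/negbTE; apply: contra h => /set_mem.
  by rewrite mulr0 add0r mulr1.
have bxs k : bounded_measurable (fun w => H (X (s + k).+1 w) - c (X (s + k) w)).
  have := bounded_increments (s + k) 1 bH bc; congr bounded_measurable.
  by apply/funext => w; rewrite /increments big_ord1 addn0.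
have axs k : adapted xi (s + k).+1 (fun w => H (X (s + k).+1 w) - c (X (s + k) w)).
  have := @adapted_increments H c (s + k) 1 bH.1 bc.1; rewrite addn1.
  by congr adapted; apply/funext => w; rewrite /increments big_ord1 addn0.
have wA k : past_weight (s + k) (V k) ->
    past_weight (s + k) (\1_(A k) : Omega -> R) /\ past_weight (s + k) (\1_(~` A k) : Omega -> R).
  move=> [aV _].
  have mA : @measurable _ (g_sigma_algebraType (past_generators xi (s + k))) (A k).
    have := aV measurableT `[expR rho, +oo[%classic (measurable_itv _).
    rewrite setTI; congr measurable; apply/seteqP; split => w /=; rewrite in_itv/= andbT//.
  by split; split; [exact: measurable_indic| |apply: measurable_indic; exact: measurableC|];
    exists 1 => w; rewrite indicE; case: (_ \in _); rewrite ?lexx ?ler01.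
have wV k : past_weight (s + k) (V k).
  elim: k => [|k IH].
    exact: past_weight1.
  have [wA1 wA2] := wA k IH.
  have w1 := past_weightM IH wA1.
  have w2 : past_weight (s + k).+1 (fun w => V k w * \1_(~` A k) w * xs k w).
    apply: past_weightM; first by apply: past_weight_le (past_weightM IH wA2); lia.
    exact: past_weight_expR.
  rewrite (_ : V k.+1 = fun w => V k w * \1_(A k) w + V k w * \1_(~` A k) w * xs k w); last first.
    by apply/funext => w; rewrite VS.
  rewrite addnS; have [a1 [B1 b1]] := past_weight_le (leqnSn _) w1; have [a2 [B2 b2]] := w2.
  split; first exact: measurable_funD.
  exists (B1 + B2) => w; have /andP[p1 p2] := b1 w; have /andP[q1 q2] := b2 w.
  by rewrite addr_ge0//= lerD.
have V0 k w : 0 <= V k w by have [_ [B /(_ w)/andP[]]] := wV k.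
have iV k : \int[P]_w V k w <= expR (k%:R * kappa).
  elim: k => [|k IH].
    rewrite mul0r expR0 Rintegral_cst// mul1r [X in fine X](_ : _ = 1%E)//.
    exact: probability_setT.
  have [wA1 wA2] := wA k (wV k).
  have w1 := past_weightM (wV k) wA1; have w2 := past_weightM (wV k) wA2.
  have b1 := past_weight_bounded w1; have b2 := past_weight_bounded w2.
  have bx : bounded_measurable (fun w => V k w * \1_(~` A k) w * xs k w).
    by apply: bounded_measurableM => //; exact: bounded_measurable_expR.
  rewrite (_ : \int[P]_w V k.+1 w = \int[P]_w (V k w * \1_(A k) w) + \int[P]_w (V k w * \1_(~` A k) w * xs k w)); last first.
    rewrite -RintegralD//; [|exact: bounded_integrable|exact: bounded_integrable].
    by apply: eq_Rintegral => w _; rewrite VS.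
  have h2 := expR_step_le w2 bH bc Hk.
  have i1 : 0 <= \int[P]_w (V k w * \1_(A k) w).
    by apply: Rintegral_ge0 => w _; rewrite mulr_ge0.
  have e1 : 1 <= expR kappa by rewrite -expR0 ler_expR.
  have sum : \int[P]_w (V k w * \1_(A k) w) + \int[P]_w (V k w * \1_(~` A k) w) = \int[P]_w V k w.
    rewrite -RintegralD//; [|exact: bounded_integrable|exact: bounded_integrable].
    apply: eq_Rintegral => w _; rewrite !indicE in_setC.
    by case: (_ \in _); rewrite /= ?mulr1 ?mulr0 ?addr0 ?add0r.
  apply: (@le_trans _ _ (expR kappa * \int[P]_w V k w)).
    rewrite -sum mulrDr; apply: lerD => //.
    by rewrite ler_peMl.
  by rewrite -natr1 mulrDl mul1r addrC expRD ler_wpM2l// expR_ge0.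
have mA k : measurable (A k).
  rewrite -[X in measurable X]setTI; apply: measurable_fun_le => //.
  by have [] := past_weight_bounded (wV k).
exists (A L); split => //.
  have markov : expR rho * fine (P (A L)) <= \int[P]_w V L w.
    rewrite -[fine (P (A L))]mul1r -(Rintegral_cst P (mA L) 1) Rintegral_mkcond -RintegralZl//; last first.
      apply: bounded_integrable; have := bounded_measurable_indic R (mA L).
      by congr bounded_measurable; apply/funext => w; rewrite patchE indicE; case: (_ \in _).
    apply: Rintegral_bounded_ler; [|exact: past_weight_bounded (wV L)|].
      apply: bounded_measurableM; first exact: bounded_measurable_cst.
      have := bounded_measurable_indic R (mA L).
      by congr bounded_measurable; apply/funext => w; rewrite patchE indicE; case: (_ \in _).
    move=> w; rewrite patchE; case: ifPn => [/set_mem|]; last by rewrite mulr0.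
    by rewrite mulr1.
  rewrite -[P (A L)]fineK ?fin_num_measure// lee_fin expRD -ler_pdivrMr ?expR_gt0//.
  by rewrite expRN invrK mulrC (le_trans markov).
move=> w NAw k kL.
have stop j : (j <= L)%N -> V j w < expR rho.
  move=> jL; rewrite ltNge; apply/negP => h; apply: NAw.
  rewrite /A/= -(subnKC jL); elim: (L - j)%N => [|i IH]; first by rewrite addn0.
  by rewrite addnS /= IH.
have VE j : (j <= L)%N -> V j w = expR (increments H c s j w).
  elim: j => [|j IH] jL; first by rewrite /increments big_ord0 expR0.
  have jL' : (j <= L)%N by lia.
  by rewrite /= leNgt (stop j jL') /= IH// incrementsS expRD.
by have := stop k kL; rewrite VE// ltr_expR.
Qed.

(** The two signs are treated separately; the kernel is bounded by [cosh_le]. *)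
Lemma maximal_martingale C b rho s L h : 0 <= C -> bounded_measurable h ->
  (forall x, `|(h (Defs.rot a x) - h (Defs.rot (- a) x)) / 2| <= C) -> 0 < b ->
  exists E : set Omega, [/\ measurable E,
    (P E <= (2 * expR (L%:R * (2 * b ^+ 2 * C ^+ 2) - rho))%:E)%E &
    forall w, ~ E w -> forall k, (k <= L)%N -> `|martingale h s k w| < rho / b].
Proof.
move=> C0 bh DC b0; have bKh := bounded_measurable_walk_kernel a bh.
have k0 : 0 <= 2 * b ^+ 2 * C ^+ 2 by rewrite !mulr_ge0 ?exprn_ge0 ?(ltW b0).
have one (e : R) : `|e| = b -> exists E : set Omega, [/\ measurable E,
    (P E <= (expR (L%:R * (2 * b ^+ 2 * C ^+ 2) - rho))%:E)%E &
    forall w, ~ E w -> forall k, (k <= L)%N -> e * martingale h s k w < rho].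
  move=> eb; have bM (g : torus R -> R) : bounded_measurable g -> bounded_measurable (fun x => e * g x).
    by move=> bg; apply: bounded_measurableM => //; exact: bounded_measurable_cst.
  have [|E [mE PE HE]] := @maximal_expR _ rho s L _ _ k0 (bM _ bh) (bM _ bKh).
    move=> x; have [h1 h2] := kernel_split h x.
    set D := (_ - _) / 2 in h1 h2.
    have -> : K (expR \o (fun x => e * h x)) x = (expR (e * D) + expR (- (e * D))) / 2 * expR (e * K h x).
      rewrite [RHS]mulrAC mulrDl -!expRD [LHS]/walk_kernel/=; congr ((expR _ + expR _) / 2).
        by rewrite -h1; ring.
      by rewrite -mulrN -h2; ring.
    rewrite expRD ler_pM2r ?expR_gt0//; apply: le_trans (cosh_le _) _.
    rewrite ler_expR -mulrA ler_wpM2l// -exprMn -real_normK ?num_real//.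
    by rewrite lerXn2r ?nnegrE ?mulr_ge0// ?(ltW b0)// normrM eb ler_wpM2l ?(ltW b0)//; exact: DC.
  exists E; split => // w Ew k kL; have := HE w Ew k kL; congr (_ < _).
  by rewrite /martingale /increments mulr_sumr; apply: eq_bigr => i _; rewrite mulrBr.
have [E1 [mE1 PE1 HE1]] := one b (gtr0_norm b0).
have [|E2 [mE2 PE2 HE2]] := one (- b); first by rewrite normrN gtr0_norm.
exists (E1 `|` E2); split; first exact: measurableU.
  apply: le_trans (measureU2 _ mE1 mE2) _.
  by rewrite mulr_natl mulr2n EFinD leeD.
move=> w /not_orP[n1 n2] k kL; rewrite ltr_pdivlMr// mulrC.
have := HE1 w n1 k kL; have := HE2 w n2 k kL.
by rewrite -[b in b * `|_|](gtr0_norm b0) -normrM ltr_norml => g1 g2; apply/andP; split; lra.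
Qed.

End exponential_increments.

(** * Moderate deviations from a martingale approximation *)

Section step_paths.
Context d (Omega : measurableType d) (R : realType).

(** A step path depends continuously on finitely many values, so that the event
that it lies in an open set is a countable union of rational boxes. *)
Lemma measurable_step_path (T : nat -> Omega -> R) (c : R) n (G : set (cadlag R)) :
  (forall k, measurable_fun setT (T k)) -> <<s (@open (cadlag R)) >> G ->
  measurable [set w | G (cadlag_scale c (cadlag_step (fun k => T k w) n))].
Proof.
move=> mT; pose phi (s : nat -> R) := cadlag_scale c (cadlag_step s n).
suff openU (U : set (cadlag R)) : open U -> measurable [set w | U (phi (T^~ w))].
  move=> sG; pose M : set (set (cadlag R)) := [set A | measurable [set w | A (phi (T^~ w))]].
  apply: (sG M); split; last by move=> U /openU.
  split.
  - rewrite /M/= (_ : [set w | set0 (phi (T^~ w))] = set0)//.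
  - move=> A; rewrite /M/= => mA.
    rewrite (_ : [set w | _] = ~` [set w | A (phi (T^~ w))]); first exact: measurableC.
    by apply/seteqP; split => w /=; [move=> [_]|move=> ?; split].
  - move=> F; rewrite /M/= => mF.
    rewrite (_ : [set w | _] = \bigcup_k [set w | F k (phi (T^~ w))]); first exact: bigcupT_measurable.
    by apply/seteqP; split => w /= [k _ Fk]; exists k.
move=> oU.
pose box (q : {ffun 'I_n.+1 -> rat} * nat) := [set w | forall k : 'I_n.+1,
  `|T k w - ratr (q.1 k)| < (q.2.+1%:R)^-1 :> R].
pose good (q : {ffun 'I_n.+1 -> rat} * nat) := forall s : nat -> R,
  (forall k : 'I_n.+1, `|s k - ratr (q.1 k)| < (q.2.+1%:R)^-1 :> R) -> U (phi s).
have -> : [set w | U (phi (T^~ w))] = \bigcup_q (if `[< good q >] then box q else set0).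
  apply/seteqP; split => w /=; last first.
    by move=> [q _]; case: asboolP => // gq; exact: gq.
  move=> Uw; have : nbhs (phi (T^~ w)) U by apply: open_nbhs_nbhs; split.
  move=> /nbhs_ballP[e /= e0 eU].
  have c1 : 0 < `|c| + 1 by rewrite ltr_wpDl.
  pose N := Num.truncn (4 * (`|c| + 1) / e).
  have N0 : 0 < N.+1%:R :> R by [].
  have Ne : (N.+1%:R)^-1 * (`|c| + 1) < e / 4.
    rewrite mulrC ltr_pdivrMr// mulrC -ltr_pdivrMr ?divr_gt0//.
    by rewrite invf_div mulrA [X in X / _]mulrC truncnS_gt.
  have /choice[q Hq] : forall k : 'I_n.+1, exists q : rat, `|T k w - ratr q| < (N.+1%:R)^-1.
    move=> k; have [|q] := @rat_in_itvoo R (T k w - (N.+1%:R)^-1) (T k w + (N.+1%:R)^-1).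
      by rewrite ltrD2l gt0_cp// invr_gt0.
    rewrite in_itv/= => /andP[q1 q2]; exists q.
    by rewrite distrC ltr_distl q1 q2.
  exists (finfun q, N) => //; rewrite asboolT; first by move=> k; rewrite /= ffunE; exact: Hq.
  move=> s Hs; apply: eU; apply: (@skorohod_ball_sup _ _ _ _ (e / 2)).
    by rewrite ltr_pdivrMr// ltr_pMr// ltr1n.
  move=> t /andP[t0 t1]; rewrite /= /step_fun in_itv/= t0 t1/=.
  set k := Num.truncn _.
  have kn : (k < n.+1)%N.
    rewrite ltnS -(@natrK R n); apply: le_truncn.
    by rewrite ler_piMr.
  have := Hs (Ordinal kn); have := Hq (Ordinal kn); rewrite /= ffunE.
  set x := ratr _ => h1 h2.
  have h : `|T k w - s k| <= 2 * (N.+1%:R)^-1.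
    rewrite -(subrKA x) (le_trans (ler_normD _ _))// [`|x - _|]distrC.
    by rewrite mulr_natl mulr2n lerD// ltW.
  rewrite -mulrBr normrM (le_trans (ler_wpM2l (normr_ge0 _) h))//.
  have : 0 <= (N.+1%:R)^-1 :> R by rewrite invr_ge0.
  by move: (N.+1%:R^-1) Ne => i Ne i0; lra.
apply: countable_bigcupT_measurable; first exact: countableP.
move=> q; case: asboolP => // _.
rewrite (_ : box q = \bigcap_(k in [set` 'I_n.+1]) [set w | `|T (k : 'I_n.+1) w - ratr (q.1 k)| < (q.2.+1%:R)^-1]); last first.
  by apply/seteqP; split => w /= H k; [move=> _|]; exact: H.
apply: fin_bigcap_measurable => // k _.
rewrite -[X in measurable X]setTI; apply: measurable_fun_ltr => //.
by apply: measurableT_comp => //; exact: measurable_funB.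
Qed.

End step_paths.

Lemma measurable_partial_sum_process d (Omega : measurableType d) (R : realType)
    (P : probability Omega R) (xi : int -> {RV P >-> torus R}) (f : torus R -> R)
    (c : R) n (G : set (cadlag R)) :
  measurable_fun setT f -> <<s (@open (cadlag R)) >> G ->
  measurable [set w | G (cadlag_scale c (partial_sum_process f xi n w))].
Proof.
move=> mf; apply: (@measurable_step_path _ _ _
  (fun k w => (Num.sqrt n%:R)^-1 * \sum_(1 <= i < k.+1) (f (xi i%:Z w) - mean f))).
move=> k; apply: measurable_funM => //; elim: k => [|k IH].
  by under eq_fun do rewrite big_geq//; exact: measurable_cst.
under eq_fun do rewrite big_nat_recr//=; apply: measurable_funD => //.
by apply: measurable_funB => //; apply: measurableT_comp => //; exact: measurable_funPT.
Qed.

Section chain_mdp.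
Context d (Omega : measurableType d) (R : realType) (P : probability Omega R).
Variables (a : R) (xi : int -> {RV P >-> torus R}).
Hypothesis chain : stationary_markov_chain (walk_kernel a) (@haar R) xi.
Local Notation K := (walk_kernel a).
Local Notation X := (chain_at xi).
Variables (f : torus R -> R) (h : nat -> torus R -> R) (C sigma : R) (N : set (torus R)).
Hypothesis mf : measurable_fun setT f.
Hypothesis C_ge0 : 0 <= C.
Hypothesis bh : forall n, bounded_measurable (h n).
Hypothesis mN : measurable N.
Hypothesis N0 : @haar R N = 0%E.
Hypothesis approx : forall n x, ~ N x ->
  `|f x - mean f - (h n x - K (h n) x)| <= C / Num.sqrt n.+1%:R.
Hypothesis h_le : forall n x, `|h n x| <= C * Num.sqrt n.+1%:R.
Local Notation D := (fun n x => (h n (Defs.rot a x) - h n (Defs.rot (- a) x)) / 2).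
Hypothesis D_le : forall n x, `|D n x| <= C.
Hypothesis D_sqr : forall eta, 0 < eta -> exists2 u, bounded_measurable u &
  \forall n \near \oo, forall x, `|D n x ^+ 2 + (K u x - u x) - sigma ^+ 2| <= eta.
Variable a_ : nat -> R.
Hypothesis a_gt0 : forall n, 0 < a_ n.
Hypothesis a_0 : a_ n @[n --> \oo] --> 0.
Hypothesis na_y : n%:R * a_ n @[n --> \oo] --> +oo.

Let T k w := \sum_(1 <= i < k.+1) (f (xi i%:Z w) - mean f).
Let Z n w := cadlag_scale (Num.sqrt (a_ n)) (partial_sum_process f xi n w).
Let lam n := (a_ n)^-1.
Let sc n := Num.sqrt (a_ n) * (Num.sqrt n%:R)^-1.

Let lam_gt0 n : 0 < lam n.
Proof. by rewrite invr_gt0. Qed.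

Let lam_y : lam n @[n --> \oo] --> +oo.
Proof.
apply/cvgryPge => A; have A0 : 0 < (`|A| + 1)^-1 by rewrite invr_gt0 ltr_wpDl.
have : \forall n \near \oo, `|a_ n| < (`|A| + 1)^-1 by move/cvgr0Pnorm_lt : a_0; exact.
apply: filterS => n; rewrite gtr0_norm// => an.
have : `|A| + 1 <= (a_ n)^-1 by rewrite -[leLHS]invrK lef_pV2 ?posrE// ltW.
by apply: le_trans; rewrite (le_trans (ler_norm _))// lerDl.
Qed.

Let ZE n w t : 0 <= t <= 1 -> Z n w t = sc n * T (Num.truncn (n%:R * t)) w.
Proof. by move=> t01; rewrite /Z/= /step_fun in_itv/= t01 mulrA. Qed.

Let mT k : measurable_fun setT (T k).
Proof.
rewrite /T; elim: k => [|k IH].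
  by under eq_fun do rewrite big_geq//; exact: measurable_cst.
under eq_fun do rewrite big_nat_recr//=; apply: measurable_funD => //.
by apply: measurable_funB => //; apply: measurableT_comp => //; exact: measurable_funPT.
Qed.

Let martingaleD g j k w : martingale a xi g 1 (j + k) w =
  martingale a xi g 1 j w + martingale a xi g (1 + j) k w.
Proof.
elim: k => [|k IH]; first by rewrite addn0 {3}/martingale /increments big_ord0 addr0.
rewrite addnS /martingale in IH *; rewrite [LHS]incrementsS [X in _ = _ + X]incrementsS IH.
by rewrite -!addnA -!addrA.
Qed.

(** The paths that visit the null set where the approximation fails. *)
Let bad := \bigcup_(i : nat) (X i @^-1` N).

Let mbad : measurable bad.
Proof.
apply: bigcupT_measurable => i; rewrite -[X in measurable X]setTI.
exact: measurable_funPT.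
Qed.

Let P_bad : P bad = 0%E.
Proof.
suff : P.-negligible bad by move=> /negligibleP ->.
apply: negligible_bigcup => i; apply/negligibleP.
  by rewrite -[X in measurable X]setTI; exact: measurable_funPT.
by have := chain.1 i%:Z N mN; rewrite N0.
Qed.

(** The sum of the errors of the Poisson equation is at most n C / sqrt (n+1), and
the telescoping part h(X 1) - h(X k+1) at most 2 C sqrt (n+1). *)
Let deviation w n k : ~ bad w -> (k <= n)%N ->
  `|T k w - martingale a xi (h n) 1 k w| <= 3 * C * Num.sqrt n.+1%:R.
Proof.
move=> nb kn; set q := Num.sqrt n.+1%:R.
have q0 : 0 < q by rewrite sqrtr_gt0.
have qq : q * q = n.+1%:R by rewrite -expr2 sqr_sqrtr.
have nN i : ~ N (X i w) by move=> NX; apply: nb; exists i.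
have E : T k w - martingale a xi (h n) 1 k w =
    \sum_(i < k) (f (X i.+1 w) - mean f - (h n (X i.+1 w) - K (h n) (X i.+1 w)))
    + (h n (X 1 w) - h n (X k.+1 w)).
  rewrite /T /martingale; elim: k {kn} => [|k IH].
    by rewrite big_geq// /increments !big_ord0 !subrr addr0.
  rewrite big_nat_recr//= incrementsS big_ord_recr/= add1n.
  move: IH; rewrite {2}/chain_at; lra.
rewrite E (le_trans (ler_normD _ _))//.
have -> : 3 * C * q = C * q + (C * q + C * q) by ring.
apply: lerD; last by rewrite (le_trans (ler_normB _ _))// lerD// h_le.
apply: (le_trans (ler_norm_sum _ _ _)).
apply: (@le_trans _ _ (\sum_(i < k) C / q)).
  by apply: ler_sum => i _; exact: approx.
rewrite sumr_const card_ord -[leLHS]mulr_natr -mulrA ler_wpM2l// mulrC ler_pdivrMr// qq.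
by rewrite ler_nat; lia.
Qed.

Let deviationD w n j k : ~ bad w -> (j + k <= n)%N ->
  `|(T (j + k) w - T j w) - martingale a xi (h n) (1 + j) k w| <= 6 * C * Num.sqrt n.+1%:R.
Proof.
move=> nb jkn; have h1 := deviation nb jkn.
have h2 := @deviation w n j nb (leq_trans (leq_addr _ _) jkn).
have -> : T (j + k) w - T j w - martingale a xi (h n) (1 + j) k w =
  (T (j + k) w - martingale a xi (h n) 1 (j + k) w) - (T j w - martingale a xi (h n) 1 j w).
  by rewrite martingaleD; ring.
by rewrite (le_trans (ler_normB _ _))//; lra.
Qed.

(** The coefficient of the partial sums in the exponents at speed lam: it tends to
0, which makes the estimates for small b available, and kap^2 n = lam. *)
Let kap n := lam n * sc n.

Let kap_sqr n : (0 < n)%N -> kap n ^+ 2 * n%:R = lam n.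
Proof.
move=> n0; rewrite /kap /sc /lam !exprMn exprVn !sqr_sqrtr ?ltW//.
by rewrite exprVn sqr_sqrtr//; field; rewrite pnatr_eq0 -lt0n n0 gt_eqF.
Qed.

Let kap_gt0 n : (0 < n)%N -> 0 < kap n.
Proof. by move=> n0; rewrite mulr_gt0// mulr_gt0 ?invr_gt0 ?sqrtr_gt0 ?ltr0n. Qed.

Let kap0 : kap n @[n --> \oo] --> 0.
Proof.
apply/cvgr0Pnorm_lt => e e0.
have : \forall n \near \oo, (e ^+ 2)^-1 + 1 <= n%:R * a_ n by move/cvgryPge : na_y; exact.
apply: filter_app; near=> n => na; have n0 : (0 < n)%N by near: n; exact: nbhs_infty_gt.
rewrite gtr0_norm ?kap_gt0// -(ltr_pXn2r (n := 2))// ?nnegrE ?ltW ?kap_gt0//.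
have -> : kap n ^+ 2 = (n%:R * a_ n)^-1.
  have n1 : n%:R != 0 :> R by rewrite pnatr_eq0 -lt0n.
  apply: (mulIf n1); rewrite kap_sqr// /lam; field.
  by rewrite n1 gt_eqF.
rewrite invf_plt ?posrE ?exprn_gt0//; last by rewrite mulr_gt0 ?ltr0n.
by rewrite (lt_le_trans _ na)// ltrDl.
Unshelve. all: by end_near. Qed.

(** The error of the martingale approximation, of order sqrt n, tends to 0 in the
scale of the paths, since a_n does. *)
Let near_error (B : R) : \forall n \near \oo, sc n * Num.sqrt n.+1%:R * B <= 1.
Proof.
have B1 : 0 < 2 * (`|B| + 1) by rewrite mulr_gt0// ltr_wpDl.
have : \forall n \near \oo, `|a_ n| < (2 * (`|B| + 1)) ^- 2.
  by move/cvgr0Pnorm_lt : a_0; apply; rewrite invr_gt0 exprn_gt0.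
apply: filter_app; near=> n; rewrite gtr0_norm// => an.
have n0 : (0 < n)%N by near: n; exact: nbhs_infty_gt.
have sn : 0 < Num.sqrt n%:R :> R by rewrite sqrtr_gt0 ltr0n.
have s2 : Num.sqrt n.+1%:R <= 2 * Num.sqrt n%:R :> R.
  rewrite -(ler_pXn2r (n := 2))// ?nnegrE ?mulr_ge0 ?sqrtr_ge0// exprMn !sqr_sqrtr//.
  by rewrite -natrX -natrM ler_nat; lia.
have sa : Num.sqrt (a_ n) <= (2 * (`|B| + 1))^-1.
  rewrite -[leRHS]ger0_norm ?invr_ge0 ?(ltW B1)// -sqrtr_sqr ler_wsqrtr// exprVn.
  exact: ltW.
have s0 : 0 <= Num.sqrt (a_ n) by exact: sqrtr_ge0.
apply: (@le_trans _ _ (sc n * Num.sqrt n.+1%:R * (`|B| + 1))).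
  apply: ler_wpM2l; last by rewrite (le_trans (ler_norm _))// lerDl.
  by rewrite mulr_ge0 ?sqrtr_ge0// mulr_ge0// invr_ge0 ltW.
rewrite -ler_pdivlMr ?ltr_wpDl// mul1r.
apply: (@le_trans _ _ (Num.sqrt (a_ n) * 2)).
  by rewrite /sc -mulrA ler_wpM2l// mulrC ler_pdivrMr.
rewrite mulrC -ler_pdivlMl//; apply: le_trans sa _.
by rewrite invfM.
Unshelve. all: by end_near. Qed.

(** The time of the chain at the j-th point of the grid. *)
Let node m n j := Num.truncn (n%:R * (j%:R / m.+1%:R) : R).

Let node_le m n j : (j <= m.+1)%N -> (node m n j <= n)%N.
Proof.
move=> jm; rewrite -{2}(@natrK R n); apply: le_truncn.
by rewrite ler_piMr// ler_pdivrMr// mul1r ler_nat.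
Qed.

Let node_homo m n : {homo node m n : i j / (i <= j)%N}.
Proof.
move=> i j ij; apply: le_truncn; rewrite ler_wpM2l// ler_pM2r ?invr_gt0//.
by rewrite ler_nat.
Qed.

Let node_step m n j : `|(node m n j.+1 - node m n j)%:R - n%:R / m.+1%:R| <= 1 :> R.
Proof.
rewrite natrB; last exact: node_homo.
have ge0 i : 0 <= n%:R * (i%:R / m.+1%:R) :> R by rewrite mulr_ge0// divr_ge0.
have /andP[h1 h2] := truncn_itv (ge0 j.+1); have /andP[h3 h4] := truncn_itv (ge0 j).
rewrite -[X in _ < X]natr1 in h2; rewrite -[X in _ < X]natr1 in h4.
rewrite -!/(node m n _) in h1 h2 h3 h4.
have E : n%:R * (j.+1%:R / m.+1%:R) = n%:R * (j%:R / m.+1%:R) + n%:R / m.+1%:R :> R.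
  by rewrite -natr1; field.
rewrite E in h1 h2; move: h1 h2 h3 h4; set y := n%:R / _; set z := n%:R * _.
by move: y z => y z *; rewrite ler_norml; apply/andP; split; lra.
Qed.

(** The number of steps in a cell of the grid is n/(m+1) up to 1, and
n kap_n^2 is the speed. *)
Let cell_sum m n (theta : nat -> R) (x0 eta y e U : R) : (0 < n)%N -> `|y| <= eta -> `|e| <= U ->
  `|\sum_(j < m.+1) ((node m n j.+1 - node m n j)%:R * ((kap n * theta j) ^+ 2 / 2 * (x0 + 2 * y)) +
      (kap n * theta j) ^+ 2 * e) -
    lam n * (x0 / m.+1%:R / 2 * \sum_(j < m.+1) theta j ^+ 2)| <=
  lam n * ((\sum_(j < m.+1) theta j ^+ 2) * (((`|x0| + 2 * eta) / 2 + U) / n%:R + eta)).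
Proof.
move=> n0 yeta eU; have nn : n%:R != 0 :> R by rewrite pnatr_eq0 -lt0n.
have k2 := kap_sqr n0.
rewrite [X in _ - X]mulrA [X in _ - X]mulr_sumr -sumrB [leRHS]mulrCA [leRHS]mulr_suml.
apply: le_trans (ler_norm_sum _ _ _) _; apply: ler_sum => j _.
set L := (_ - _)%:R; have Lm : `|L - n%:R / m.+1%:R| <= 1 by exact: node_step.
have -> : L * ((kap n * theta j) ^+ 2 / 2 * (x0 + 2 * y)) + (kap n * theta j) ^+ 2 * e -
    lam n * (x0 / m.+1%:R / 2) * theta j ^+ 2 =
    theta j ^+ 2 * kap n ^+ 2 * ((L - n%:R / m.+1%:R) * ((x0 + 2 * y) / 2) + e + n%:R / m.+1%:R * y).
  by rewrite -k2; field.
rewrite -mulrA normrM ger0_norm ?sqr_ge0// ler_wpM2l ?sqr_ge0//.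
have -> : lam n * (((`|x0| + 2 * eta) / 2 + U) / n%:R + eta) =
  kap n ^+ 2 * ((`|x0| + 2 * eta) / 2 + U + n%:R * eta) by rewrite -k2; field.
rewrite normrM ger0_norm ?sqr_ge0// ler_wpM2l ?sqr_ge0//.
rewrite (le_trans (ler_normD _ _))// lerD//.
  rewrite (le_trans (ler_normD _ _))// lerD// normrM.
  apply: (@le_trans _ _ (1 * ((`|x0| + 2 * eta) / 2))); last by rewrite mul1r.
  apply: ler_pM => //; rewrite normrM normfV normr_nat ler_pM2r//.
  by rewrite (le_trans (ler_normD _ _))// lerD2l normrM normr_nat ler_wpM2l.
rewrite -mulrA normrM normr_nat ler_wpM2l// normrM normfV normr_nat.
rewrite mulrC ler_pdivrMr// (le_trans yeta)// ler_peMr// ?ler1n//.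
exact: le_trans (normr_ge0 _) yeta.
Qed.

(** The increments of Z on the grid are those of the martingale of h n up to a
negligible error, off a null set; [martingale_blocks] with the coefficients
kap theta_j computes the Laplace transform of the latter. *)
Lemma chain_laplace_asymptotics : laplace_asymptotics P lam Z sigma.
Proof.
move=> m theta eta eta0.
(* The blocks are numbered by natural numbers, to which inord extends theta; B
bounds all the values of the extension. *)
pose th j := theta (inord j) : R.
pose S := \sum_(j < m.+1) th j ^+ 2.
pose B := \sum_(j < m.+1) `|th j|.
have S0 : 0 <= S by apply: sumr_ge0 => j _; exact: sqr_ge0.
have B0 : 0 <= B by apply: sumr_ge0.
have SE : S = \sum_j theta j ^+ 2 by apply: eq_bigr => j _; rewrite /th inord_val.
have eta42 : eta / 4 <= eta / 2 by lra.
pose eta' := eta / (8 * (S + 1)).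
have eta'0 : 0 < eta' by rewrite divr_gt0// mulr_gt0// ltr_wpDl.
have [u bu Hu] := D_sqr eta'0; have [mu [U0 uU0]] := bu.
pose U := `|U0|; have uU x : `|u x| <= U by rewrite (le_trans (uU0 x))// ler_norm.
have [b0 b0p Hb] := martingale_blocks chain (sigma ^+ 2) C_ge0 (normr_ge0 U0) eta'0.
pose A := S * ((`|sigma ^+ 2| + 2 * eta') / 2 + U).
have /cvgr0Pnorm_lt/(_ (b0 / (B + 1))) := kap0.
have b0B : 0 < b0 / (B + 1) by rewrite divr_gt0// ltr_wpDl.
move=> /(_ b0B) near_kap.
have near_err := near_error (B * (6 * C) * (4 / eta)).
near=> n.
have n0 : (0 < n)%N by near: n; exact: nbhs_infty_gt.
have n0R : 0 < n%:R :> R by rewrite ltr0n.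
have kb : `|kap n| < b0 / (B + 1) by near: n.
have err : sc n * Num.sqrt n.+1%:R * (B * (6 * C) * (4 / eta)) <= 1 by near: n.
have An : A / n%:R <= eta / 4.
  rewrite ler_pdivrMr// mulrC -ler_pdivrMr ?divr_gt0//.
  by near: n; exact: nbhs_infty_ger.
have Dn : forall x, `|D n x ^+ 2 + (K u x - u x) - sigma ^+ 2| <= eta' by near: n.
have thB j : `|th j| <= B.
  rewrite /B (bigD1 (inord j))//= {2}/th inord_val -/(th j) lerDl.
  exact: sumr_ge0.
have bb j : `|kap n * th j| <= b0.
  rewrite normrM; apply: (@le_trans _ _ (b0 / (B + 1) * (B + 1))).
    by apply: ler_pM => //; [exact: ltW|rewrite (le_trans (thB j))// lerDl].
  by rewrite divfK// gt_eqF// ltr_wpDl.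
have := Hb (h n) u (fun j => kap n * th j) (fun j => (1 + node m n j)%N) (bh n) bu (@D_le n) uU Dn bb.
have hom : {homo (fun j => (1 + node m n j)%N) : i j / (i <= j)%N}.
  by move=> i j ij; rewrite leq_add2l; exact: node_homo.
move=> /(_ hom m.+1).
under eq_bigr do rewrite subnDl.
under [X in _ <= X <= _]eq_Rintegral do under eq_bigr do rewrite subnDl.
under [X in _ <= _ <= expR X]eq_bigr do rewrite subnDl.
set Mg := (fun w => expR _) => /andP[lo hi].
have eta'S : S * eta' <= eta / 8.
  rewrite /eta' invfM mulrCA !mulrA ler_pdivrMr ?ltr_wpDl//.
  by rewrite [_ * S]mulrC -mulrA [X in X <= _]mulrC ler_wpM2l ?divr_ge0 ?(ltW eta0)// lerDl.
have cs (y e : R) : `|y| <= eta' -> `|e| <= U ->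
  `|\sum_(j < m.+1) ((node m n j.+1 - node m n j)%:R * ((kap n * th j) ^+ 2 / 2 * (sigma ^+ 2 + 2 * y)) +
      (kap n * th j) ^+ 2 * e) -
    lam n * (sigma ^+ 2 / m.+1%:R / 2 * S)| <= lam n * (eta / 2).
  move=> ye eU; have := cell_sum m th (sigma ^+ 2) n0 ye eU; rewrite -/S => /le_trans; apply.
  rewrite ler_wpM2l ?(ltW (lam_gt0 n))// -/S mulrDr mulrA -/A.
  by move: eta'S An eta0; lra.
have U1 : 0 <= U by exact: normr_ge0.
have cs1 := cs (- eta') (- U); rewrite !normrN (gtr0_norm eta'0) (ger0_norm U1) in cs1.
have cs2 := cs eta' U; rewrite (gtr0_norm eta'0) (ger0_norm U1) in cs2.
have {}cs1 := cs1 (lexx _) (lexx _); have {}cs2 := cs2 (lexx _) (lexx _).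
have lo' : expR (lam n * (sigma ^+ 2 / m.+1%:R / 2 * S - eta / 2)) <= \int[P]_w Mg w.
  apply: le_trans lo; rewrite ler_expR.
  move: cs1; rewrite ler_norml => /andP[+ _].
  set s1 := (X in - _ <= X - _); set s2 := (X in _ -> _ <= X).
  have -> : s1 = s2 by apply: eq_bigr => j _; rewrite /U; ring.
  by rewrite mulrBr lerBrDr [X in X <= _ -> _]addrC.
have hi' : \int[P]_w Mg w <= expR (lam n * (sigma ^+ 2 / m.+1%:R / 2 * S + eta / 2)).
  apply: le_trans hi _; rewrite ler_expR.
  by move: cs2; rewrite ler_norml mulrDr => /andP[_]; rewrite lerBlDr [X in _ <= X -> _]addrC.
pose F w := expR (lam n * \sum_j theta j * grid_increment Z n j w).
have bMg : bounded_measurable Mg.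
  apply: bounded_measurable_expR; apply: bounded_measurable_sum => j.
  apply: bounded_measurableM; first exact: bounded_measurable_cst.
  by apply: bounded_increments => //; exact: bounded_measurable_walk_kernel.
have mMg : measurable_fun setT (EFin \o Mg) by apply/measurable_EFinP; exact: bMg.1.
have MgE : (\int[P]_w (Mg w)%:E)%E = (\int[P]_w Mg w)%:E.
  rewrite /Rintegral fineK//; apply: integrable_fin_num => //.
  exact: bounded_measurable_integrable.
have mF : measurable_fun setT F.
  apply: measurableT_comp => //; apply: measurable_funM => //.
  apply: measurable_sum => j; apply: measurable_funM => //.
  have mZt t : 0 <= t <= 1 -> measurable_fun setT (fun w => Z n w t).
    move=> t01; under eq_fun do rewrite ZE//.
    by apply: measurable_funM => //; exact: mT.
  apply: measurable_funB; apply: mZt; rewrite divr_ge0//= ler_pdivrMr// mul1r ler_nat//.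
  exact: ltnW.
have FM w : ~ bad w -> `|lam n * (\sum_j theta j * grid_increment Z n j w) - \sum_(j < m.+1)
    kap n * th j * martingale a xi (h n) (1 + node m n j) (node m n j.+1 - node m n j) w| <= lam n * (eta / 2).
  move=> nb; rewrite mulr_sumr -sumrB; apply: le_trans (ler_norm_sum _ _ _) _.
  apply: (@le_trans _ _ (\sum_(j < m.+1) kap n * `|th j| * (6 * C * Num.sqrt n.+1%:R))).
    apply: ler_sum => j _; rewrite /grid_increment !ZE; last 2 first.
    - by rewrite divr_ge0//= ler_pdivrMr// mul1r ler_nat ltnW.
    - by rewrite divr_ge0//= ler_pdivrMr// mul1r ler_nat.
    rewrite -!/(node _ _ _) -mulrBr.
    have jj : (node m n j + (node m n j.+1 - node m n j) = node m n j.+1)%N.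
      by rewrite subnKC//; exact: node_homo.
    have := @deviationD w n (node m n j) (node m n j.+1 - node m n j)%N nb.
    rewrite jj => /(_ (node_le n (ltn_ord j))).
    set DT := T _ w - T _ w; set M := martingale _ _ _ _ _ _ => dev.
    have -> : lam n * (theta j * (sc n * DT)) - kap n * th j * M = kap n * th j * (DT - M).
      by rewrite /th inord_val /kap; ring.
    rewrite normrM normrM (gtr0_norm (kap_gt0 n0)) ler_wpM2l//.
    by rewrite mulr_ge0// ltW// kap_gt0.
  rewrite -mulr_suml -mulr_sumr -/B.
  have -> : kap n * B * (6 * C * Num.sqrt n.+1%:R) =
      lam n * (sc n * Num.sqrt n.+1%:R * (B * (6 * C))) by rewrite /kap; ring.
  rewrite ler_wpM2l ?(ltW (lam_gt0 n))//.
  have e4 : 0 <= eta / 4 by rewrite divr_ge0// ltW.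
  have := ler_wpM2r e4 err; rewrite mul1r.
  have -> : sc n * Num.sqrt n.+1%:R * (B * (6 * C) * (4 / eta)) * (eta / 4) =
      sc n * Num.sqrt n.+1%:R * (B * (6 * C)) by field; rewrite gt_eqF.
  by move/le_trans; apply.
have ae1 (g1 g2 : Omega -> R) : measurable_fun setT g1 -> measurable_fun setT g2 ->
  (forall w, 0 <= g1 w) -> (forall w, 0 <= g2 w) -> (forall w, ~ bad w -> g1 w <= g2 w) ->
  (\int[P]_w (g1 w)%:E <= \int[P]_w (g2 w)%:E)%E.
  move=> m1 m2 p1 p2 H; apply: ae_ge0_le_integral => //.
  - by move=> w _; rewrite lee_fin.
  - exact/measurable_EFinP.
  - by move=> w _; rewrite lee_fin.
  - exact/measurable_EFinP.
  exists bad; split; [exact: mbad|exact: P_bad|].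
  by move=> w /= Hw; apply: contrapT => nb; apply: Hw => _; rewrite lee_fin; exact: H.
have Mgp (c : R) : (\int[P]_w (expR c * Mg w)%:E)%E = (expR c * \int[P]_w Mg w)%:E.
  under eq_integral do rewrite EFinM.
  rewrite ge0_integralZl//; first by rewrite MgE -EFinM.
  by move=> w _; rewrite lee_fin expR_ge0.
have mMgc (c : R) : measurable_fun setT (fun w => expR c * Mg w).
  by apply: measurable_funM => //; exact: bMg.1.
have aux1 (l s : R) : - (l * (eta / 2)) + l * (s - eta / 2) = l * (s - eta) by field.
have aux2 (l s : R) : l * (eta / 2) + l * (s + eta / 2) = l * (s + eta) by field.
rewrite /laplace -SE; split.
  apply: (@le_trans _ _ (\int[P]_w (expR (- (lam n * (eta / 2))) * Mg w)%:E)%E).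
    rewrite Mgp lee_fin; apply: le_trans (ler_wpM2l (expR_ge0 _) lo').
    by rewrite -expRD aux1.
  have Mg0 c w : 0 <= expR c * Mg w by rewrite mulr_ge0 ?expR_ge0.
  apply: ae1 => // w nb.
  rewrite -expRD ler_expR; have := FM w nb; rewrite ler_norml => /andP[+ _].
  by rewrite lerBrDr.
apply: (@le_trans _ _ (\int[P]_w (expR (lam n * (eta / 2)) * Mg w)%:E)%E).
  have Mg0 c w : 0 <= expR c * Mg w by rewrite mulr_ge0 ?expR_ge0.
  apply: ae1 => // w nb.
  rewrite -expRD ler_expR; have := FM w nb; rewrite ler_norml => /andP[_].
  by rewrite lerBlDr.
rewrite Mgp lee_fin; apply: le_trans (ler_wpM2l (expR_ge0 _) hi') _.
by rewrite -expRD aux2.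
Unshelve. all: by end_near. Qed.

(** A maximal inequality in each cell, with b = x kap: a cell has about n/(m+1)
steps, so that the variance term is small at the speed lam when m is large,
while x may be chosen to make the gain lam x r / 2 as large as wanted. *)
Lemma chain_small_oscillations : small_oscillations P lam Z.
Proof.
move=> r K0 r0.
have aux (l u k k' : R) : u <= l * 2 -> l * k <= l * k' -> l * 1 + (u - l * (k' + 3)) <= - (l * k).
  by move=> h1 h2; lra.
(* Among the three units, two bound the variance term and one pays for the number
of cells. *)
pose x := 2 * (`|K0| + 3) / r.
have x0 : 0 < x by rewrite divr_gt0// mulr_gt0// ltr_wpDl.
pose q := 2 * x ^+ 2 * C ^+ 2; have q0 : 0 <= q by rewrite mulr_ge0 ?sqr_ge0// mulr_ge0 ?sqr_ge0.
near=> m.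
have qm : q / m.+1%:R <= 1.
  rewrite ler_pdivrMr// mul1r (@le_trans _ _ m%:R)// ?ler_nat//.
  by near: m; exact: nbhs_infty_ger.
have near_err := near_error (6 * C * (2 / r)).
have near_card := near_le_expR_speed lam_y (m.+1%:R * 2) ltr01.
near=> n.
have n0 : (0 < n)%N by near: n; exact: nbhs_infty_gt.
have n0R : 0 < n%:R :> R by rewrite ltr0n.
have qn : q / n%:R <= 1.
  by rewrite ler_pdivrMr// mul1r; near: n; exact: nbhs_infty_ger.
have err : sc n * Num.sqrt n.+1%:R * (6 * C * (2 / r)) <= 1 by near: n.
have card : m.+1%:R * 2 <= expR (lam n * 1) by near: n.
pose L := (Num.truncn (n%:R / m.+1%:R : R)).+1.
pose rho := lam n * (x * r / 2).
have kp := kap_gt0 n0; have b0 : 0 < x * kap n by rewrite mulr_gt0.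
have /choice[E HE] : forall j : 'I_m.+1, exists E : set Omega, [/\ measurable E,
    (P E <= (2 * expR (L%:R * (2 * (x * kap n) ^+ 2 * C ^+ 2) - rho))%:E)%E &
    forall w, ~ E w -> forall k, (k <= L)%N ->
      `|martingale a xi (h n) (1 + node m n j) k w| < rho / (x * kap n)].
  by move=> j; apply: maximal_martingale => //; exact: D_le.
exists (\big[setU/set0]_j E j `|` bad); split.
- by apply: measurableU => //; apply: bigsetU_measurable => j _; have [] := HE j.
- apply: le_trans (measureU2 _ _ mbad) _.
    by apply: bigsetU_measurable => j _; have [] := HE j.
  rewrite [X in (_ + X)%E](_ : _ = 0%E) ?adde0//; apply: le_trans (union_bound _ _) _.
  - by move=> j; have [+ _ _] := HE j; apply.
  - by move=> j; have [_ + _] := HE j; apply.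
  rewrite lee_fin card_ord mulrA.
  apply: le_trans (ler_wpM2r (expR_ge0 _) card) _.
  rewrite -expRD ler_expR /rho.
  have Lq : L%:R * (2 * (x * kap n) ^+ 2 * C ^+ 2) <= lam n * 2.
    have -> : L%:R * (2 * (x * kap n) ^+ 2 * C ^+ 2) = kap n ^+ 2 * (L%:R * q).
      by rewrite /q; ring.
    rewrite -(kap_sqr n0) -mulrA ler_wpM2l ?sqr_ge0//.
    apply: (@le_trans _ _ ((n%:R / m.+1%:R + 1) * q)).
      rewrite ler_wpM2r// /L -natr1 lerD2r.
      by have /andP[] := truncn_itv (divr_ge0 (ler0n R n) (ler0n R m.+1)).
    rewrite mulrDl mul1r mulrAC -mulrA mulr_natr [_ *+ 2]mulr2n lerD//.
      by rewrite ler_piMr.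
    by move: qn; rewrite ler_pdivrMr// mul1r.
  have xr : x * r / 2 = `|K0| + 3 by rewrite /x; field; rewrite gt_eqF.
  rewrite xr; have l0 := lam_gt0 n.
  have : lam n * K0 <= lam n * `|K0| by rewrite ler_wpM2l ?ler_norm// ltW.
  exact: aux Lq.
move=> w /not_orP[nE nb] j t jm /andP[t0 t1].
have nEj : ~ E (Ordinal jm) w by move=> Ew; apply: nE; rewrite (bigD1 (Ordinal jm))//=; left.
have jm0 : 0 <= j%:R / m.+1%:R :> R by rewrite divr_ge0.
have jm1 : j.+1%:R / m.+1%:R <= 1 :> R by rewrite ler_pdivrMr// mul1r ler_nat.
rewrite !ZE; last 2 first.
- by rewrite jm0 ler_pdivrMr// mul1r ler_nat ltnW.
- by rewrite (le_trans jm0 t0) (le_trans t1 jm1).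
rewrite -/(node m n j) -mulrBr; set e := Num.truncn _.
have je : (node m n j <= e)%N by apply: le_truncn; rewrite ler_wpM2l.
have en : (e <= n)%N.
  rewrite -(@natrK R n); apply: le_truncn; rewrite ler_piMr//.
  exact: le_trans t1 jm1.
have eL : (e - node m n j <= L)%N.
  rewrite leq_subLR /L addnS -addSn truncn_le_nat.
  have y0 : 0 <= n%:R / m.+1%:R :> R by rewrite divr_ge0.
  have /andP[_ h1] := truncn_itv y0.
  have /andP[_ h2] := truncn_itv (mulr_ge0 (ler0n R n) jm0).
  rewrite -/(node m n j) in h2.
  apply: (@le_lt_trans _ _ (n%:R * (j.+1%:R / m.+1%:R))); first by rewrite ler_wpM2l.
  have -> : n%:R * (j.+1%:R / m.+1%:R) = n%:R * (j%:R / m.+1%:R) + n%:R / m.+1%:R :> R.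
    by rewrite -natr1; field.
  apply: lt_le_trans (ltrD h2 h1) _.
  by rewrite -natrD ler_nat addnS.
have := @deviationD w n (node m n j) (e - node m n j)%N nb; rewrite subnKC// => /(_ en).
set M := martingale _ _ _ _ _ _ => dev.
have [_ _ /(_ w nEj _ eL)] := HE (Ordinal jm); rewrite /= -/M => MM.
have sc0 : 0 < sc n by rewrite mulr_gt0 ?invr_gt0 ?sqrtr_gt0.
rewrite normrM (gtr0_norm sc0).
have scM : sc n * (rho / (x * kap n)) = r / 2.
  rewrite /rho /kap; field.
  by rewrite !gt_eqF.
have : `|T e w - T (node m n j) w| <= 6 * C * Num.sqrt n.+1%:R + rho / (x * kap n).
  rewrite -(subrK M (T e w - _)) (le_trans (ler_normD _ _))// lerD//.
  exact: ltW.
move=> /(ler_wpM2l (ltW sc0)) /le_trans; apply.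
rewrite mulrDr scM.
have r2 : 0 <= r / 2 by rewrite divr_ge0// ltW.
have := ler_wpM2r r2 err; rewrite mul1r.
have -> : sc n * Num.sqrt n.+1%:R * (6 * C * (2 / r)) * (r / 2) =
    sc n * (6 * C * Num.sqrt n.+1%:R) by field; rewrite gt_eqF.
by move=> h1; rewrite [r in leRHS]splitr lerD2r.
Unshelve. all: by end_near. Qed.

Lemma chain_MDP : 0 < sigma -> MDP P (partial_sum_process f xi) a_ (rate sigma).
Proof.
move=> sigma0; apply: MDP_of_estimates => //.
- by move=> n G; exact: measurable_partial_sum_process.
- move=> n w /=; rewrite /step_fun; case: ifP => // _.
  by rewrite mulr0 truncn0 big_geq// mulr0.
- move=> n t; have [t01|t01] := boolP (t \in `[0, 1]).
    under eq_fun do rewrite ZE//.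
    by apply: measurable_funM => //; exact: mT.
  rewrite (_ : (fun w => _) = cst 0); first exact: measurable_cst.
  by apply/funext => w; rewrite /= step_out// mulr0.
- exact: chain_laplace_asymptotics.
- exact: chain_small_oscillations.
Qed.

End chain_mdp.

(** * Small divisors *)

Section diophantine.
Variable R : realType.

Lemma powR2X n (y : R) : (2 ^+ n) `^ y = (2 `^ y) ^+ n.
Proof.
rewrite -(powR_mulrn n (powR_ge0 2 y)) -(powR_mulrn n (ler0n R 2)).
by rewrite -[LHS]powRrM -[RHS]powRrM mulrC.
Qed.

Lemma powR_lt1 (y : R) : y < 0 -> 2 `^ y < 1 :> R.
Proof. 
move=> y0; rewrite /powR gt_eqF//= -[ltRHS]expR0 ltr_expR nmulr_rlt0// ln_gt0//.
by rewrite ltr1n. Qed.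

(** On the dyadic block [2^n, 2^(n+1)[ the weight is at most 2^(-n s) and the sum
of the x k at most B 2^((n+1) g), which gives a geometric series. *)
Lemma dyadic_sum_le (x : nat -> R) (B g s : R) : 0 <= B -> 0 <= s -> (forall k, 0 <= x k) -> g < s ->
  (forall n, \sum_(1 <= k < 2 ^ n) x k <= B * (2 ^+ n) `^ g) ->
  exists2 B' : R, 0 <= B' & forall n, \sum_(1 <= k < n) k%:R `^ (- s) * x k <= B'.
Proof.
move=> B0 s0 x0 gs Hx; pose r : R := 2 `^ (g - s).
have r0 : 0 < r by exact: powR_gt0.
have r1 : r < 1 by apply: powR_lt1; rewrite subr_lt0.
pose A : R := B * 2 `^ g.
have A0 : 0 <= A by rewrite mulr_ge0 ?powR_ge0.
have A1 : 0 <= A / (1 - r) by rewrite divr_ge0// subr_ge0 ltW.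
have two n : \sum_(1 <= k < 2 ^ n) k%:R `^ (- s) * x k <= series (geometric A r) n.
  elim: n => [|n IH]; first by rewrite big_geq// /series/= big_geq.
  have p1 : (1 <= 2 ^ n)%N by rewrite expn_gt0.
  have p2 : (2 ^ n <= 2 ^ n.+1)%N by rewrite leq_exp2l.
  rewrite (big_cat_nat p1 p2)/= /series/= big_nat_recr//= lerD//.
  apply: (@le_trans _ _ (\sum_(2 ^ n <= k < 2 ^ n.+1) (2 ^+ n) `^ (- s) * x k)).
    rewrite big_nat [leRHS]big_nat; apply: ler_sum => k /andP[k1 k2].
    rewrite ler_wpM2r// !powRN lef_pV2 ?posrE ?powR_gt0 ?exprn_gt0 ?ltr0n//; last first.
      exact: leq_trans p1 k1.
    by apply: ge0_ler_powR; rewrite ?nnegrE ?exprn_ge0// -natrX ler_nat.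
  rewrite -mulr_sumr; have h : \sum_(2 ^ n <= k < 2 ^ n.+1) x k <= B * (2 ^+ n.+1) `^ g.
    apply: le_trans (Hx n.+1); rewrite (big_cat_nat p1 p2)/= lerDr.
    exact: sumr_ge0.
  apply: le_trans (ler_wpM2l (powR_ge0 _ _) h) _.
  rewrite !powR2X exprS /A /r (_ : g - s = - s + g); last by rewrite addrC.
  rewrite powRD; last by rewrite pnatr_eq0 implybT.
  by rewrite exprMn le_eqVlt; apply/orP; left; apply/eqP; ring.
exists (A / (1 - r)) => // n.
have n2 : (n <= 2 ^ n)%N by apply: ltnW; exact: ltn_expl.
apply: le_trans (le_trans (two n) (geometric_le_lim _ _ _ _)) => //; last first.
  by rewrite gtr0_norm.
case: n n2 => [|n] n2; first by rewrite big_geq// big_geq.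
rewrite [leRHS](big_cat_nat _ n2)//= lerDl; apply: sumr_ge0 => k _.
by rewrite mulr_ge0 ?powR_ge0.
Qed.

Lemma sum_powR_le (s : R) : 1 < s ->
  exists2 B : R, 0 <= B & forall n, \sum_(1 <= k < n) k%:R `^ (- s) <= B.
Proof.
move=> s1; have s0 : 0 <= s by rewrite (le_trans ler01)// ltW.
have [|B B0 HB] := @dyadic_sum_le (fun=> 1) 1 1 s ler01 s0 (fun=> ler01) s1.
  move=> n; rewrite sumr_const_nat mul1r powRr1 ?exprn_ge0// -natrX ler_nat.
  exact: leq_subr.
by exists B => // n; have := HB n; under eq_bigr do rewrite mulr1.
Qed.

Lemma sum_injective_le (F : nat -> R) (m : nat -> nat) (N M : nat) : (forall k, 0 <= F k) ->
  (forall k, (1 <= k < N)%N -> (1 <= m k < M)%N) ->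
  (forall j k, (1 <= j < k)%N -> (k < N)%N -> m j != m k) ->
  \sum_(1 <= k < N) F (m k) <= \sum_(1 <= k < M) F k.
Proof.
move=> F0 mM minj; pose s := [seq m k | k <- index_iota 1 N].
have us : uniq s.
  rewrite map_inj_in_uniq ?iota_uniq// => i j; rewrite !mem_index_iota => /andP[i1 iN] /andP[j1 jN] mij.
  case: (ltngtP i j) => // ij.
    by have := minj i j; rewrite i1 ij jN mij eqxx => /(_ isT isT).
  by have := minj j i; rewrite j1 ij iN mij eqxx => /(_ isT isT).
rewrite -(big_map m xpredT F) -/s [leRHS](bigID (mem s))/=.
have -> : \sum_(1 <= i < M | i \in s) F i = \sum_(i <- s) F i.
  rewrite -big_filter; apply: perm_big; apply: uniq_perm => //.
    by rewrite filter_uniq// iota_uniq.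
  move=> i; rewrite mem_filter mem_index_iota; apply/andb_idr => /mapP[k].
  by rewrite mem_index_iota => kN ->; exact: mM.
by rewrite lerDl sumr_ge0.
Qed.

(** The points y k, 1 <= k < N, are separated by delta = c N^(-1-e): they lie in
different cells of length delta, none of them in the first one. The sum of their
inverses is compared with the one over all the cells; the power 1 + e of the
inverses, possible as y <= 1, makes the latter converge. *)
Lemma separated_sum_le (y : nat -> R) (c e : R) : 0 < c <= 1 -> 0 < e ->
  (forall k, (0 < k)%N -> c * k%:R `^ (- (1 + e)) <= y k <= 1) ->
  (forall j k, (0 < j < k)%N -> c * (k - j)%:R `^ (- (1 + e)) <= `|y k - y j|) ->
  exists2 B : R, 0 <= B &
    forall N, \sum_(1 <= k < N) (y k)^-1 <= B * N%:R `^ ((1 + e) * (1 + e)).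
Proof.
move=> /andP[c0 c1] e0 yc ysep; have [|Z Z0 HZ] := @sum_powR_le (1 + e); first by rewrite ltrDl.
exists (c `^ (- (1 + e)) * Z); first by rewrite mulr_ge0// powR_ge0.
move=> N; case: N => [|N]; first by rewrite big_geq// !mulr_ge0 ?powR_ge0.
pose N' := N.+1; have N0 : 0 < N'%:R :> R by rewrite ltr0n.
have [delta deltaE] : exists delta, delta = c * N'%:R `^ (- (1 + e)) by eexists.
have d0 : 0 < delta by rewrite deltaE mulr_gt0// powR_gt0.
have e1 : 0 <= 1 + e by rewrite addr_ge0// ltW.
have dk k : (0 < k < N')%N -> delta <= c * k%:R `^ (- (1 + e)).
  move=> /andP[k0 kN]; rewrite deltaE ler_pM2l// !powRN lef_pV2 ?posrE ?powR_gt0 ?ltr0n//.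
  by apply: ge0_ler_powR; rewrite ?nnegrE// ler_nat ltnW.
have yk k : (0 < k < N')%N -> delta <= y k <= 1.
  by move=> kN; have /andP[k0 _] := kN; have /andP[h1 ->] := yc k k0; rewrite (le_trans (dk k kN) h1).
pose m k := Num.truncn (y k / delta).
have mP k : (0 < k < N')%N -> (m k)%:R * delta <= y k < (m k).+1%:R * delta.
  move=> kN; have /andP[h1 h2] := yk k kN.
  have := truncn_itv (divr_ge0 (le_trans (ltW d0) h1) (ltW d0)).
  by rewrite -/(m k) ler_pdivlMr// ltr_pdivrMr.
have m1 k : (0 < k < N')%N -> (1 <= m k)%N.
  move=> kN; have /andP[h1 h2] := yk k kN; rewrite truncn_ge_nat; last first.
    by rewrite divr_ge0// ?(le_trans (ltW d0))// ltW.
  by rewrite ler_pdivlMr// mul1r.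
pose M := (Num.truncn delta^-1).+1.
apply: (@le_trans _ _ (\sum_(1 <= k < N') delta `^ (- (1 + e)) * (m k)%:R `^ (- (1 + e)))).
  rewrite big_nat [leRHS]big_nat; apply: ler_sum => k kN.
  have /andP[h1 h2] := yk k kN; have /andP[h3 _] := mP k kN; have h4 := m1 k kN.
  have m0 : 0 < (m k)%:R :> R by rewrite ltr0n.
  apply: (@le_trans _ _ ((m k)%:R * delta)^-1).
    have y0 : 0 < y k by exact: lt_le_trans d0 h1.
    rewrite lef_pV2 ?posrE//; exact: mulr_gt0.
  rewrite -powRM ?(ltW d0)// mulrC powRN lef_pV2 ?posrE ?powR_gt0 ?mulr_gt0//.
  set z := _ * delta in h3 *; have z0 : 0 < z by rewrite mulr_gt0.
  rewrite [delta * _]mulrC -/z powRD ?(gt_eqF z0) ?implybT// powRr1 ?(ltW z0)//.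
  rewrite ger_pMr// (_ : 1 = 1 `^ e); last by rewrite powR1.
  apply: ge0_ler_powR; rewrite ?nnegrE ?(ltW z0) ?(ltW e0)//.
  exact: le_trans h3 h2.
rewrite -mulr_sumr.
apply: (@le_trans _ _ (delta `^ (- (1 + e)) * Z)).
  rewrite ler_wpM2l ?powR_ge0//; apply: le_trans (HZ M).
  apply: (@sum_injective_le (fun k => k%:R `^ (- (1 + e))) m N' M).
  - by move=> k; exact: powR_ge0.
  - move=> k kN; rewrite m1// ltnS; apply: le_truncn.
    by have /andP[h1 h2] := yk k kN; rewrite ler_pdivrMr// mulVf ?gt_eqF.
  move=> j k /andP[j0 jk] kN; apply/eqP => mjk.
  have jN : (0 < j < N')%N by rewrite j0 (ltn_trans jk).
  have kN' : (0 < k < N')%N by rewrite kN (leq_trans _ jk).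
  have := ysep j k; rewrite j0 jk => /(_ isT); apply/negP; rewrite -ltNge.
  apply: lt_le_trans (dk (k - j)%N _); last first.
    by rewrite subn_gt0 jk (leq_ltn_trans (leq_subr _ _)).
  have /andP[a1 a2] := mP j jN; have /andP[b1 b2] := mP k kN'.
  by move: a1 a2 b1 b2; rewrite mjk -natr1 mulrDl mul1r ltr_norml => *; apply/andP; split; lra.
rewrite mulrC [leRHS]mulrAC [leRHS]mulrC ler_wpM2l// deltaE powRM ?powR_ge0// ?(ltW c0)//.
by rewrite -powRrM mulrNN.
Qed.

Definition frac (x : R) : R := x - (Num.floor x)%:~R.

Lemma frac_itv x : 0 <= frac x < 1.
Proof.
rewrite /frac; have /andP[h1 h2] := floor_itv x.
by rewrite subr_ge0 h1/= ltrBlDl; move: h2; rewrite intrD addrC.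
Qed.

(** The graph of the sine lies above its chord on [0, pi/2]: the slopes of the
two halves of the graph cut at pi t are separated by cos (pi t). *)
Lemma jordan_sin t : 0 < t -> t <= 1 / 2 -> 2 * t <= sin (pi * t) :> R.
Proof.
move=> t0 th; have p0 := pi_gt0 R; set y := pi * t.
have y0 : 0 < y by rewrite mulr_gt0.
have yh : y <= pi / 2 by rewrite /y ler_pM2l// -[2^-1]div1r.
have tE : t = y / pi by rewrite /y mulrAC divff ?mul1r// gt_eqF.
have [yE|yne] := eqVneq y (pi / 2).
  by rewrite yE sin_pihalf tE yE; rewrite mulrAC divff ?gt_eqF// mul1r mulfV.
have ylt : y < pi / 2 by rewrite lt_neqAle yne.
have cosm u v : 0 <= u -> u <= v -> v <= pi / 2 -> cos v <= cos u :> R.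
  move=> u0 uv vp; rewrite leNgt ltr_cos -?leNgt// in_itv/=.
    by rewrite (le_trans u0 uv) (le_trans vp)// ler_pdivrMr// ler_peMr ?ler1n// ltW.
  by rewrite u0 (le_trans uv)// (le_trans vp)// ler_pdivrMr// ler_peMr ?ler1n// ltW.
have [u] := @MVT R sin cos 0 y y0 (fun x _ => is_derive_sin x)
  (continuous_subspaceT (@continuous_sin R)).
rewrite in_itv/= sin0 !subr0 => /andP[u0 uy] E1.
have [v] := @MVT R sin cos y (pi / 2) ylt (fun x _ => is_derive_sin x)
  (continuous_subspaceT (@continuous_sin R)).
rewrite in_itv/= sin_pihalf => /andP[yv vp] E2.
have c1 : cos y <= cos u by rewrite cosm// ltW.
have c2 : cos v <= cos y by rewrite cosm// ltW.
have l1 : cos y * y <= sin y by rewrite E1 ler_pM2r.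
have l2 : 1 - sin y <= cos y * (pi / 2 - y) by rewrite E2 ler_pM2r// subr_gt0.
rewrite tE mulrA ler_pdivrMr//.
suff : y * (1 - sin y) <= sin y * (pi / 2 - y) by lra.
apply: (@le_trans _ _ (y * (cos y * (pi / 2 - y)))); first by rewrite ler_pM2l.
by rewrite mulrCA mulrA ler_wpM2r// ?subr_ge0 ?(ltW ylt)//.
Qed.

(** Comparison of |sin (pi x)| with the distance of x to the integers, in a form
whose inverse splits as a sum. *)
Lemma sin_frac_ge x : frac x * (1 - frac x) / 2 <= `|sin (pi * x)|.
Proof.
have sinM (z : int) y : `|sin (pi * (y + z%:~R))| = `|sin (pi * y)| :> R.
  have nat (n : nat) t : `|sin (t + pi * n%:R)| = `|sin t| :> R.
    elim: n t => [|n IH] t; first by rewrite mulr0 addr0.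
    by rewrite -natr1 mulrDr mulr1 addrA sinDpi normrN IH.
  rewrite mulrDr; case: z => n; first exact: nat.
  rewrite NegzE intrN mulrN -(nat n.+1 (pi * y - _)); congr `|sin _|.
  by rewrite -addrA addNr addr0.
have -> : `|sin (pi * x)| = `|sin (pi * frac x)|.
  by rewrite -(sinM (Num.floor x) (frac x)) /frac subrK.
have /andP[] := frac_itv x; move: (frac x) => t t0 t1.
wlog th : t t0 t1 / t <= 1 / 2.
  move=> H; have [/H|th] := leP t (1 / 2); first by apply.
  have e : `|sin (pi * (1 - t))| = `|sin (pi * t)|.
    by rewrite (mulrBr pi) mulr1 sinB sinpi cospi mul0r mulN1r sub0r opprK.
  have := H (1 - t); rewrite e subKr [(1 - t) * t]mulrC; apply.
  - by rewrite subr_ge0 ltW.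
  - by rewrite ltrBlDr ltrDl (lt_trans _ th).
  - by lra.
have [t0'|tp] := leP t 0.
  by rewrite (_ : t = 0) ?mul0r//; apply/eqP; rewrite eq_le t0' t0.
have h : 2 * t <= sin (pi * t) by exact: jordan_sin.
apply: le_trans (ler_norm _); apply: le_trans h.
have : 0 <= t * t by rewrite mulr_ge0.
lra.
Qed.

(** Finitely many exceptions cost only a constant, since no k a is an integer. *)
Lemma badly_approximable_ge (a e : R) : irrational a -> badly_approximable a -> 0 < e ->
  exists2 c : R, 0 < c <= 1 & forall (k : nat) (z : int), (0 < k)%N ->
    c * k%:R `^ (- (1 + e)) <= `|k%:R * a - z%:~R|.
Proof.
move=> irr bad e0; have /finite_seqP[s Hs] := bad e e0.
have dl x (z : int) : dist_int x <= `|x - z%:~R| :> R.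
  apply: ge_inf; first by exists 0 => _ [z' _ <-].
  by exists z.
have [c c01 Hc] : exists2 c : R, 0 < c <= 1 & forall (k : nat) (z : int), (0 < k)%N ->
    k%:Z \in s -> c <= `|k%:R * a - z%:~R|.
  elim: s {Hs} => [|j s [c /andP[c0 c1] IH]]; first by exists 1 => //; rewrite ltr01 lexx.
  pose f := frac (j%:~R * a).
  have /andP[f0 f1] := frac_itv (j%:~R * a).
  have [j0|j0] := eqVneq f 0.
    exists c => [|k z k0]; first by rewrite c0 c1.
    rewrite inE => /orP[/eqP kj|]; last exact: IH.
    exfalso; apply: irr; exists ((Num.floor (j%:~R * a))%:~R / k%:R) => //.
    have kR : k%:R != 0 :> R by rewrite pnatr_eq0 -lt0n.
    rewrite fmorph_div/= ratr_int ratr_nat; apply: (mulIf kR).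
    rewrite divfK//; move/eqP: j0; rewrite /f /frac subr_eq0 => /eqP <-.
    by rewrite -kj mulrC.
  exists (Num.min c (Num.min f (1 - f))).
    by rewrite !lt_min c0 lt_neqAle eq_sym j0 f0 subr_gt0 f1/= ge_min c1.
  move=> k z k0; rewrite inE => /orP[/eqP kj|ks]; last by rewrite ge_min IH.
  rewrite !ge_min; apply/orP; right.
  have -> : k%:R * a = f + (Num.floor (j%:~R * a))%:~R by rewrite /f /frac subrK -kj.
  rewrite -addrA -intrB; set i : int := _ - z.
  have [i0|i0] := leP 0 i.
    by apply/orP; left; rewrite ger0_norm; [rewrite lerDl ler0z|rewrite addr_ge0// ler0z].
  have i1 : i%:~R <= -1 :> R by rewrite -[-1]/((-1)%:~R) ler_int; move: i0; clear; lia.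
  apply/orP; right; rewrite -normrN; apply: le_trans (ler_norm _).
  apply: (@le_trans _ _ (- i%:~R - f)); first by rewrite lerD2r lerNr.
  by rewrite -opprD addrC.
have /andP[c0 c1] := c01.
exists c => // k z k0; have [ks|ks] := boolP (k%:Z \in s).
  apply: le_trans (Hc k z k0 ks); rewrite ler_piMr ?(ltW c0)//.
  rewrite powRN invf_le1 ?powR_gt0 ?ltr0n//.
  apply: (@le_trans _ _ (1 `^ (1 + e))); first by rewrite powR1.
  by apply: ge0_ler_powR; rewrite ?nnegrE ?addr_ge0 ?(ltW e0)// ler1n.
apply: le_trans (dl _ z); apply: (@le_trans _ _ (k%:R `^ (- (1 + e)))).
  by rewrite ler_piMl ?powR_ge0.
rewrite leNgt; apply/negP => lt; move/negP: ks; apply.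
suff : [set` s] k%:Z by [].
rewrite -Hs/=; rewrite opprD in lt.
by rewrite normr_nat.
Qed.

(** The small divisors sin (pi k a) are summable against k^(-1-eps): the
fractional parts of k a, 1 <= k < N, are separated by c N^(-1-e) for each e > 0. *)
Lemma small_divisors (a eps : R) : irrational a -> badly_approximable a -> 0 < eps ->
  exists2 B : R, 0 <= B &
    forall n, \sum_(1 <= k < n) k%:R `^ (- (1 + eps)) / `|sin (pi * (k%:R * a))| <= B.
Proof.
move=> irr bad eps0; pose e := Num.min 1 (eps / 4).
have e0 : 0 < e by rewrite lt_min ltr01 divr_gt0.
have ee : (1 + e) * (1 + e) < 1 + eps.
  have e1 : e <= 1 by rewrite ge_min lexx.
  have e2 : e <= eps / 4 by rewrite ge_min lexx orbT.
  have : e * e <= e by rewrite ler_piMl// ltW.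
  by lra.
have [c c01 Hc] := badly_approximable_ge irr bad e0.
pose y1 (k : nat) := frac (k%:R * a); pose y2 k := 1 - y1 k.
have yk k : (0 < k)%N -> c * k%:R `^ (- (1 + e)) <= y1 k <= 1 /\
    c * k%:R `^ (- (1 + e)) <= y2 k <= 1.
  move=> k0; have /andP[f0 f1] := frac_itv (k%:R * a).
  split; apply/andP; split.
  - by have := Hc k (Num.floor (k%:R * a)) k0; rewrite ger0_norm.
  - exact: ltW.
  - have y20 : 0 <= y2 k by rewrite subr_ge0 ltW.
    have E : y2 k = - (k%:R * a - (Num.floor (k%:R * a) + 1)%:~R).
      by rewrite intrD /y2 /y1 /frac; ring.
    by have := Hc k (Num.floor (k%:R * a) + 1) k0; rewrite -normrN -E ger0_norm.
  - by rewrite lerBlDl lerDr.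
have sep j k : (0 < j < k)%N -> c * (k - j)%:R `^ (- (1 + e)) <= `|y1 k - y1 j|.
  move=> /andP[j0 jk].
  have := Hc (k - j)%N (Num.floor (k%:R * a) - Num.floor (j%:R * a)).
  rewrite subn_gt0 jk => /(_ isT); rewrite natrB ?(ltnW jk)// intrB mulrBl.
  by rewrite /y1 /frac => /le_trans; apply; rewrite le_eqVlt; apply/orP; left; apply/eqP; congr `|_|; ring.
have [B1 B10 HB1] := separated_sum_le c01 e0 (fun k k0 => (yk k k0).1) sep.
have [|B2 B20 HB2] := @separated_sum_le y2 c e c01 e0 (fun k k0 => (yk k k0).2).
  by move=> j k jk; rewrite (_ : y2 k - y2 j = - (y1 k - y1 j)) ?normrN ?sep//; rewrite /y2; ring.
pose x (k : nat) : R := if k == 0%N then 0 else 2 * ((y1 k)^-1 + (y2 k)^-1).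
have yp k : (0 < k)%N -> 0 < y1 k /\ 0 < y2 k.
  move=> k0; have /andP[c0 _] := c01; have [/andP[h1 _] /andP[h2 _]] := yk k k0.
  have p : 0 < c * k%:R `^ (- (1 + e)) by rewrite mulr_gt0 ?powR_gt0 ?ltr0n.
  by split; exact: lt_le_trans p _.
have x0 k : 0 <= x k.
  rewrite /x; case: eqP => // /eqP; rewrite -lt0n => k0; have [p1 p2] := yp k k0.
  by rewrite mulr_ge0// addr_ge0// invr_ge0 ltW.
have [||n|B B0 HB] := @dyadic_sum_le x (2 * (B1 + B2)) ((1 + e) * (1 + e)) (1 + eps) _ _ x0 ee.
- by rewrite mulr_ge0// addr_ge0.
- by rewrite addr_ge0// ltW.
- rewrite -natrX -[leRHS]mulrA [X in _ <= 2 * X]mulrDl; apply: le_trans (ler_wpM2l _ (lerD (HB1 _) (HB2 _))) => //.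
  rewrite -big_split/= mulr_sumr le_eqVlt; apply/orP; left; apply/eqP.
  by rewrite big_nat [RHS]big_nat; apply: eq_bigr => k /andP[k0 _]; rewrite /x gtn_eqF.
exists B => // n; apply: le_trans (HB n).
rewrite big_nat [leRHS]big_nat; apply: ler_sum => k /andP[k0 _].
rewrite ler_wpM2l ?powR_ge0// /x gtn_eqF//; have [p1 p2] := yp k k0.
have := sin_frac_ge (k%:R * a); rewrite -/(y1 k) -/(y2 k).
have -> : 2 * ((y1 k)^-1 + (y2 k)^-1) = (y1 k * y2 k / 2)^-1.
  have E : y2 k = 1 - y1 k by [].
  have n1 : y1 k != 0 by rewrite gt_eqF.
  have n2 : 1 - y1 k != 0 by rewrite -E gt_eqF.
  by rewrite E; field; rewrite n1 n2.
have p3 : 0 < y1 k * y2 k / 2 by rewrite divr_gt0// mulr_gt0.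
by move=> h; rewrite lef_pV2 ?posrE// (lt_le_trans p3).
Qed.

End diophantine.

(** * Uniqueness of Fourier coefficients on the torus *)

Section trigonometric_atoms.
Variable R : realType.
Implicit Types (k j : int) (x : torus R).

Lemma cosDint (z : int) (y : R) : cos (y + 2 * pi * z%:~R) = cos y.
Proof.
have per t : cos (t + 2 * pi) = cos t :> R.
  by rewrite mulr_natl mulr2n addrA !cosDpi opprK.
have nat (n : nat) t : cos (t + 2 * pi * n%:R) = cos t :> R.
  elim: n t => [|n IH] t; first by rewrite mulr0 addr0.
  by rewrite -[n.+1%:R]natr1 mulrDr mulr1 addrA per IH.
case: z => n; first exact: nat.
by rewrite NegzE intrN mulrN -(nat n.+1 (y - _)) subrK.
Qed.

Lemma sinDint (z : int) (y : R) : sin (y + 2 * pi * z%:~R) = sin y.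
Proof. by rewrite -[LHS]cosBpihalf addrAC cosDint cosBpihalf. Qed.

(** These are the functions whose integrals against f are the Fourier coefficients;
they are well defined on the torus since k is an integer. *)
Definition cosk k x : R := cos (2 * pi * k%:~R * repr x).
Definition sink k x : R := sin (2 * pi * k%:~R * repr x).

Let repr_shift k (y : R) : exists z : int,
  2 * pi * k%:~R * repr (torus_pi y) = 2 * pi * k%:~R * y + 2 * pi * z%:~R.
Proof.
have /intrP[m Hm] := torus_reprP y; exists (k * m); rewrite intrM -[m%:~R]Hm.
by ring.
Qed.

Lemma cosk_pi k y : cosk k (torus_pi y) = cos (2 * pi * k%:~R * y).
Proof. by rewrite /cosk; have [z ->] := repr_shift k y; rewrite cosDint. Qed.

Lemma sink_pi k y : sink k (torus_pi y) = sin (2 * pi * k%:~R * y).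
Proof. by rewrite /sink; have [z ->] := repr_shift k y; rewrite sinDint. Qed.

Lemma cosk_rot k b x : cosk k (Defs.rot b x) =
  cosk k x * cos (2 * pi * k%:~R * b) - sink k x * sin (2 * pi * k%:~R * b).
Proof. by rewrite /Defs.rot cosk_pi mulrDr cosD. Qed.

Lemma sink_rot k b x : sink k (Defs.rot b x) =
  sink k x * cos (2 * pi * k%:~R * b) + cosk k x * sin (2 * pi * k%:~R * b).
Proof. by rewrite /Defs.rot sink_pi mulrDr sinD. Qed.

Lemma bounded_measurable_cosk k : bounded_measurable (cosk k).
Proof.
split; last by exists 1 => x; exact: cos_max.
apply: continuous_measurable_torus; apply: continuous_torus.
rewrite (_ : _ \o _ = cos \o (fun y => 2 * pi * k%:~R * y)); last first.
  by apply/funext => y; rewrite /= cosk_pi.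
move=> y; apply: continuous_comp; last exact: continuous_cos.
by apply: cvgM; [exact: cvg_cst|exact: cvg_id].
Qed.

Lemma bounded_measurable_sink k : bounded_measurable (sink k).
Proof.
split; last by exists 1 => x; exact: sin_max.
apply: continuous_measurable_torus; apply: continuous_torus.
rewrite (_ : _ \o _ = sin \o (fun y => 2 * pi * k%:~R * y)); last first.
  by apply/funext => y; rewrite /= sink_pi.
move=> y; apply: continuous_comp; last exact: continuous_sin.
by apply: cvgM; [exact: cvg_cst|exact: cvg_id].
Qed.

Lemma cosk0 x : cosk 0 x = 1.
Proof. by rewrite /cosk mulr0 mul0r cos0. Qed.

Lemma sink0 x : sink 0 x = 0.
Proof. by rewrite /sink mulr0 mul0r sin0. Qed.

Let split_index k j (t : R) : 2 * pi * (k + j)%:~R * t = 2 * pi * k%:~R * t + 2 * pi * j%:~R * t /\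
  2 * pi * (k - j)%:~R * t = 2 * pi * k%:~R * t - 2 * pi * j%:~R * t.
Proof. by rewrite intrD intrB; split; ring. Qed.

Lemma cosk_cosk k j x : cosk k x * cosk j x = (cosk (k + j) x + cosk (k - j) x) / 2.
Proof.
rewrite /cosk; have [-> ->] := split_index k j (repr x).
by rewrite cosB cosD; field.
Qed.

Lemma sink_sink k j x : sink k x * sink j x = (cosk (k - j) x - cosk (k + j) x) / 2.
Proof.
rewrite /cosk /sink; have [-> ->] := split_index k j (repr x).
by rewrite cosB cosD; field.
Qed.

Lemma sink_cosk k j x : sink k x * cosk j x = (sink (k + j) x + sink (k - j) x) / 2.
Proof.
rewrite /cosk /sink; have [-> ->] := split_index k j (repr x).
by rewrite sinB sinD; field.
Qed.

Lemma cosk_sink k j x : cosk k x * sink j x = (sink (k + j) x - sink (k - j) x) / 2.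
Proof.
rewrite /cosk /sink; have [-> ->] := split_index k j (repr x).
by rewrite sinB sinD; field.
Qed.

Lemma one_sub_cos2 (t : R) : 1 - cos (2 * t) = 2 * sin t ^+ 2.
Proof.
rewrite mulr_natl mulr2n cosD; have := cos2Dsin2 t; rewrite !expr2; lra.
Qed.

(** A zero of the sine at pi k a would make k a an integer. *)
Lemma sin_irrational (a : R) k : irrational a -> k != 0 -> sin (pi * (k%:~R * a)) != 0.
Proof.
move=> irr k0; apply/eqP => s0; have := sin_frac_ge (k%:~R * a); rewrite s0 normr0.
have /andP[f0 f1] := frac_itv (k%:~R * a).
have [fE|fn] := eqVneq (frac (k%:~R * a)) 0.
  move=> _; apply: irr; exists ((Num.floor (k%:~R * a))%:~R / k%:~R) => //.
  have kR : k%:~R != 0 :> R by rewrite intr_eq0.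
  rewrite fmorph_div/= !ratr_int; apply: (mulIf kR); rewrite divfK//.
  by move/eqP: fE; rewrite /frac subr_eq0 => /eqP <-; rewrite mulrC.
apply/negP; rewrite -ltNge divr_gt0// mulr_gt0//; last by rewrite subr_gt0.
by rewrite lt_neqAle eq_sym fn.
Qed.

End trigonometric_atoms.

Section arcs.
Variable R : realType.
Implicit Types (u v w x z : R).

(** On [0, 1/2] the function z |-> cos (2 pi z) decreases, and it is symmetric with
respect to 1/2. *)
Lemma cos_arc w z : 0 < w -> w <= 1 / 4 -> 0 <= z -> z <= 1 - w -> z != w -> z != 1 - w ->
  cos (2 * pi * z) != cos (2 * pi * w) /\
  (cos (2 * pi * z) < cos (2 * pi * w)) = ~~ (z < w).
Proof.
move=> w0 w4 z0 zu zw zw1; have p0 := pi_gt0 R.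
have itv (t : R) : 0 <= t -> t <= 1 / 2 -> 2 * pi * t \in `[0, pi].
  move=> t0 t2; have t1 : 2 * t <= 1 by lra.
  rewrite in_itv/= mulr_ge0 ?mulr_ge0 ?(ltW p0)//= (_ : 2 * pi * t = 2 * t * pi); last by ring.
  by rewrite ger_pMl.
have mono (s t : R) : 0 <= s -> s <= 1 / 2 -> 0 <= t -> t <= 1 / 2 ->
    (cos (2 * pi * s) < cos (2 * pi * t)) = (t < s).
  by move=> s0 s1 t0 t1; rewrite ltr_cos ?itv// ltr_pM2l// mulr_gt0.
have w2 : w <= 1 / 2 by lra.
rewrite -leNgt [w <= z]le_eqVlt [w == z]eq_sym (negbTE zw)/=.
have [z2|z2] := leP z (1 / 2).
  rewrite mono ?(ltW w0)//; split => //; apply/eqP => E.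
  have h1 := mono w z (ltW w0) w2 z0 z2; have h2 := mono z w z0 z2 (ltW w0) w2.
  rewrite E ltxx in h1 h2.
  by move/eqP: zw; apply; apply/eqP; rewrite eq_le !leNgt -h1 -h2.
have -> : cos (2 * pi * z) = cos (2 * pi * (1 - z)).
  rewrite -(cosN (2 * pi * z)) -(cosDint 1 (- (2 * pi * z))); congr cos.
  by rewrite mulr1z; ring.
have q0 : 0 <= 1 - z by lra.
have q2 : 1 - z <= 1 / 2 by lra.
have wz : w < 1 - z.
  rewrite lt_neqAle; apply/andP; split; last by lra.
  by apply/eqP => E; move/eqP: zw1; apply; rewrite E; ring.
have h : cos (2 * pi * (1 - z)) < cos (2 * pi * w) by rewrite mono ?(ltW w0).
split; first by rewrite lt_eqF.
by rewrite h; apply/esym; lra.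
Qed.

(** The cosine of 2 pi (x - y), where y is the middle of ]u, v[, compares to that
of pi (v - u) on [0, 1[ as x does to ]u, v[. *)
Lemma arc_cos u v x : 0 <= u -> u < v -> v <= 1 -> v - u <= 1 / 2 -> 0 <= x < 1 ->
  x != u -> x != v -> x != 0 ->
  cos (2 * pi * (x - (u + v) / 2)) != cos (pi * (v - u)) /\
  (cos (2 * pi * (x - (u + v) / 2)) < cos (pi * (v - u))) = ~~ ((u < x) && (x < v)).
Proof.
move=> u0 uv v1 vu /andP[x0 x1] xu xv xn0.
have [w wE] : exists w, w = (v - u) / 2 by eexists.
have [y yE] : exists y, y = (u + v) / 2 by eexists.
have uE : u = y - w by rewrite yE wE; field.
have vE : v = y + w by rewrite yE wE; field.
have -> : pi * (v - u) = 2 * pi * w by rewrite uE vE; ring.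
rewrite -yE {wE yE}; subst u v.
have cz : cos (2 * pi * (x - y)) = cos (2 * pi * `|x - y|).
  have [h|h] := ger0P (x - y); first by [].
  by rewrite mulrN cosN.
rewrite cz -ltr_distl; apply: cos_arc => //.
- by lra.
- by lra.
- by rewrite ler_norml; apply/andP; split; lra.
- apply/eqP; have [h|h] := ger0P (x - y) => E.
    by move/eqP: xv; apply; rewrite -E; ring.
  by move/eqP: xu; apply; rewrite -E; ring.
- apply/eqP; have [h|h] := ger0P (x - y) => E; first by lra.
  by move/eqP: xn0; apply; lra.
Qed.

End arcs.

Section haar_integral.
Variable R : realType.
Local Notation mu := (@lebesgue_measure R).
Local Notation mI := (measurable_itv `[0%R, 1%R[ : measurable (`[0%R, 1%R[%classic : set R)).
Local Open Scope ereal_scope.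

Let integral_mrestr (F : R -> \bar R) : measurable_fun setT F ->
  (forall x, 0 <= F x) ->
  \int[mrestr mu mI]_x F x = \int[mu]_(x in `[0%R, 1%R[) F x.
Proof.
move=> mF F0.
have mI' : measurable (`[0%R, 1%R[%classic : set R) := measurable_itv _.
rewrite -(setvU (`[0%R, 1%R[%classic : set R)) ge0_integral_setU//=; last 3 first.
- exact: measurableC.
- by rewrite setvU.
- by rewrite disj_set2E setICl.
rewrite [X in X + _ = _](_ : _ = 0) ?add0e.
  by apply: eq_measure_integral => A mA AI; rewrite /= /mrestr (setIidl AI).
apply: null_set_integral; [exact: measurableC|exact: measurable_funTS|].
by rewrite /= /mrestr setICl measure0.
Qed.

Lemma ge0_haar_integral (g : torus R -> \bar R) : measurable_fun setT g ->
  (forall x, 0 <= g x) ->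
  \int[@haar R]_x g x = \int[mu]_(x in `[0%R, 1%R[) g (torus_pi x).
Proof.
move=> mg g0; rewrite -integral_mrestr//; last exact: (measurableT_comp mg (@measurable_torus_pi R)).
rewrite -[in RHS](preimage_setT (@torus_pi R)).
rewrite -(@ge0_integral_pushforward _ _ (measurableTypeR R) (torus R) R (@torus_pi R)
  (@measurable_torus_pi R) (mrestr mu mI) setT g measurableT mg (fun y _ => g0 y)).
apply: eq_measure_integral => //; exact: measurable_torus_pi.
Qed.

(** The Haar measure is the image of the Lebesgue measure on [0, 1[. *)
Lemma haar_integral (g : torus R -> R) : (@haar R).-integrable setT (EFin \o g) ->
  mu.-integrable `[0%R, 1%R[ (EFin \o (g \o @torus_pi R)) /\
  (\int[@haar R]_x g x)%R = (\int[mu]_(x in `[0%R, 1%R[) g (torus_pi x))%R.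
Proof.
move=> ig; have /integrableP[mg fin] := ig.
have mgpi : measurable_fun setT ((EFin \o g) \o @torus_pi R).
  exact: (measurableT_comp mg (@measurable_torus_pi R)).
split.
  apply/integrableP; split; first exact: measurable_funTS mgpi.
  move: fin; rewrite ge0_haar_integral//.
  exact: measurableT_comp.
rewrite /Rintegral integralE [in RHS]integralE !ge0_haar_integral//.
- by congr (fine (_ - _)); apply: eq_integral => x _; rewrite ?funeposE ?funenegE.
- exact: measurable_funeneg.
- exact: measurable_funepos.
Qed.

End haar_integral.

Section fourier_uniqueness.
Variable R : realType.
Local Notation mu := (@lebesgue_measure R).
Variable g : torus R -> R.
Hypothesis ig : (@haar R).-integrable setT (EFin \o g).
Hypothesis gcos : forall k, \int[@haar R]_x (g x * cosk k x) = 0.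
Hypothesis gsin : forall k, \int[@haar R]_x (g x * sink k x) = 0.

Lemma integrable_bounded_measurable (t : torus R -> R) : bounded_measurable t ->
  (@haar R).-integrable setT (EFin \o (fun x => g x * t x)).
Proof.
move=> [mt [M tM]]; have := @integrableMl _ _ _ (@haar R) setT measurableT (EFin \o g) t ig mt.
apply; exists M; split; rewrite ?num_real// => N MN x _.
by apply: le_trans (tM x) _; exact: ltW.
Qed.

(** Stable under linear combinations and under multiplication by cos and sin, by
the product formulas, these test functions include all the trigonometric
polynomials. *)
Let Z (t : torus R -> R) := bounded_measurable t /\ forall k,
  \int[@haar R]_x (g x * (t x * cosk k x)) = 0 /\ \int[@haar R]_x (g x * (t x * sink k x)) = 0.

Let intD (t1 t2 : torus R -> R) (c1 c2 : R) : bounded_measurable t1 -> bounded_measurable t2 ->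
  \int[@haar R]_x (g x * (c1 * t1 x + c2 * t2 x)) =
  c1 * \int[@haar R]_x (g x * t1 x) + c2 * \int[@haar R]_x (g x * t2 x).
Proof.
move=> b1 b2; have i1 := integrable_bounded_measurable b1.
have i2 := integrable_bounded_measurable b2.
rewrite -RintegralZl// -[in RHS]RintegralZl// -RintegralD//; last 2 first.
- exact: (integrableZl measurableT _ i1).
- exact: (integrableZl measurableT _ i2).
by apply: eq_Rintegral => x _; ring.
Qed.

Let bm_lin (t1 t2 : torus R -> R) (c1 c2 : R) : bounded_measurable t1 -> bounded_measurable t2 ->
  bounded_measurable (fun x => c1 * t1 x + c2 * t2 x).
Proof.
move=> b1 b2; apply: bounded_measurableD; apply: bounded_measurableM => //;
  exact: bounded_measurable_cst.
Qed.

Let Z1 : Z (cst 1).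
Proof.
split; first exact: bounded_measurable_cst.
by move=> k; split; [rewrite -(gcos k)|rewrite -(gsin k)]; apply: eq_Rintegral => x _; rewrite mul1r.
Qed.

Let Zlin (t1 t2 : torus R -> R) (c1 c2 : R) : Z t1 -> Z t2 -> Z (fun x => c1 * t1 x + c2 * t2 x).
Proof.
move=> [b1 H1] [b2 H2]; split; first exact: bm_lin.
move=> k; have bc := bounded_measurable_cosk R k; have bs := bounded_measurable_sink R k.
have [h1 h2] := H1 k; have [h3 h4] := H2 k; split.
  transitivity (\int[@haar R]_x (g x * (c1 * (t1 x * cosk k x) + c2 * (t2 x * cosk k x)))).
    by apply: eq_Rintegral => x _; ring.
  rewrite (intD c1 c2 (bounded_measurableM b1 bc) (bounded_measurableM b2 bc)) h1 h3.
  by rewrite !mulr0 addr0.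
transitivity (\int[@haar R]_x (g x * (c1 * (t1 x * sink k x) + c2 * (t2 x * sink k x)))).
  by apply: eq_Rintegral => x _; ring.
rewrite (intD c1 c2 (bounded_measurableM b1 bs) (bounded_measurableM b2 bs)) h2 h4.
by rewrite !mulr0 addr0.
Qed.

Let eqZ (t1 t2 : torus R -> R) : t1 =1 t2 -> Z t1 -> Z t2.
Proof. by move=> /funext ->. Qed.

Let Zcos (t : torus R -> R) : Z t -> Z (fun x => t x * cosk 1 x).
Proof.
move=> [bt H]; split; first exact/bounded_measurableM/bounded_measurable_cosk.
move=> k; have bc j := bounded_measurableM bt (bounded_measurable_cosk R j).
have bs j := bounded_measurableM bt (bounded_measurable_sink R j).
split.
  transitivity (\int[@haar R]_x (g x * (2^-1 * (t x * cosk (k + 1) x) + 2^-1 * (t x * cosk (k - 1) x)))).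
    by apply: eq_Rintegral => x _; rewrite -(mulrA (t x)) [cosk 1 x * _]mulrC cosk_cosk; ring.
  by rewrite intD// (H _).1 (H _).1 !mulr0 addr0.
transitivity (\int[@haar R]_x (g x * (2^-1 * (t x * sink (k + 1) x) + 2^-1 * (t x * sink (k - 1) x)))).
  by apply: eq_Rintegral => x _; rewrite -(mulrA (t x)) [cosk 1 x * _]mulrC sink_cosk; ring.
by rewrite intD// (H _).2 (H _).2 !mulr0 addr0.
Qed.

Let Zsin (t : torus R -> R) : Z t -> Z (fun x => t x * sink 1 x).
Proof.
move=> [bt H]; split; first exact/bounded_measurableM/bounded_measurable_sink.
move=> k; have bc j := bounded_measurableM bt (bounded_measurable_cosk R j).
have bs j := bounded_measurableM bt (bounded_measurable_sink R j).
split.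
  transitivity (\int[@haar R]_x (g x * (2^-1 * (t x * sink (k + 1) x) + - 2^-1 * (t x * sink (k - 1) x)))).
    by apply: eq_Rintegral => x _; rewrite -(mulrA (t x)) [sink 1 x * _]mulrC cosk_sink; ring.
  by rewrite intD// (H _).2 (H _).2 !mulr0 addr0.
transitivity (\int[@haar R]_x (g x * (2^-1 * (t x * cosk (k - 1) x) + - 2^-1 * (t x * cosk (k + 1) x)))).
  by apply: eq_Rintegral => x _; rewrite -(mulrA (t x)) [sink 1 x * _]mulrC sink_sink; ring.
by rewrite intD// (H _).1 (H _).1 !mulr0 addr0.
Qed.

(** Polynomials with values in [0, 1] that approximate a step function: 2^n s^n
tends to 0 for s < 1/2 and to infinity for s > 1/2. *)
Let step_poly_cvg (s : R) : 0 <= s <= 1 -> s != 1 / 2 ->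
  (1 - s ^+ n) ^+ (2 ^ n) @[n --> \oo] --> ((s < 1 / 2)%R%:R : R).
Proof.
move=> /andP[s0 s1] sh; have u01 n : 0 <= 1 - s ^+ n <= 1.
  by rewrite subr_ge0 exprn_ile1//= gerBl exprn_ge0.
have bern (x : R) m : 0 <= x <= 1 -> 1 - m%:R * x <= (1 - x) ^+ m.
  move=> /andP[x0 x1]; elim: m => [|m IH]; first by rewrite mul0r subr0 expr0.
  rewrite exprS; apply: le_trans (ler_wpM2l _ IH); last by rewrite subr_ge0.
  have : 0 <= m%:R * (x * x) by rewrite !mulr_ge0.
  by rewrite -natr1; lra.
have [sl|sg] := ltP s (1 / 2).
  have c0 : (2 * s) ^+ n @[n --> \oo] --> 0.
    by apply: cvg_expr; rewrite ger0_norm ?mulr_ge0//; lra.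
  apply: (@squeeze_cvgr _ _ _ _ (fun n => 1 - (2 * s) ^+ n) (cst 1)).
  - apply: nearW => n; have /andP[h0 h1] := u01 n; rewrite exprn_ile1// andbT.
    have := bern (s ^+ n) (2 ^ n)%N; rewrite exprn_ge0//= exprn_ile1//= natrX exprMn.
    exact.
  - by rewrite -[X in _ --> X]subr0; apply: cvgB => //; exact: cvg_cst.
  - exact: cvg_cst.
have s2 : 1 < 2 * s by rewrite lt_neqAle; apply/andP; split; [|lra]; apply: contra sh => /eqP h; apply/eqP; lra.
have c0 : ((2 * s)^-1) ^+ n @[n --> \oo] --> 0.
  by apply: cvg_expr; rewrite ger0_norm ?invr_ge0 ?mulr_ge0// invf_lt1// (lt_trans ltr01).
apply: (@squeeze_cvgr _ _ _ _ (cst 0) (fun n => ((2 * s)^-1) ^+ n)) => //; last exact: cvg_cst.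
apply: nearW => n; have /andP[h0 h1] := u01 n; rewrite exprn_ge0//=.
apply: (@le_trans _ _ (expR (- (2 * s) ^+ n))).
  apply: (@le_trans _ _ (expR (- s ^+ n) ^+ (2 ^ n))).
    by rewrite lerXn2r ?nnegrE ?expR_ge0// expR_ge1Dx.
  by rewrite -expRM_natl natrX mulrN exprMn.
have p0 : 0 < (2 * s) ^+ n by rewrite exprn_gt0// (lt_trans ltr01).
rewrite expRN exprVn lef_pV2 ?posrE ?expR_gt0//.
by apply: le_trans (expR_ge1Dx _); rewrite lerDr.
Qed.

Let G := g \o @torus_pi R.

Let iG : mu.-integrable `[0, 1[ (EFin \o G).
Proof. by have [] := haar_integral ig. Qed.

(** The raised cosine p is above 1/2 on the arc ]u, v[ and below 1/2 outside its
closure. The polynomials of [step_poly_cvg] in p are orthogonal to g, and they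
tend to the indicator of the complement of the arc. *)
Let arc_integral (u v : R) : 0 <= u -> u < v -> v <= 1 -> v - u <= 1 / 2 ->
  \int[mu]_(x in `]u, v[) G x = 0.
Proof.
move=> u0 uv v1 vu.
pose y := (u + v) / 2; pose c := cos (pi * (v - u)).
have p0 := pi_gt0 R.
have c0 : 0 <= c.
  apply: cos_ge0_pihalf; apply/andP; split.
    by rewrite (@le_trans _ _ 0)// ?oppr_le0 ?divr_ge0 ?(ltW p0)// mulr_ge0 ?subr_ge0 ?(ltW p0) ?(ltW uv).
  by rewrite ler_pM2l// -[2^-1]div1r.
pose lam := (1 + c)^-1; have lam0 : 0 < lam by rewrite invr_gt0 ltr_pwDl.
pose p (x : torus R) := lam / 2 * (1 + cos (2 * pi * y) * cosk 1 x + sin (2 * pi * y) * sink 1 x).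
have pE x : p x = lam / 2 * (1 + cos (2 * pi * (repr x - y))).
  by rewrite /p mulrBr cosB /cosk /sink -[1%:~R]/(1 : R) mulr1; ring.
have pE' x : p (torus_pi x) = lam / 2 * (1 + cos (2 * pi * (x - y))).
  by rewrite /p cosk_pi sink_pi mulrBr cosB -[1%:~R]/(1 : R) mulr1; ring.
have p01 x : 0 <= p x <= 1.
  rewrite pE; set k := cos _; have k1 : -1 <= k := cos_geN1 _; have k2 : k <= 1 := cos_le1 _.
  have l1 : lam <= 1 by rewrite invf_le1 ?ltr_pwDl// lerDl.
  apply/andP; split; first by rewrite mulr_ge0 ?divr_ge0 ?(ltW lam0)//; lra.
  apply: (@le_trans _ _ (1 / 2 * 2)); last by rewrite divfK.
  by apply: ler_pM; rewrite ?divr_ge0 ?(ltW lam0)//; lra.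
have Zp t : Z t -> Z (fun x => t x * p x).
  move=> Zt; apply: (eqZ _ (Zlin (lam / 2) 1 Zt (Zlin (lam / 2 * cos (2 * pi * y)) (lam / 2 * sin (2 * pi * y)) (Zcos Zt) (Zsin Zt)))).
  by move=> x; rewrite /p; ring.
have Zpn t n : Z t -> Z (fun x => t x * p x ^+ n).
  move=> Zt; elim: n => [|n IH]; first by apply: (eqZ _ Zt) => x; rewrite expr0 mulr1.
  by apply: (eqZ _ (Zp _ IH)) => x /=; rewrite exprSr [RHS]mulrA.
have Zq n m : Z (fun x => (1 - p x ^+ n) ^+ m).
  elim: m => [|m IH]; first by apply: (eqZ _ Z1) => x; rewrite expr0.
  apply: (eqZ _ (Zlin 1 (-1) IH (Zpn _ n IH))) => x; rewrite exprSr; ring.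
have int0 n : \int[mu]_(x in `[0, 1[) (G x * (1 - p (torus_pi x) ^+ n) ^+ (2 ^ n)) = 0.
  have [bq Hq] := Zq n (2 ^ n)%N.
  have [_ <-] := haar_integral (integrable_bounded_measurable bq).
  have [<- _] := Hq 0; apply: eq_Rintegral => x _; by rewrite cosk0 mulr1.
have G0 : \int[mu]_(x in `[0, 1[) G x = 0.
  have [_ <-] := haar_integral ig; rewrite -(gcos 0); apply: eq_Rintegral => x _.
  by rewrite cosk0 mulr1.
have mG : measurable_fun (`[(0:R), 1[%classic : set (measurableTypeR R)) G by apply/measurable_EFinP; exact: measurable_int iG.
pose h x : R := (~~ ((u < x) && (x < v)))%:R.
have hE x : h x = 1 - \1_(`]u, v[%classic) x.
  rewrite /h indicE mem_setE in_itv/=.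
  by case: (_ && _); rewrite /= ?subrr ?subr0.
have mh : measurable_fun (`[(0:R), 1[%classic : set (measurableTypeR R)) h.
  rewrite (_ : h = fun x => 1 - \1_(`]u, v[%classic) x); last exact/funext.
  by apply: measurable_funB => //; exact: measurable_indic.
have mp : measurable_fun setT p.
  by have [[+ _] _] := Zp _ Z1; congr measurable_fun; apply/funext => x /=; rewrite mul1r.
have lim0 : \int[mu]_(x in `[0, 1[) (G x * h x) = 0.
  have [|||||/= _ _] := @dominated_convergence _ _ _ mu `[0, 1[%classic (measurable_itv _)
    (fun n x => (G x * (1 - p (torus_pi x) ^+ n) ^+ (2 ^ n))%:E)
    (fun x => (G x * h x)%:E) (fun x => `|G x|%:E).
  - move=> n; apply/measurable_EFinP; apply: measurable_funM => //.
    apply: measurable_funTS; apply: measurable_funX; apply: measurable_funB => //.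
    by apply: measurable_funX; apply: (measurableT_comp mp (@measurable_torus_pi R)).
  - by apply/measurable_EFinP; apply: measurable_funM.
  - have n4 : mu.-negligible [set u; v; 0].
      apply: negligibleU; first apply: negligibleU; by apply/negligibleP => //; exact: lebesgue_measure_set1.
    case: n4 => A [mA A0 uA]; exists A; split => // x /= Hx; apply: uA.
    apply: contrapT => nx; apply: Hx => /=; rewrite in_itv/= => x01.
    have [xu xv xn0] : [/\ x != u, x != v & x != 0].
      by split; apply/eqP => xe; apply: nx; [left; left|left; right|right].
    apply: cvg_EFin; first exact: nearW.
    have [ne le] := arc_cos u0 uv v1 vu x01 xu xv xn0.
    have lE : lam / 2 * (1 + c) = 1 / 2 by rewrite mulrAC /lam mulVf ?gt_eqF ?ltr_pwDl.
    rewrite (_ : fine \o _ = fun n => G x * (1 - p (torus_pi x) ^+ n) ^+ (2 ^ n))//.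
    apply: cvgMr; rewrite /h -le -/y -/c.
    have -> : (cos (2 * pi * (x - y)) < c) = (p (torus_pi x) < 1 / 2).
      by rewrite pE' -lE ltr_pM2l ?divr_gt0// ltrD2l.
    apply: step_poly_cvg => //; rewrite pE' -lE; apply/eqP => E.
    have l20 : lam / 2 != 0 by rewrite gt_eqF// divr_gt0.
    by move: (mulfI l20 E) => /addrI E'; rewrite -/y -/c E' eqxx in ne.
  - by have := integrable_norm iG.
  - apply: aeW => x n _; rewrite lee_fin normrM ler_piMr//.
    have /andP[q0 q1] := p01 (torus_pi x).
    have a0 : 0 <= 1 - p (torus_pi x) ^+ n by rewrite subr_ge0 exprn_ile1.
    have a1 : 1 - p (torus_pi x) ^+ n <= 1 by rewrite gerBl exprn_ge0.
    by rewrite ger0_norm ?exprn_ge0// exprn_ile1.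
  move=> H; rewrite /Rintegral -(cvg_lim _ H)//.
  have E n : (\int[mu]_(x in `[0%R, 1%R[) (G x * (1 - p (torus_pi x) ^+ n) ^+ (2 ^ n))%:E = 0)%E.
    rewrite -[LHS]fineK; first by rewrite [X in X%:E]int0.
    apply: integrable_fin_num => //.
    have [bq _] := Zq n (2 ^ n)%N.
    by have [] := haar_integral (integrable_bounded_measurable bq).
  by under eq_fun do rewrite E; rewrite lim_cst.
have iGh : mu.-integrable `[0, 1[ (EFin \o (fun x => G x * \1_(`]u, v[%classic) x)).
  have := @integrableMl _ _ _ mu `[0, 1[%classic (measurable_itv _) (EFin \o G) (\1_(`]u, v[%classic)) iG.
  apply; first exact: measurable_indic.
  exists 1; split; rewrite ?num_real// => M M1 x _ /=; rewrite indicE.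
  by case: (_ \in _); rewrite ?normr1 ?normr0 ltW// (lt_trans _ M1).
have : \int[mu]_(x in `[0, 1[) (G x * h x) = \int[mu]_(x in `[0, 1[) G x - \int[mu]_(x in `[0, 1[) (G x * \1_(`]u, v[%classic) x).
  by rewrite -RintegralB//; apply: eq_Rintegral => x _; rewrite hE; ring.
rewrite lim0 G0 sub0r => /esym/eqP; rewrite oppr_eq0 => /eqP <-.
rewrite Rintegral_mkcond [RHS]Rintegral_mkcond; apply: eq_Rintegral => x _.
rewrite !patchE indicE !mem_setE !in_itv/=.
case: ifPn => [/andP[ux xv]|_].
  by rewrite (le_trans u0 (ltW ux)) (lt_le_trans xv v1) mulr1.
by rewrite mulr0; case: ifP.
Qed.

(** The integral of g over each short arc vanishes, hence the primitive of g is
locally constant, and g is its derivative almost everywhere. *)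
Lemma fourier_uniqueness : exists2 N : set (torus R), measurable N /\ @haar R N = 0%E &
  forall x, ~ N x -> g x = 0.
Proof.
pose H := G \_ `[0, 1[.
have iH : mu.-integrable setT (EFin \o H).
  have := (@integrable_mkcond _ (measurableTypeR R) R mu `[0, 1[%classic (EFin \o G) (measurable_itv _)).1 iG; congr (integrable _ _ _).
  by apply/funext => x; rewrite /H /= !patchE; case: ifP.
have HE (A : set R) : A `<=` `[0, 1[%classic -> \int[mu]_(x in A) H x = \int[mu]_(x in A) G x.
  move=> AI; apply: eq_Rintegral => x /set_mem Ax; rewrite /H patchE mem_set//; exact: AI.
have iHS (y : R) : mu.-integrable [set` Interval (BRight 0) (BRight y)] (EFin \o H).
  exact: integrableS iH.
have [N [mN N0 HN]] := FTC1 iHS (open_integrable_locally openT iH).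
have zero x : 0 < x < 1 -> ~ N x -> G x = 0.
  move=> /andP[x0 x1] Nx; pose F (y : R) := \int[mu]_(t in [set` Interval (BRight 0) (BRight y)]) H t.
  have [dF F'] : derivable F x 1 /\ derive1 F x = H x.
    by apply: contrapT => nd; apply/Nx/HN => K; apply: nd; exact: K.
  have cstF s t : 0 < s -> s < t -> t < 1 -> t - s <= 1 / 2 -> F t = F s.
    move=> s0 st t1 ts; apply/eqP; rewrite -subr_eq0 /F Rintegral_itvB//; last 2 first.
    - by rewrite bnd_simp ltW.
    - by rewrite bnd_simp ltW.
    rewrite -Rintegral_itv_bndo_bndc; last exact: integrableS iH.
    rewrite HE; first by rewrite arc_integral ?(ltW s0) ?(ltW t1).
    move=> r /=; rewrite !in_itv/= => /andP[r1 r2].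
    by rewrite (ltW (lt_trans s0 r1)) (lt_trans r2 t1).
  have near_cst : \forall y \near x, F y = F x.
    near=> y.
    have y0 : 0 < y by near: y; exact: lt_nbhsr.
    have y1 : y < 1 by near: y; exact: lt_nbhsl.
    have yx : y - x <= 1 / 2.
      by rewrite lerBlDr ltW//; near: y; apply: lt_nbhsl; lra.
    have xy : x - y <= 1 / 2.
      by rewrite lerBlDr -lerBlDl ltW//; near: y; apply: lt_nbhsr; lra.
    by have [yx'|yx'|->//] := ltgtP y x; [apply/esym; exact: cstF|exact: cstF].
  have E0 : \forall y \near x, F x + 0 = F y by move: near_cst; apply: filterS => y ->; rewrite addr0.
  have [_ E] : derivable F x 1 /\ derive1 F x = 0.
    have near' : \forall y \near x, cst (F x) y + 0 = F y by move: E0; apply: filterS => y /=.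
    have [d1 e1] := derivable_near_shift (@derivable_cst _ _ _ (F x) x 1) near'.
    by split; [exact: d1|rewrite e1; exact: derive1_cst].
  move: F'; rewrite E /H patchE mem_set; first by move=> <-.
  by rewrite /= in_itv/= (ltW x0) x1.
have mg : measurable_fun setT g by apply/measurable_EFinP; exact: measurable_int ig.
exists [set x | g x != 0].
  have mA : measurable [set x : torus R | g x != 0].
    rewrite (_ : [set x | _] = setT `&` g @^-1` (~` [set 0])).
      by apply: mg => //; exact: measurableC.
    by rewrite setTI; apply/seteqP; split => x /= /eqP.
  split => //; suff : mu.-negligible (@torus_pi R @^-1` [set x | g x != 0] `&` `[0, 1[%classic).
    move=> /negligibleP; apply; apply: measurableI => //.
    rewrite -[X in measurable X]setTI; exact: measurable_torus_pi.
  apply: (@negligibleS _ _ _ _ (N `|` [set 0])).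
    move=> x /= [gx]; rewrite in_itv/= => /andP[x0 x1].
    have [->|xn] := eqVneq x 0; first by right.
    left; apply: contrapT => Nx; move/eqP: gx; apply; apply: (zero x) => //.
    by rewrite x1 lt_neqAle eq_sym xn x0.
  apply: negligibleU; first exact/negligibleP.
  by apply/negligibleP => //; exact: lebesgue_measure_set1.
by move=> x /=; case: eqVneq.
Unshelve. all: by end_near. Qed.

End fourier_uniqueness.

(** * Majorized series, invariance of the Haar measure, coboundaries *)

Section majorized_series.
Variable R : realType.
Implicit Types (F G M : nat -> R).

(** All the series below are majorized termwise by a fixed summable sequence, which
gives their convergence together with a bound on their remainders. *)
Definition psum F (n : nat) : R := \sum_(k < n) F k.
Definition isum F : R := limn (psum F).
Definition summable M : Prop := (forall k, 0 <= M k) /\ exists B, forall n, psum M n <= B.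
Definition tail M n : R := isum M - psum M n.

Lemma psumS F n : psum F n.+1 = psum F n + F n.
Proof. by rewrite /psum big_ord_recr. Qed.

Lemma psum_homo M : (forall k, 0 <= M k) -> {homo psum M : m n / (m <= n)%N >-> m <= n}.
Proof.
move=> M0 m n /subnKC <-; elim: (n - m)%N => [|k IH]; first by rewrite addn0.
by rewrite addnS psumS (le_trans IH)// lerDl.
Qed.

Lemma summable_cvg M : summable M -> psum M @ \oo --> isum M.
Proof.
move=> [M0 [B MB]]; apply: nondecreasing_is_cvgn; first exact: psum_homo.
by exists B => _ [n _ <-].
Qed.

Lemma cvgn_ge (u : nat -> R) (l c : R) n : u @ \oo --> l -> (forall m, (n <= m)%N -> c <= u m) -> c <= l.
Proof.
move=> ul cu; apply: (cvgr_to_ge ul); near=> m; apply: cu; near: m.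
exact: nbhs_infty_ge.
Unshelve. all: by end_near. Qed.

Lemma cvgn_le (u : nat -> R) (l c : R) n : u @ \oo --> l -> (forall m, (n <= m)%N -> u m <= c) -> l <= c.
Proof.
move=> ul cu; apply: (cvgr_to_le ul); near=> m; apply: cu; near: m.
exact: nbhs_infty_ge.
Unshelve. all: by end_near. Qed.

Lemma psum_le_isum M n : summable M -> psum M n <= isum M.
Proof.
move=> sM; apply: (cvgn_ge (n := n) (summable_cvg sM)) => m nm; exact: psum_homo sM.1 _ _ nm.
Qed.

Lemma summable_le M F : summable M -> (forall k, 0 <= F k <= M k) -> summable F.
Proof.
move=> [M0 [B MB]] FM; split => [k|]; first by have /andP[] := FM k.
exists B => n; apply: le_trans (MB n); apply: ler_sum => k _.
by have /andP[] := FM k.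
Qed.

Lemma summableZ c M : 0 <= c -> summable M -> summable (fun k => c * M k).
Proof.
move=> c0 [M0 [B MB]]; split => [k|]; first exact: mulr_ge0.
by exists (c * B) => n; rewrite /psum -mulr_sumr; apply: ler_wpM2l => //; exact: MB.
Qed.

Lemma tail_ge0 M n : summable M -> 0 <= tail M n.
Proof. by move=> sM; rewrite subr_ge0 psum_le_isum. Qed.

Lemma tail_cvg M : summable M -> tail M @ \oo --> 0.
Proof.
move=> sM; rewrite -(subrr (isum M)); apply: cvgB; first exact: cvg_cst.
exact: summable_cvg.
Qed.

Lemma psumB_le M F m n : (m <= n)%N -> (forall k, `|F k| <= M k) ->
  `|psum F n - psum F m| <= psum M n - psum M m.
Proof.
move=> /subnKC <- FM; elim: (n - m)%N => [|k IH]; first by rewrite addn0 !subrr normr0.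
by rewrite addnS !psumS addrAC (le_trans (ler_normD _ _))// [leRHS]addrAC lerD.
Qed.

Lemma majorized_cvg M F : summable M -> (forall k, `|F k| <= M k) -> psum F @ \oo --> isum F.
Proof.
move=> sM FM.
have sp : summable (fun k => (F k + M k) / 2).
  apply: (summable_le sM) => k; have := FM k; rewrite ler_norml => /andP[h1 h2].
  by apply/andP; split; lra.
have E : psum F = fun n => 2 * psum (fun k => (F k + M k) / 2) n - psum M n.
  apply/funext => n; elim: n => [|n IH]; first by rewrite /psum !big_ord0 mulr0 subr0.
  by rewrite !psumS IH; field.
suff : psum F @ \oo --> 2 * isum (fun k => (F k + M k) / 2) - isum M.
  by move=> h; rewrite /isum; apply/cvg_ex; eexists; exact: h.
rewrite E; apply: cvgB; last exact: summable_cvg.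
by apply: cvgMr; exact: summable_cvg.
Qed.

Lemma isum_tail M F n : summable M -> (forall k, `|F k| <= M k) -> `|isum F - psum F n| <= tail M n.
Proof.
move=> sM FM; have cF := majorized_cvg sM FM.
have c1 : (fun m => psum F m - psum F n) @ \oo --> isum F - psum F n.
  by apply: cvgB => //; exact: cvg_cst.
apply: (cvgn_le (n := n) (cvg_norm c1)) => m nm.
by apply: le_trans (psumB_le nm FM) _; rewrite lerD2r psum_le_isum.
Qed.

Lemma isum_le M F : summable M -> (forall k, `|F k| <= M k) -> `|isum F| <= isum M.
Proof.
by move=> sM FM; have := isum_tail 0 sM FM; rewrite /tail /psum !big_ord0 !subr0.
Qed.

Lemma isumE F l : psum F @ \oo --> l -> isum F = l.
Proof. by move=> h; exact: cvg_lim h. Qed.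

Lemma isum_lin M M' F G c : summable M -> (forall k, `|F k| <= M k) ->
  summable M' -> (forall k, `|G k| <= M' k) ->
  isum (fun k => F k + c * G k) = isum F + c * isum G.
Proof.
move=> sM FM sM' GM; apply: isumE.
have -> : psum (fun k => F k + c * G k) = fun n => psum F n + c * psum G n.
  by apply/funext => n; rewrite /psum mulr_sumr -big_split.
apply: cvgD; first exact: majorized_cvg sM FM.
by apply: cvgMr; exact: majorized_cvg sM' GM.
Qed.

Lemma isum_single j c : isum (fun k => if k == j then c else 0) = c.
Proof.
apply: isumE; apply: cvg_near_cst; near=> n.
have jn : (j < n)%N by near: n; exact: nbhs_infty_gt.
rewrite /psum (bigD1 (Ordinal jn))//= eqxx big1 ?addr0// => i ij.
by rewrite ifF//; apply: contra_neqF ij => /eqP ij; exact: val_inj.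
Unshelve. all: by end_near. Qed.

Lemma isum_dominated M (F : nat -> nat -> R) G : summable M ->
  (forall j k, `|F j k| <= M k) -> (forall k, F j k @[j --> \oo] --> G k) ->
  isum (F j) @[j --> \oo] --> isum G.
Proof.
move=> sM FM FG; have GM k : `|G k| <= M k.
  by apply: (cvgn_le (n := 0%N) (cvg_norm (FG k))) => m _; exact: FM.
apply/cvgrPdist_le => e e0.
have e3 : 0 < e / 3 by rewrite divr_gt0.
have /cvgr0Pnorm_le/(_ _ e3)[n _ /(_ n (leqnn n)) tn] := tail_cvg sM.
rewrite /= ger0_norm ?tail_ge0// in tn.
have cn m : psum (F j) m @[j --> \oo] --> psum G m.
  elim: m => [|m IH].
    rewrite /psum big_ord0; under eq_fun do rewrite big_ord0; exact: cvg_cst.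
  by under eq_fun do rewrite psumS; rewrite psumS; exact: cvgD.
move/cvgrPdist_le : (cn n) => /(_ _ e3); apply: filterS => j h.
have h1 := isum_tail n sM GM; have h2 := isum_tail n sM (FM j).
have -> : isum G - isum (F j) = (isum G - psum G n) + (psum G n - psum (F j) n) - (isum (F j) - psum (F j) n).
  by ring.
rewrite (le_trans (ler_normB _ _))// (_ : e = e / 3 + e / 3 + e / 3); last by field.
rewrite lerD//; last exact: le_trans h2 tn.
by rewrite (le_trans (ler_normD _ _))// lerD//; exact: le_trans h1 tn.
Qed.

End majorized_series.

Section series_of_functions.
Context d (T : measurableType d) (R : realType) (mu : probability T R).
Variables (M : nat -> R) (F : nat -> T -> R).
Hypothesis sM : summable M.
Hypothesis bF : forall k, bounded_measurable (F k).
Hypothesis FM : forall k x, `|F k x| <= M k.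

Lemma bounded_measurable_psum n : bounded_measurable (fun x => psum (F^~ x) n).
Proof. exact: bounded_measurable_sum. Qed.

Lemma bounded_measurable_isum : bounded_measurable (fun x => isum (F^~ x)).
Proof.
split; last by exists (isum M) => x; exact: isum_le.
apply: (@measurable_fun_cvg _ _ _ _ (fun n x => psum (F^~ x) n)).
- by move=> n; have [] := bounded_measurable_psum n.
- by move=> x _; exact: majorized_cvg sM (FM^~ x).
Qed.

(** The remainders tend to 0 uniformly, and g is integrable. *)
Lemma Rintegral_isum (g : T -> R) : mu.-integrable setT (EFin \o g) ->
  \int[mu]_x (g x * isum (F^~ x)) = isum (fun k => \int[mu]_x (g x * F k x)).
Proof.
move=> ig; have ib (t : T -> R) : bounded_measurable t -> mu.-integrable setT (EFin \o (fun x => g x * t x)).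
  move=> [mt [B tB]]; have := @integrableMl _ _ _ mu setT measurableT (EFin \o g) t ig mt.
  apply; exists B; split; rewrite ?num_real// => N MN x _.
  by apply: le_trans (tB x) _; exact: ltW.
apply/esym/isumE.
have E n : psum (fun k => \int[mu]_x (g x * F k x)) n = \int[mu]_x (g x * psum (F^~ x) n).
  elim: n => [|n IH].
    rewrite /psum big_ord0; under eq_Rintegral do rewrite big_ord0 mulr0.
    by rewrite Rintegral_cst// mul0r.
  rewrite psumS IH -RintegralD//; [|exact/ib/bounded_measurable_psum|exact: ib].
  by apply: eq_Rintegral => x _; rewrite psumS mulrDr.
pose B := \int[mu]_x `|g x|.
have B0 : 0 <= B by apply: Rintegral_ge0.
apply/cvgrPdist_le => e e0; have B1 : 0 < B + 1 by rewrite ltr_wpDl.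
have /cvgr0Pnorm_le/(_ (e / (B + 1))) := tail_cvg sM.
rewrite divr_gt0// => /(_ isT); apply: filterS => n.
rewrite ger0_norm ?tail_ge0// => tn; rewrite E.
rewrite -RintegralB//; [|exact/ib/bounded_measurable_isum|exact/ib/bounded_measurable_psum].
have ig' : mu.-integrable setT (EFin \o (fun x => `|g x|)) by exact: (integrable_norm ig).
have iD : mu.-integrable setT (EFin \o (fun x => g x * isum (F^~ x) - g x * psum (F^~ x) n)).
  exact: (integrableB measurableT (ib _ bounded_measurable_isum) (ib _ (bounded_measurable_psum n))).
apply: le_trans (le_normr_Rintegral _ iD) _ => //.
apply: (@le_trans _ _ (\int[mu]_x (tail M n * `|g x|))).
  apply: le_Rintegral => //.
  - exact: (integrable_norm iD).
  - exact: (integrableZl measurableT _ ig').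
  move=> x _; rewrite -mulrBr normrM mulrC ler_wpM2r//.
  exact: isum_tail sM (FM^~ x).
rewrite RintegralZl// -/B; apply: (@le_trans _ _ (e / (B + 1) * B)); first by rewrite ler_wpM2r.
by rewrite mulrAC ler_pdivrMr// ler_wpM2l ?(ltW e0)// lerDl.
Qed.

End series_of_functions.

Section haar_invariance.
Context d (Omega : measurableType d) (R : realType) (P : probability Omega R).
Variables (a : R) (xi : int -> {RV P >-> torus R}).
Hypothesis chain : stationary_markov_chain (walk_kernel a) (@haar R) xi.

Let law k (g : torus R -> R) : bounded_measurable g -> \int[P]_w g (chain_at xi k w) = mean g.
Proof.
move=> bg; rewrite /mean /Rintegral; congr fine.
transitivity (\int[distribution P (xi k%:Z)]_x (g x)%:E)%E.
  have mg : measurable_fun setT (EFin \o g) by apply/measurable_EFinP; exact: bg.1.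
  rewrite (integral_distribution mg)//; apply: bounded_measurable_integrable.
  by apply: (bounded_measurable_comp _ bg); exact: measurable_funPT.
by apply: eq_measure_integral => A mA _; exact: chain.1.
Qed.

(** The laws of X 0 and X 1 are both the Haar measure, and the kernel maps one to
the other. *)
Lemma haar_kernel_invariant (g : torus R -> R) : bounded_measurable g ->
  mean (walk_kernel a g) = mean g.
Proof.
move=> bg; rewrite -(law 0); last exact: bounded_measurable_walk_kernel.
rewrite -(law 1)//.
have ad : adapted xi 0 (cst 1) by exact: measurable_cst.
have le1 (w : Omega) : (0 : R) <= cst (1 : R) w <= (1 : R) by rewrite ler01 lexx.
have := markov_step chain ad le1 bg.
move=> H; have {}H := esym H; transitivity (\int[P]_w (cst 1 w * walk_kernel a g (chain_at xi 0 w))).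
  by apply: eq_Rintegral => w _; rewrite mul1r.
by rewrite H; apply: eq_Rintegral => w _; rewrite mul1r.
Qed.

End haar_invariance.

Section coboundaries.
Variables (R : realType) (a : R).
Hypothesis irr : irrational a.
Hypothesis inv : forall g : torus R -> R, bounded_measurable g -> mean (walk_kernel a g) = mean g.
Local Notation K := (walk_kernel a).
Implicit Types (g u : torus R -> R).

(** Solvability of the Poisson equation for g - c: along the chain, g may be
replaced by c at the cost of a bounded coboundary. *)
Definition cohomologous g (c : R) : Prop :=
  exists2 u, bounded_measurable u & forall x, g x - c = u x - K u x.

Lemma mean_cohomologous g c : cohomologous g c -> mean g = c.
Proof.
move=> [u bu H]; have bKu := bounded_measurable_walk_kernel a bu.
have ib (t : torus R -> R) : bounded_measurable t -> (@haar R).-integrable setT (EFin \o t).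
  exact: bounded_measurable_integrable.
have gE : g = fun x => (u x - K u x) + c by apply/funext => x; rewrite -H subrK.
have bc := @bounded_measurable_cst _ (torus R) R c.
have iB : (@haar R).-integrable setT (EFin \o (fun x => u x - K u x)).
  exact: (integrableB measurableT (ib _ bu) (ib _ bKu)).
rewrite /mean gE RintegralD//; last exact: ib.
rewrite RintegralB//; [|exact: ib|exact: ib].
rewrite -/(mean (K u)) -/(mean u) inv// subrr add0r Rintegral_cst//.
by rewrite [X in fine X](_ : _ = 1%E) ?mulr1//; exact: haar_setT.
Qed.

Lemma cohomologous_lin g g' c c' k k' : cohomologous g c -> cohomologous g' c' ->
  cohomologous (fun x => k * g x + k' * g' x) (k * c + k' * c').
Proof.
move=> [u bu H] [u' bu' H']; exists (fun x => k * u x + k' * u' x).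
  by apply: bounded_measurableD; apply: bounded_measurableM => //; exact: bounded_measurable_cst.
move=> x; have -> : k * g x + k' * g' x - (k * c + k' * c') = k * (g x - c) + k' * (g' x - c') by ring.
by rewrite H H' /walk_kernel; field.
Qed.

Lemma eq_cohomologous g g' c c' : g =1 g' -> c = c' -> cohomologous g c -> cohomologous g' c'.
Proof. by move=> /funext -> ->. Qed.

Lemma cohomologous_sum n (g : 'I_n -> torus R -> R) (c : 'I_n -> R) (w : 'I_n -> R) :
  (forall i, cohomologous (g i) (c i)) ->
  cohomologous (fun x => \sum_i w i * g i x) (\sum_i w i * c i).
Proof.
elim: n g c w => [|n IH] g c w H.
  exists (cst 0) => [|x]; first exact: bounded_measurable_cst.
  by rewrite !big_ord0 /walk_kernel addr0 mul0r.
have := cohomologous_lin 1 (w ord_max) (IH (fun i => g (widen_ord (leqnSn n) i)) _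
  (fun i => w (widen_ord (leqnSn n) i)) (fun i => H _)) (H ord_max).
by apply: eq_cohomologous => [x|]; rewrite big_ord_recr mul1r.
Qed.

Let theta (k : int) : R := 2 * pi * k%:~R * a.

Lemma kernel_cosk k x : K (cosk k) x = cos (theta k) * cosk k x.
Proof.
by rewrite /walk_kernel !cosk_rot mulrN -/(theta k) cosN sinN; field.
Qed.

Lemma kernel_sink k x : K (sink k) x = cos (theta k) * sink k x.
Proof.
by rewrite /walk_kernel !sink_rot mulrN -/(theta k) cosN sinN; field.
Qed.

Let theta_neq k : k != 0 -> 1 - cos (theta k) != 0.
Proof.
move=> k0; have -> : theta k = 2 * (pi * (k%:~R * a)) by rewrite /theta; ring.
rewrite one_sub_cos2 mulf_neq0// expf_neq0//; exact: sin_irrational.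
Qed.

(** The kernel multiplies the k-th harmonics by cos (2 pi k a), which differs from 1
for k <> 0 as a is irrational. *)
Lemma cohomologous_cosk k : cohomologous (cosk k) (k == 0)%:R.
Proof.
have [->|k0] := eqVneq k 0.
  exists (cst 0) => [|x]; first exact: bounded_measurable_cst.
  by rewrite cosk0 /walk_kernel/= addr0 mul0r subrr subr0.
exists (fun x => (1 - cos (theta k))^-1 * cosk k x) => [|x].
  by apply: bounded_measurableM; [exact: bounded_measurable_cst|exact: bounded_measurable_cosk].
have -> : K (fun x => (1 - cos (theta k))^-1 * cosk k x) x = (1 - cos (theta k))^-1 * K (cosk k) x.
  by rewrite /walk_kernel; ring.
rewrite kernel_cosk mulr0n; field; exact: theta_neq.
Qed.

Lemma cohomologous_sink k : cohomologous (sink k) 0.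
Proof.
have [->|k0] := eqVneq k 0.
  exists (cst 0) => [|x]; first exact: bounded_measurable_cst.
  by rewrite sink0 /walk_kernel/= addr0 mul0r subrr.
exists (fun x => (1 - cos (theta k))^-1 * sink k x) => [|x].
  by apply: bounded_measurableM; [exact: bounded_measurable_cst|exact: bounded_measurable_sink].
have -> : K (fun x => (1 - cos (theta k))^-1 * sink k x) x = (1 - cos (theta k))^-1 * K (sink k) x.
  by rewrite /walk_kernel; ring.
rewrite kernel_sink; field; exact: theta_neq.
Qed.

(** The k-th term of a real Fourier series, numbered from 0 and without the constant
term. *)
Definition wave (A B : R) (k : nat) x : R := A * cosk k.+1%:Z x + B * sink k.+1%:Z x.

Lemma bounded_measurable_wave A B k : bounded_measurable (wave A B k).
Proof.
apply: bounded_measurableD; apply: bounded_measurableM; try exact: bounded_measurable_cst.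
- exact: bounded_measurable_cosk.
- exact: bounded_measurable_sink.
Qed.

Lemma wave_le A B k x : `|wave A B k x| <= `|A| + `|B|.
Proof.
rewrite (le_trans (ler_normD _ _))// !normrM; apply: lerD; rewrite ler_piMr//.
- exact: cos_max.
- exact: sin_max.
Qed.

Lemma kernel_wave A B k x : K (wave A B k) x = cos (theta k.+1%:Z) * wave A B k x.
Proof.
have -> : K (wave A B k) x = A * K (cosk k.+1%:Z) x + B * K (sink k.+1%:Z) x.
  by rewrite /walk_kernel /wave; field.
by rewrite kernel_cosk kernel_sink /wave; ring.
Qed.

(** The martingale difference attached to a wave is plus or minus this quantity,
according to the side to which the walk steps. *)
Lemma wave_difference A B k x :
  (wave A B k (Defs.rot a x) - wave A B k (Defs.rot (- a) x)) / 2 =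
  sin (theta k.+1%:Z) * wave B (- A) k x.
Proof.
by rewrite /wave !cosk_rot !sink_rot mulrN -/(theta _) cosN sinN; field.
Qed.

Lemma cohomologous_wave A B k : cohomologous (wave A B k) 0.
Proof.
have := cohomologous_lin A B (cohomologous_cosk k.+1%:Z) (cohomologous_sink k.+1%:Z).
by apply: eq_cohomologous => //; rewrite !mulr0 addr0.
Qed.

(** A product of waves is a combination of harmonics of orders k + j + 2 and k - j,
and only the harmonic of order 0 has a nonzero mean. *)
Lemma cohomologous_waveM A B A' B' k j :
  cohomologous (fun x => wave A B k x * wave A' B' j x)
    (if k == j then (A * A' + B * B') / 2 else 0).
Proof.
pose p := (k.+1%:Z + j.+1%:Z); pose q := k.+1%:Z - j.+1%:Z.
have H1 := cohomologous_lin ((A * A' - B * B') / 2) ((A * A' + B * B') / 2)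
  (cohomologous_cosk p) (cohomologous_cosk q).
have H2 := cohomologous_lin ((A * B' + B * A') / 2) ((B * A' - A * B') / 2)
  (cohomologous_sink p) (cohomologous_sink q).
have := cohomologous_lin 1 1 H1 H2; apply: eq_cohomologous => [x|].
  rewrite /wave.
  have -> : (A * cosk k.+1 x + B * sink k.+1 x) * (A' * cosk j.+1 x + B' * sink j.+1 x) =
    A * A' * (cosk k.+1 x * cosk j.+1 x) + B * B' * (sink k.+1 x * sink j.+1 x) +
    A * B' * (cosk k.+1 x * sink j.+1 x) + B * A' * (sink k.+1 x * cosk j.+1 x) by ring.
  by rewrite cosk_cosk sink_sink cosk_sink sink_cosk -/p -/q; field.
have -> : (p == 0) = false by apply/negbTE; rewrite /p; lia.
have -> : (q == 0) = (k == j) by rewrite /q subr_eq0 eqz_nat eqSS.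
by case: eqP => _; rewrite /= ?mulr1n ?mulr0n; field.
Qed.

End coboundaries.

(** * Fourier expansion and martingale approximation *)

Lemma Rintegral_ae_eq d (T : measurableType d) (R : realType) (mu : probability T R)
    (g1 g2 : T -> R) (N : set T) : measurable_fun setT g1 -> measurable_fun setT g2 ->
  measurable N -> mu N = 0%E -> (forall x, ~ N x -> g1 x = g2 x) ->
  \int[mu]_x g1 x = \int[mu]_x g2 x.
Proof.
move=> m1 m2 mN N0 H; rewrite /Rintegral; congr fine; apply: ae_eq_integral => //.
- exact/measurable_EFinP.
- exact/measurable_EFinP.
exists N; split => // x /= Hx; apply: contrapT => Nx; apply: Hx => _.
by rewrite H.
Qed.

Lemma cvg_psum (R : realType) (F : nat -> nat -> R) (G : nat -> R) n :
  (forall k, F j k @[j --> \oo] --> G k) -> psum (F j) n @[j --> \oo] --> psum G n.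
Proof.
move=> FG; elim: n => [|n IH].
  rewrite /psum big_ord0; under eq_fun do rewrite big_ord0; exact: cvg_cst.
by under eq_fun do rewrite psumS; rewrite psumS; exact: cvgD.
Qed.

Lemma isum0 (R : realType) : isum (fun=> 0 : R) = 0.
Proof.
apply: isumE; rewrite (_ : psum _ = cst 0); first exact: cvg_cst.
by apply/funext => n; rewrite /psum big1.
Qed.

Section fourier_expansion.
Variables (R : realType) (a : R).
Hypothesis irr : irrational a.
Hypothesis inv : forall g : torus R -> R, bounded_measurable g -> mean (walk_kernel a g) = mean g.
Local Notation K := (walk_kernel a).
Variable f : torus R -> R.
Hypothesis f_int : (@haar R).-integrable setT (EFin \o f).

Definition cos_coef k : R := \int[@haar R]_x (f x * cosk k.+1%:Z x).
Definition sin_coef k : R := \int[@haar R]_x (f x * sink k.+1%:Z x).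
Definition divisor k : R := `|sin (pi * (k.+1%:R * a))|.
Local Notation A := cos_coef.
Local Notation B := sin_coef.
Local Notation S := divisor.

(** It bounds the k-th term 2 (A cos + B sin) of the Fourier series, to which both
frequencies k+1 and -(k+1) contribute. *)
Definition majorant k : R := 2 * (`|A k| + `|B k|).
Local Notation M := majorant.
Hypothesis sMS : summable (fun k => M k / S k).

Let c k : R := cos (2 * pi * k.+1%:Z%:~R * a).
Let sn k : R := sin (2 * pi * k.+1%:Z%:~R * a).

Let angle k : 2 * pi * k.+1%:Z%:~R * a = 2 * (pi * (k.+1%:R * a)) :> R.
Proof. by rewrite pmulrn; ring. Qed.

Let S_gt0 k : 0 < S k.
Proof. by rewrite normr_gt0; have := @sin_irrational R a k.+1%:Z irr isT. Qed.

Let S_le1 k : S k <= 1.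
Proof. exact: sin_max. Qed.

Let cE k : 1 - c k = 2 * S k ^+ 2.
Proof. by rewrite /c angle one_sub_cos2 /S real_normK ?num_real. Qed.

Let c_le1 k : `|c k| <= 1.
Proof. exact: cos_max. Qed.

Let sn_le k : `|sn k| <= 2 * S k.
Proof.
have -> : sn k = 2 * (sin (pi * (k.+1%:R * a)) * cos (pi * (k.+1%:R * a))).
  by rewrite /sn angle mulr_natl mulr2n sinD; ring.
by rewrite normrM normr_nat ler_wpM2l// normrM ler_piMr// cos_max.
Qed.

Let snE k : sn k ^+ 2 = (1 - c k) * (1 + c k).
Proof.
have := cos2Dsin2 (2 * pi * k.+1%:Z%:~R * a); rewrite -/(c k) -/(sn k) => h.
by have -> : sn k ^+ 2 = 1 - c k ^+ 2 by [lra|]; ring.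
Qed.

Let M0 k : 0 <= M k.
Proof. by rewrite mulr_ge0// addr_ge0. Qed.

Let M_le k : M k <= M k / S k.
Proof. by rewrite ler_pdivlMr// ler_piMr. Qed.

Let sM : summable M.
Proof. by apply: (summable_le sMS) => k; rewrite M0 M_le. Qed.

Let w2 k x := 2 * wave (A k) (B k) k x : R.

Let w2_le k x : `|w2 k x| <= M k.
Proof. by rewrite /w2 normrM normr_nat ler_wpM2l// wave_le. Qed.

Let bw2 k : bounded_measurable (w2 k).
Proof.
apply: bounded_measurableM; first exact: bounded_measurable_cst.
exact: bounded_measurable_wave.
Qed.

(** The n-th iterate of the kernel on the Fourier series. *)
Let Gn n x := isum (fun k => c k ^+ n * w2 k x).

Let Gn_le n k x : `|c k ^+ n * w2 k x| <= M k.
Proof.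
rewrite normrM; apply: le_trans (w2_le k x); rewrite ler_piMl//.
by rewrite normrX exprn_ile1.
Qed.

Let bGn_term n k : bounded_measurable (fun x => c k ^+ n * w2 k x).
Proof. by apply: bounded_measurableM => //; exact: bounded_measurable_cst. Qed.

Let bGn n : bounded_measurable (Gn n).
Proof.
exact: (@bounded_measurable_isum _ _ _ M (fun k x => c k ^+ n * w2 k x) sM (bGn_term n) (Gn_le n)).
Qed.

Let integral_Gn n (g : torus R -> R) : (@haar R).-integrable setT (EFin \o g) ->
  \int[@haar R]_x (g x * Gn n x) = isum (fun k => \int[@haar R]_x (g x * (c k ^+ n * w2 k x))).
Proof.
exact: (@Rintegral_isum _ _ _ (@haar R) M (fun k x => c k ^+ n * w2 k x) sM (bGn_term n) (Gn_le n) g).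
Qed.

Let ib (t : torus R -> R) : bounded_measurable t -> (@haar R).-integrable setT (EFin \o t).
Proof. exact: bounded_measurable_integrable. Qed.

Let int_wave al be k : \int[@haar R]_x (f x * wave al be k x) = al * A k + be * B k.
Proof.
have i1 := integrable_bounded_measurable f_int (bounded_measurable_cosk R k.+1%:Z).
have i2 := integrable_bounded_measurable f_int (bounded_measurable_sink R k.+1%:Z).
rewrite /cos_coef /sin_coef -RintegralZl// -[X in _ + X]RintegralZl// -RintegralD//; last 2 first.
- exact: (integrableZl measurableT _ i1).
- exact: (integrableZl measurableT _ i2).
by apply: eq_Rintegral => x _; rewrite /wave; ring.
Qed.

Let mean_wave (al be : R) k : mean (wave al be k) = 0.
Proof. exact: (mean_cohomologous inv (cohomologous_wave irr al be k)). Qed.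

Let mean_waveM (al be al' be' : R) k j : mean (fun x => wave al be k x * wave al' be' j x) =
  if k == j then (al * al' + be * be') / 2 else 0.
Proof. exact: (mean_cohomologous inv (cohomologous_waveM irr al be al' be' k j)). Qed.

Let G0E x : Gn 0 x = isum (w2^~ x).
Proof. by congr isum; apply/funext => k; rewrite expr0 mul1r. Qed.

Let remainder x := f x - mean f - Gn 0 x.

Let i_remainder : (@haar R).-integrable setT (EFin \o remainder).
Proof.
have ic := ib (@bounded_measurable_cst _ (torus R) R (mean f)).
exact: (integrableB measurableT (integrableB measurableT f_int ic) (ib (bGn 0))).
Qed.

Let int_remainder (t : torus R -> R) : bounded_measurable t ->
  \int[@haar R]_x (remainder x * t x) = \int[@haar R]_x (f x * t x) - mean f * mean t -
    isum (fun k => \int[@haar R]_x (t x * w2 k x)).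
Proof.
move=> bt; have i1 := integrable_bounded_measurable f_int bt.
have i2 : (@haar R).-integrable setT (EFin \o (fun x => mean f * t x)).
  exact: (integrableZl measurableT _ (ib bt)).
have i3 : (@haar R).-integrable setT (EFin \o (fun x => t x * Gn 0 x)).
  by apply: ib; exact: bounded_measurableM.
have -> : isum (fun k => \int[@haar R]_x (t x * w2 k x)) = \int[@haar R]_x (t x * Gn 0 x).
  rewrite integral_Gn; last exact: ib.
  by congr isum; apply/funext => k; apply: eq_Rintegral => x _; rewrite expr0 mul1r.
rewrite /mean -RintegralZl//; last exact: ib.
rewrite -RintegralB// -RintegralB//.
  by apply: eq_Rintegral => x _; rewrite /remainder /mean; ring.
exact: (integrableB measurableT i1 i2).
Qed.

Let remainder_wave al be i : \int[@haar R]_x (remainder x * wave al be i x) = 0.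
Proof.
rewrite int_remainder; last exact: bounded_measurable_wave.
rewrite int_wave mean_wave mulr0 subr0.
have -> : (fun k => \int[@haar R]_x (wave al be i x * w2 k x)) =
    fun k => if k == i then al * A i + be * B i else 0.
  apply/funext => k.
  transitivity (2 * mean (fun x => wave al be i x * wave (A k) (B k) k x)).
    rewrite /mean -RintegralZl//; first by apply: eq_Rintegral => x _; rewrite /w2; ring.
    by apply: ib; apply: bounded_measurableM; exact: bounded_measurable_wave.
  by rewrite mean_waveM eq_sym; case: eqP => [->|_]; [field|rewrite mulr0].
by rewrite isum_single subrr.
Qed.

Let remainder_1 : \int[@haar R]_x (remainder x * 1) = 0.
Proof.
rewrite (int_remainder (bounded_measurable_cst _ _)).
have -> : mean (fun=> 1 : R) = 1 :> R.
  by rewrite /mean Rintegral_cst// mul1r [X in fine X](_ : _ = 1%E)//; exact: haar_setT.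
have -> : \int[@haar R]_x (f x * 1) = mean f by apply: eq_Rintegral => x _; rewrite mulr1.
rewrite mulr1 subrr sub0r (_ : (fun k => _) = fun=> 0) ?isum0 ?oppr0//.
apply/funext => k; transitivity (2 * mean (wave (A k) (B k) k)); last by rewrite mean_wave mulr0.
rewrite /mean -RintegralZl//; last exact/ib/bounded_measurable_wave.
by apply: eq_Rintegral => x _; rewrite mul1r.
Qed.

(** The difference of both sides is integrable and has zero Fourier coefficients. *)
Lemma fourier_expansion : exists2 N : set (torus R), measurable N /\ @haar R N = 0%E &
  forall x, ~ N x -> f x - mean f = isum (fun k => 2 * wave (A k) (B k) k x).
Proof.
have [| |N mN HN] := @fourier_uniqueness R remainder i_remainder.
- case=> [[|i]|i].
  + by rewrite -remainder_1; apply: eq_Rintegral => x _; rewrite cosk0.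
  + by rewrite -(remainder_wave 1 0 i); apply: eq_Rintegral => x _; rewrite /wave mul1r mul0r addr0.
  + rewrite -(remainder_wave 1 0 i); apply: eq_Rintegral => x _; rewrite /wave mul1r mul0r addr0.
    by rewrite /cosk NegzE intrN mulrN mulNr cosN.
- case=> [[|i]|i].
  + transitivity (\int[@haar R]_x (cst 0 x : R)); last by rewrite Rintegral_cst// mul0r.
    by apply: eq_Rintegral => x _; rewrite sink0 mulr0.
  + by rewrite -(remainder_wave 0 1 i); apply: eq_Rintegral => x _; rewrite /wave mul1r mul0r add0r.
  + rewrite -(remainder_wave 0 (-1) i); apply: eq_Rintegral => x _; rewrite /wave mulN1r mul0r add0r.
    by rewrite /sink NegzE intrN mulrN mulNr sinN.
exists N => // x Nx; have := HN x Nx; rewrite /remainder G0E => /eqP.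
by rewrite subr_eq0 => /eqP.
Qed.

Let kernel_Gn n x : K (Gn n) x = Gn n.+1 x.
Proof.
apply/esym/isumE.
have -> : psum (fun k => c k ^+ n.+1 * w2 k x) =
    fun j => (psum (fun k => c k ^+ n * w2 k (Defs.rot a x)) j + psum (fun k => c k ^+ n * w2 k (Defs.rot (- a) x)) j) / 2.
  apply/funext => j; rewrite /psum -big_split mulr_suml; apply: eq_bigr => k _ /=.
  have := kernel_wave a (A k) (B k) k x; rewrite -/(c k) /walk_kernel /w2 exprSr => h.
  rewrite (_ : c k ^+ n * c k * _ = 2 * c k ^+ n * (c k * wave (A k) (B k) k x)); last by ring.
  by rewrite -h; field.
apply: cvgMl; apply: cvgD; exact: majorized_cvg sM (Gn_le n ^~ _).
Qed.

(** The kernel is a mean of two rotations, and it preserves the Haar measure. *)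
Let haar_rot (N : set (torus R)) b : b = a \/ b = - a -> measurable N -> @haar R N = 0%E ->
  @haar R (Defs.rot b @^-1` N) = 0%E.
Proof.
move=> bE mN N0; have mrN b' : measurable (Defs.rot b' @^-1` N).
  by rewrite -[X in measurable X]setTI; exact: measurable_rot.
have int1 (E : set (torus R)) : measurable E -> (mean (\1_E : torus R -> R))%:E = @haar R E.
  by move=> mE; rewrite /mean /Rintegral integral_indic// setIT fineK// fin_num_measure.
have bN := bounded_measurable_indic R mN; have bK := bounded_measurable_walk_kernel a bN.
have := inv bN; have -> : mean (\1_N : torus R -> R) = 0.
  by apply: EFin_inj; rewrite int1.
move=> KN; apply/eqP; rewrite eq_le measure_ge0 andbT -int1// lee_fin.
have : 2^-1 * mean (\1_(Defs.rot b @^-1` N) : torus R -> R) <= mean (K (\1_N : torus R -> R)).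
  rewrite /mean -RintegralZl//; last exact/ib/bounded_measurable_indic.
  apply: le_Rintegral => //; [|exact: ib|].
    apply: ib; apply: bounded_measurableM; [exact: bounded_measurable_cst|exact: bounded_measurable_indic].
  move=> x _; rewrite /walk_kernel !indicE mulrC ler_pM2r//.
  have E b' : (x \in Defs.rot b' @^-1` N) = (Defs.rot b' x \in N) by apply/idP/idP => /set_mem h; apply/mem_set.
  by case: bE => ->; rewrite E; [rewrite lerDl|rewrite lerDr]; case: (_ \in N).
by rewrite KN pmulr_rle0.
Qed.

Let iterK n x := iter n K (fun y => f y - mean f) x.

(** The expansion holds off a null set, and the iterates of the kernel visit its
preimages by rotations, which are null sets too. *)
Let iterK_ae n : exists2 N : set (torus R), measurable N /\ @haar R N = 0%E &
  forall x, ~ N x -> iterK n x = Gn n x.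
Proof.
elim: n => [|n [N [mN N0] HN]].
  have [N mN HN] := fourier_expansion; exists N => // x Nx.
  by rewrite G0E -HN.
exists ((Defs.rot a @^-1` N) `|` (Defs.rot (- a) @^-1` N)).
  have mr b : measurable (Defs.rot b @^-1` N).
    by rewrite -[X in measurable X]setTI; exact: measurable_rot.
  split; first exact: measurableU.
  apply/eqP; rewrite eq_le measure_ge0 andbT (le_trans (measureU2 _ _ _))//.
  have h1 := haar_rot (or_introl erefl) mN N0; have h2 := haar_rot (or_intror erefl) mN N0.
  rewrite -[leRHS]adde0; apply: leeD; rewrite le_eqVlt; apply/orP; left; apply/eqP.
    exact: h1.
  exact: h2.
by move=> x /not_orP[n1 n2]; rewrite -kernel_Gn /walk_kernel -!HN.
Qed.

Let mf : measurable_fun setT f.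
Proof. by apply/measurable_EFinP; exact: measurable_int f_int. Qed.

Let measurable_iterK n : measurable_fun setT (iterK n).
Proof.
elim: n => [|n IH]; first exact: measurable_funB.
rewrite /iterK /= /walk_kernel; apply: measurable_funM => //.
have mr b : measurable_fun setT (fun x => iterK n (Defs.rot b x)).
  by apply: measurableT_comp => //; exact: measurable_rot.
by apply: measurable_funD; exact: mr.
Qed.

(** The contribution of the frequencies k+1 and -(k+1) to the variance. *)
Definition power k : R := 2 * (A k ^+ 2 + B k ^+ 2).
Local Notation v := power.

Let v_ge0 k : 0 <= v k.
Proof. by rewrite mulr_ge0// addr_ge0 ?sqr_ge0. Qed.

Let v_le k : v k <= M k ^+ 2.
Proof.
rewrite /power /majorant -(real_normK (num_real (A k))) -(real_normK (num_real (B k))).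
have := normr_ge0 (A k); have := normr_ge0 (B k); move: `|A k| `|B k| => p q p0 q0.
have : 0 <= p * q by exact: mulr_ge0. rewrite !expr2; nra.
Qed.

Let Q := isum (fun k => M k / S k).

Let MS_le k : M k / S k <= Q.
Proof.
apply: le_trans (psum_le_isum k.+1 sMS); rewrite psumS lerDr.
by apply: sumr_ge0 => i _; exact: sMS.1.
Qed.

Let svS : summable (fun k => v k / S k ^+ 2).
Proof.
have Q0 : 0 <= Q by apply: le_trans (sMS.1 0%N) (MS_le 0%N).
apply: (summable_le (summableZ Q0 sMS)) => k; rewrite divr_ge0 ?exprn_ge0 ?(ltW (S_gt0 k))//=.
apply: (@le_trans _ _ ((M k / S k) ^+ 2)).
  by rewrite expr_div_n ler_pM2r ?invr_gt0 ?exprn_gt0.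
by rewrite expr2 ler_wpM2r// ?MS_le//; exact: sMS.1.
Qed.

Let v_leS k : v k <= v k / S k ^+ 2.
Proof. by rewrite ler_pdivlMr ?exprn_gt0// ler_piMr// exprn_ile1// ltW. Qed.

Let autocovE n : autocov a f n = isum (fun k => v k * c k ^+ n).
Proof.
have [N [mN N0] HN] := iterK_ae n.
rewrite /autocov /mean (@Rintegral_ae_eq _ _ _ _ _ (fun x => f x * Gn n x) N)//; last 3 first.
- by apply: measurable_funM => //; exact: measurable_iterK.
- by apply: measurable_funM => //; exact: (bGn n).1.
- by move=> x Nx; rewrite -/(mean f) -HN.
rewrite integral_Gn//; congr isum; apply/funext => k.
transitivity (2 * c k ^+ n * \int[@haar R]_x (f x * wave (A k) (B k) k x)).
  rewrite -RintegralZl//; last exact/(integrable_bounded_measurable f_int)/bounded_measurable_wave.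
  by apply: eq_Rintegral => x _; rewrite /w2; ring.
by rewrite int_wave /power; ring.
Qed.

Let variance : mean (fun x => (f x - mean f) ^+ 2) = isum v.
Proof.
have [N [mN N0] HN] := iterK_ae 0.
have m1 : measurable_fun setT (fun x => f x - mean f) by exact: measurable_funB.
rewrite /mean (@Rintegral_ae_eq _ _ _ _ _ (fun x => (f x - mean f) * Gn 0 x) N)//; last 3 first.
- exact: measurable_funX.
- by apply: measurable_funM => //; exact: (bGn 0).1.
- by move=> x Nx; rewrite expr2 -HN.
have ic := ib (@bounded_measurable_cst _ (torus R) R (mean f)).
have im : (@haar R).-integrable setT (EFin \o (fun x => f x - mean f)).
  exact: (integrableB measurableT f_int ic).
rewrite integral_Gn//; congr isum; apply/funext => k.
have bw := bounded_measurable_wave (A k) (B k) k.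
have i1 := integrable_bounded_measurable f_int bw.
transitivity (2 * (\int[@haar R]_x (f x * wave (A k) (B k) k x) - mean f * mean (wave (A k) (B k) k))).
  rewrite [in RHS]/mean -[X in _ - X]RintegralZl//; last exact: ib.
  rewrite -RintegralB//; last exact: (integrableZl measurableT _ (ib bw)).
  rewrite -RintegralZl//; last first.
    exact: (integrableB measurableT i1 (integrableZl measurableT _ (ib bw))).
  by apply: eq_Rintegral => x _; rewrite /w2 expr0 /mean; ring.
by rewrite mean_wave int_wave /power; ring.
Qed.

Let cneq k : 1 - c k != 0.
Proof. by rewrite cE mulf_neq0// expf_neq0// gt_eqF. Qed.

Let dominated_term n k : `|v k * ((c k - c k ^+ n.+1) / (1 - c k))| <= v k / S k ^+ 2.
Proof.
rewrite normrM ger0_norm// ler_wpM2l// normrM normfV [`|1 - _|]ger0_norm; last first.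
  by rewrite cE mulr_ge0// sqr_ge0.
rewrite cE invfM mulrA ler_piMl ?invr_ge0 ?sqr_ge0//.
rewrite ler_pdivrMr// mul1r (le_trans (ler_normB _ _))//.
have : `|c k ^+ n.+1| <= 1 by rewrite normrX exprn_ile1.
by have := c_le1 k; lra.
Qed.

Let c_lt1 k : `|c k| < 1.
Proof.
have h1 : c k < 1 by rewrite -subr_gt0 cE mulr_gt0// exprn_gt0.
suff h2 : -1 < c k by rewrite ltr_norml h1 h2.
rewrite lt_neqAle; apply/andP; split; last exact: cos_geN1.
apply/eqP => h; have := @sin_irrational R a (k.+1 * 2)%:Z irr isT.
move/eqP; apply; have := snE k; rewrite -h subrr mulr0 => /eqP.
rewrite sqrf_eq0 => /eqP; rewrite /sn angle => <-; congr sin.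
by rewrite PoszM intrM pmulrn; ring.
Qed.

(** By Parseval's identity the autocovariance of order n is the sum of v_k c_k^n;
the geometric sums over n are dominated by 1 / S_k^2, as 1 - c_k = 2 S_k^2. *)
Lemma autocov_sum_cvg :
  autocov_sum a f @ \oo --> isum (fun k => v k * (c k / (1 - c k))).
Proof.
have E n : autocov_sum a f n.+1 = isum (fun k => v k * ((c k - c k ^+ n.+1) / (1 - c k))).
  rewrite /autocov_sum; elim: n => [|n IH].
    rewrite big_geq// (_ : (fun k => _) = fun=> 0) ?isum0//.
    by apply/funext => k; rewrite expr1 subrr mul0r mulr0.
  rewrite big_nat_recr//= IH autocovE.
  rewrite -[X in _ + X]mul1r -(isum_lin _ svS (dominated_term n) svS); last first.
    move=> k; rewrite normrM ger0_norm//; apply: le_trans (v_leS k).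
    by rewrite ler_piMr// normrX exprn_ile1.
  congr isum; apply/funext => k; rewrite mul1r -mulrDr; congr (_ * _).
  by rewrite [X in _ = (_ - X) / _]exprS; field; exact: cneq.
rewrite -cvg_shiftS; under eq_fun do rewrite E.
apply: (isum_dominated svS dominated_term) => k.
apply: cvgMr; apply: cvgMl; rewrite -[X in _ --> X]subr0; apply: cvgB; first exact: cvg_cst.
have -> : (fun n => c k ^+ n.+1) = (fun n => c k * c k ^+ n) by apply/funext => n; rewrite exprS.
by rewrite -(mulr0 (c k)); apply: cvgMr; apply: cvg_expr.
Qed.

(** This is v_k cot^2 (pi (k+1) a): the variance of the k-th component of the limit
of the martingale differences. *)
Definition sigma_term k : R := v k * ((1 + c k) / (1 - c k)).

Let sigma_term_ge0 k : 0 <= sigma_term k.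
Proof.
have := c_le1 k; rewrite ler_norml => /andP[h1 _].
by rewrite mulr_ge0// divr_ge0//; [lra|rewrite cE mulr_ge0// sqr_ge0].
Qed.

Let s_sigma : summable sigma_term.
Proof.
apply: (summable_le svS) => k; rewrite sigma_term_ge0/= ler_wpM2l//.
have := c_le1 k; rewrite ler_norml => /andP[h1 h2].
rewrite cE invfM mulrA ler_piMl ?invr_ge0 ?sqr_ge0//.
by rewrite ler_pdivrMr// mul1r; lra.
Qed.

Lemma asymptotic_varianceE : asymptotic_variance a f = isum sigma_term.
Proof.
rewrite /asymptotic_variance variance (cvg_lim _ autocov_sum_cvg)//.
rewrite -(isum_lin _ svS _ svS); last 2 first.
- by move=> k; rewrite ger0_norm// v_leS.
- move=> k; rewrite normrM ger0_norm// ler_wpM2l// normrM normfV [`|1 - _|]ger0_norm; last first.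
    by rewrite cE mulr_ge0// sqr_ge0.
  rewrite cE invfM mulrA ler_piMl ?invr_ge0 ?sqr_ge0//.
  by rewrite ler_pdivrMr// mul1r (le_trans (c_le1 k))// ler1n.
congr isum; apply/funext => k; rewrite /sigma_term; field; exact: cneq.
Qed.

Lemma isum_sigma_ge0 : 0 <= isum sigma_term.
Proof. by have := psum_le_isum 0 s_sigma; rewrite /psum big_ord0. Qed.

(** All the factors cot^2 are positive, hence all the Fourier coefficients of f
vanish. *)
Lemma degenerate_case : isum sigma_term = 0 ->
  exists2 N : set (torus R), measurable N /\ @haar R N = 0%E & forall x, ~ N x -> f x = mean f.
Proof.
move=> s0; have t0 k : sigma_term k = 0.
  apply/eqP; rewrite eq_le sigma_term_ge0 andbT -s0.
  apply: le_trans (psum_le_isum k.+1 s_sigma); rewrite psumS lerDr.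
  by apply: sumr_ge0 => i _.
have v0 k : v k = 0.
  have /eqP := t0 k; rewrite mulf_eq0 => /orP[/eqP //|].
  rewrite mulf_eq0 invr_eq0 (negbTE (cneq k)) orbF => /eqP h.
  by have := c_lt1 k; rewrite ltr_norml => /andP[h1 _]; lra.
have AB k : A k = 0 /\ B k = 0.
  have /eqP := v0 k; rewrite mulf_eq0 pnatr_eq0/= paddr_eq0 ?sqr_ge0//.
  by rewrite !sqrf_eq0 => /andP[/eqP -> /eqP ->].
have [N mN HN] := fourier_expansion; exists N => // x Nx.
apply/eqP; rewrite -subr_eq0 HN// (_ : (fun k => _) = fun=> 0) ?isum0//.
by apply/funext => k; have [-> ->] := AB k; rewrite /wave !mul0r addr0 mulr0.
Qed.

(** The Poisson equation f - m(f) = h - K h has the divisors 1 - c_k = 2 S_k^2,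
and its solution need not be bounded, as only 1 / S_k is summable against the
coefficients. The resolvent of K at 1 + 1/(n+1) has the divisors
2 S_k^2 + 1/(n+1), which are at least S_k / sqrt (n+1): its sup norm is of order
sqrt n, and its error in the equation of order 1 / sqrt n. The martingale
differences have the factors sin (2 pi (k+1) a) over these divisors, of order
1 / S_k: they are bounded and converge uniformly to a series whose square is
cohomologous to sigma^2 once it is cut. The series of the resolvent is cut after
J n terms too, which makes h n a trigonometric polynomial. *)
Lemma martingale_approximation : exists (h : nat -> torus R -> R) (C : R) (N : set (torus R)),
  [/\ 0 <= C, forall n, bounded_measurable (h n), measurable N, @haar R N = 0%E &
  [/\ forall n x, ~ N x -> `|f x - mean f - (h n x - K (h n) x)| <= C / Num.sqrt n.+1%:R,
  forall n x, `|h n x| <= C * Num.sqrt n.+1%:R,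
  forall n x, `|(h n (Defs.rot a x) - h n (Defs.rot (- a) x)) / 2| <= C &
  forall eta, 0 < eta -> exists2 u, bounded_measurable u &
    \forall n \near \oo, forall x,
      `|((h n (Defs.rot a x) - h n (Defs.rot (- a) x)) / 2) ^+ 2 + (K u x - u x) - isum sigma_term| <= eta]].
Proof.
have [N [mN N0] HN] := fourier_expansion.
pose q (n : nat) : R := Num.sqrt n.+1%:R.
have q0 n : 0 < q n by rewrite sqrtr_gt0.
have qq n : q n ^+ 2 = n.+1%:R by rewrite sqr_sqrtr.
have /choice[J HJ] : forall n : nat, exists J : nat, (n <= J)%N /\ tail M J <= (q n)^-1.
  move=> n; have /cvgr0Pnorm_le/(_ (q n)^-1) := tail_cvg sM.
  rewrite invr_gt0 q0 => /(_ isT) [J _ HJ].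
  exists (maxn J n); rewrite leq_maxr; split => //.
  by have := HJ (maxn J n) (leq_maxl _ _); rewrite /= ger0_norm ?tail_ge0.
pose den n k : R := 1 + (q n) ^- 2 - c k.
have denE n k : den n k = 2 * S k ^+ 2 + (q n) ^- 2 by rewrite /den -cE; ring.
have den_gt0 n k : 0 < den n k by rewrite denE ltr_pwDl ?mulr_gt0 ?exprn_gt0 ?invr_ge0 ?exprn_ge0 ?(ltW (q0 n)).
(* The inequality of arithmetic and geometric means, for s^2 + r^2 with r = 1/q. *)
have den_ge n k : S k * (q n)^-1 <= den n k.
  rewrite denE -exprVn; have := S_gt0 k; have : 0 < (q n)^-1 by rewrite invr_gt0.
  move: (S k) (q n)^-1 => s r r0 s0; have : 0 <= (s - r) ^+ 2 := sqr_ge0 _.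
  by rewrite !expr2; nra.
have den_ge2 n k : 2 * S k ^+ 2 <= den n k by rewrite denE lerDl invr_ge0 exprn_ge0// ltW.
have Q0 : 0 <= Q by apply: le_trans (sMS.1 0%N) (MS_le 0%N).
pose h n x := psum (fun k => (den n k)^-1 * w2 k x) (J n).
have Kh n x : K (h n) x = psum (fun k => (den n k)^-1 * (c k * w2 k x)) (J n).
  rewrite /walk_kernel /h /psum -big_split mulr_suml; apply: eq_bigr => k _ /=.
  have := kernel_wave a (A k) (B k) k x; rewrite -/(c k) /walk_kernel /w2 => hk.
  by rewrite [c k * _]mulrCA -hk; field; rewrite gt_eqF.
have Dh n x : (h n (Defs.rot a x) - h n (Defs.rot (- a) x)) / 2 =
    psum (fun k => 2 * sn k / den n k * wave (B k) (- A k) k x) (J n).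
  rewrite /h /psum -sumrB mulr_suml; apply: eq_bigr => k _ /=.
  have := wave_difference a (A k) (B k) k x; rewrite -/(sn k) /w2 => hk.
  transitivity (2 / den n k * (sn k * wave (B k) (- A k) k x)); last by field; rewrite gt_eqF.
  by rewrite -hk; field; rewrite gt_eqF.
have psum_abs (F G : nat -> R) m : (forall k, `|F k| <= G k) -> `|psum F m| <= psum G m.
  by move=> FG; apply: le_trans (ler_norm_sum _ _ _) _; apply: ler_sum => k _.
have MQ m : psum (fun k => M k / S k) m <= Q by exact: psum_le_isum.
have psi_le k x : `|wave (B k) (- A k) k x| <= M k / 2.
  by rewrite (le_trans (wave_le _ _ _ _))// normrN /majorant mulrAC mulfV// mul1r addrC.
have snS k : `|2 * sn k| / (2 * S k ^+ 2) <= 2 / S k.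
  rewrite normrM normr_nat.
  apply: (@le_trans _ _ (2 * (2 * S k) / (2 * S k ^+ 2))).
    by rewrite ler_pM2r ?invr_gt0 ?mulr_gt0 ?exprn_gt0// ler_pM2l.
  by rewrite le_eqVlt; apply/orP; left; apply/eqP; field; rewrite gt_eqF.
have D_term (r : R) k x : 2 * S k ^+ 2 <= r -> `|2 * sn k / r * wave (B k) (- A k) k x| <= M k / S k.
  move=> rS; have r0 : 0 < r by apply: lt_le_trans rS; rewrite mulr_gt0// exprn_gt0.
  rewrite normrM (_ : M k / S k = 2 / S k * (M k / 2)); last by field; rewrite gt_eqF.
  apply: ler_pM => //; rewrite normrM normfV (gtr0_norm r0).
  apply: le_trans (snS k); rewrite ler_wpM2l// lef_pV2// posrE mulr_gt0// exprn_gt0//.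
exists h, (Q + 1), N; split => //.
- by rewrite addr_ge0.
- move=> n; apply: bounded_measurable_sum => k; apply: bounded_measurableM => //.
  exact: bounded_measurable_cst.
split.
- move=> n x Nx; rewrite HN//.
  have E : h n x - K (h n) x = psum (w2^~ x) (J n) - psum (fun k => (q n) ^- 2 / den n k * w2 k x) (J n).
    rewrite Kh /h /psum -!sumrB; apply: eq_bigr => k _.
    have -> : w2 k x - q n ^- 2 / den n k * w2 k x = (1 - q n ^- 2 / den n k) * w2 k x by ring.
    have -> : 1 - q n ^- 2 / den n k = (1 - c k) / den n k.
      have dk : den n k != 0 by rewrite gt_eqF.
      by apply: (mulIf dk); rewrite mulrBl mul1r !divfK// /den; ring.
    by rewrite -/(w2 _ _); ring.
  rewrite -[isum (fun k => _)]/(isum (w2^~ x)) E.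
  rewrite (_ : _ - (_ - _) = (isum (w2^~ x) - psum (w2^~ x) (J n)) +
    psum (fun k => (q n) ^- 2 / den n k * w2 k x) (J n)); last by ring.
  rewrite (le_trans (ler_normD _ _))// mulrDl mul1r [leRHS]addrC lerD//.
    by rewrite (le_trans (isum_tail (J n) sM (w2_le^~ x)))//; have [] := HJ n.
  apply: le_trans (psum_abs _ (fun k => (q n)^-1 * (M k / S k)) _ _) _.
    move=> k; rewrite normrM mulrCA mulrC; apply: ler_pM => //.
    rewrite ger0_norm; last by rewrite divr_ge0 ?(ltW (den_gt0 n k))// invr_ge0 sqr_ge0.
    rewrite -exprVn.
    rewrite ler_pdivrMr// expr2 -mulrA ler_pM2l ?invr_gt0//.
    rewrite mulrC ler_pdivlMr// mulrC; exact: den_ge.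
  by rewrite /psum -mulr_sumr mulrC ler_pM2r ?invr_gt0//; exact: MQ.
- move=> n x; apply: le_trans (psum_abs _ (fun k => q n * (M k / S k)) _ _) _.
    move=> k; rewrite normrM mulrCA mulrC; apply: ler_pM => //.
    rewrite normfV (gtr0_norm (den_gt0 n k)) -[q n]invrK -invfM lef_pV2 ?posrE ?mulr_gt0 ?invr_gt0//.
    by rewrite mulrC; exact: den_ge.
  rewrite /psum -mulr_sumr mulrC ler_pM2r//; apply: le_trans (MQ _) _.
  by rewrite lerDl.
- move=> n x; rewrite Dh; apply: le_trans (psum_abs _ (fun k => M k / S k) _ _) _.
    by move=> k; exact: D_term.
  by apply: le_trans (MQ _) _; rewrite lerDl.
move=> eta eta0.
(* W is the limit of the coefficients of the martingale differences; Dm is their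
limit cut at m. *)
pose W k : R := 2 * sn k / (2 * S k ^+ 2).
have [eps epsD] : exists eps : R, eps = eta / (3 * (4 * (Q + 1))) by eexists.
have eps0 : 0 < eps by rewrite epsD divr_gt0// !mulr_gt0// ltr_wpDl.
have epsE : eps * (Q + 1) = eta / 12 by rewrite epsD; field; rewrite gt_eqF// ltr_wpDl.
have e3 : 0 < eta / 3 by rewrite divr_gt0.
have [m [tm sm]] : exists m, tail (fun k => M k / S k) m <= eps /\ `|isum sigma_term - psum sigma_term m| <= eta / 3.
  have /cvgr0Pnorm_le/(_ _ eps0) h1 := tail_cvg sMS.
  have /cvgrPdist_le/(_ _ e3) h2 := summable_cvg s_sigma.
  have [m [k1 k2]] := filter_ex (filterI h1 h2).
  by exists m; split => //; rewrite ger0_norm ?tail_ge0 in k1.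
pose Dm x := psum (fun k => W k * wave (B k) (- A k) k x) m.
have [u bu Hu] : cohomologous a (fun x => Dm x ^+ 2) (psum sigma_term m).
  have inner (k : 'I_m) := cohomologous_sum (fun j : 'I_m => W j)
    (fun j : 'I_m => cohomologous_waveM irr (B k) (- A k) (B j) (- A j) k j).
  have := cohomologous_sum (fun k : 'I_m => W k) inner; apply: eq_cohomologous => [x|].
    rewrite expr2 /Dm /psum mulr_suml; apply: eq_bigr => k _.
    rewrite -[RHS]mulrA [X in _ = _ * X]mulr_sumr; congr (_ * _).
    by apply: eq_bigr => j _; rewrite [RHS]mulrCA.
  apply: eq_bigr => k _; rewrite (bigD1 k)//= eqxx big1 ?addr0; last first.
    by move=> j jk; rewrite ifF ?mulr0//; apply: contra_neqF jk => /eqP kj; exact/esym/val_inj.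
  rewrite /W /sigma_term /power -cE.
  have -> : 2 * sn k / (1 - c k) * (2 * sn k / (1 - c k) * ((B k * B k + - A k * - A k) / 2)) =
    (sn k ^+ 2) * (2 * (A k ^+ 2 + B k ^+ 2)) / (1 - c k) ^+ 2 by field; exact: cneq.
  by rewrite snE; field; exact: cneq.
exists u => //.
pose rho n := psum (fun k => `|2 * sn k / den n k - W k| * (M k / 2)) m.
have rho0 : rho n @[n --> \oo] --> 0.
  rewrite (_ : 0 = psum (fun=> 0) m); last by rewrite /psum big1.
  apply: cvg_psum => k; rewrite -(mul0r (M k / 2)); apply: cvgMl.
  rewrite -[X in _ --> X](@normr0 R R); apply: cvg_norm.
  rewrite -(subrr (W k)); apply: cvgB; last exact: cvg_cst.
  apply: cvgMr; apply: cvgV; first by rewrite mulf_neq0// expf_neq0// gt_eqF.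
  have -> : (fun n => den n k) = (fun n => 2 * S k ^+ 2 + (n.+1%:R)^-1).
    by apply/funext => n; rewrite denE qq.
  have : 2 * S k ^+ 2 + (n.+1%:R)^-1 @[n --> \oo] --> 2 * S k ^+ 2 + 0.
    by apply: cvgD; [exact: cvg_cst|exact: cvg_harmonic].
  by rewrite addr0.
have := rho0 => /cvgr0Pnorm_le/(_ _ eps0); apply: filter_app; near=> n => rn x.
have mJ : (m <= J n)%N.
  have [h1 _] := HJ n; apply: leq_trans h1; near: n; exact: nbhs_infty_ge.
rewrite Dh; set Dn := psum _ (J n).
have Dn_le : `|Dn| <= Q.
  by apply: le_trans (psum_abs _ _ _ (fun k => D_term _ k x (den_ge2 n k))) (MQ _).
have Dm_le : `|Dm x| <= Q.
  by apply: le_trans (psum_abs _ _ _ (fun k => D_term _ k x (lexx _))) (MQ _).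
have close : `|Dn - Dm x| <= 2 * eps.
  rewrite -(subrKA (psum (fun k => 2 * sn k / den n k * wave (B k) (- A k) k x) m)).
  rewrite (le_trans (ler_normD _ _))// mulr_natl mulr2n lerD//.
    apply: le_trans (psumB_le mJ (fun k => D_term _ k x (den_ge2 n k))) _.
    by apply: le_trans tm; rewrite lerD2r psum_le_isum.
  apply: le_trans rn; apply: le_trans (ler_norm _); rewrite /psum -sumrB.
  apply: le_trans (ler_norm_sum _ _ _) _; apply: ler_sum => k _.
  by rewrite -mulrBl normrM ler_wpM2l.
have sq : `|Dn ^+ 2 - Dm x ^+ 2| <= 2 * eta / 3.
  rewrite subr_sqr normrM; apply: (@le_trans _ _ (2 * eps * (2 * (Q + 1)))).
    apply: ler_pM => //; rewrite (le_trans (ler_normD _ _))//; lra.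
  have -> : 2 * eps * (2 * (Q + 1)) = 4 * (eps * (Q + 1)) by ring.
  by rewrite epsE; lra.
have -> : Dn ^+ 2 + (K u x - u x) - isum sigma_term =
  (Dn ^+ 2 - Dm x ^+ 2) - (isum sigma_term - psum sigma_term m).
  by have := Hu x; lra.
by rewrite (le_trans (ler_normB _ _))//; lra.
Unshelve. all: by end_near. Qed.

End fourier_expansion.

(** * The moderate deviation principle *)

(** The coefficients are of order k^(-1-eps), against which the inverses of the
divisors are summable. *)
Lemma summable_fourier_divisors (R : realType) (a eps : R) (f : torus R -> R) :
  irrational a -> badly_approximable a -> 0 < eps ->
  (ereal_sup [set (`|k%:~R| `^ (1 + eps) * Normc.normc (fourier_coef f k))%:E
               | k in [set k : int | k != 0%R]] < +oo)%E ->
  summable (fun k => majorant f k / divisor a k).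
Proof.
move=> irr bad eps0; set E := [set _ | _ in _] => Efin.
have [C0 HC0] : exists C0 : R, forall k, k.+1%:R `^ (1 + eps) * Normc.normc (fourier_coef f k.+1%:Z) <= C0.
  have EC k : ((k.+1%:R `^ (1 + eps) * Normc.normc (fourier_coef f k.+1%:Z))%:E <= ereal_sup E)%E.
    apply: ereal_sup_ubound; exists k.+1%:Z => //.
    by rewrite -pmulrn normr_nat.
  case: (ereal_sup E) EC Efin => [r| |] //= EC _; first by exists r => k; rewrite -lee_fin.
  by have := EC 0%N; rewrite leeNy_eq.
have [B B0 HB] := small_divisors irr bad eps0.
have normc_ge (x y : R) : `|x| <= Normc.normc (Complex x y) /\ `|y| <= Normc.normc (Complex x y).
  by rewrite /Normc.normc -!sqrtr_sqr; split; rewrite ler_wsqrtr// ?lerDl ?lerDr sqr_ge0.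
have M_le k : majorant f k <= 4 * C0 * k.+1%:R `^ (- (1 + eps)).
  have p0 : 0 < k.+1%:R `^ (1 + eps) by rewrite powR_gt0 ?ltr0n.
  have := HC0 k; rewrite mulrC -ler_pdivlMr//.
  rewrite -powRN /fourier_coef => h.
  have [h1 h2] := normc_ge (\int[@haar R]_x (f x * cos (2 * pi * k.+1%:Z%:~R * repr x)))
    (- \int[@haar R]_x (f x * sin (2 * pi * k.+1%:Z%:~R * repr x))).
  rewrite normrN in h2; rewrite -/(cos_coef f k) in h1 h; rewrite -/(sin_coef f k) in h2 h.
  rewrite /majorant; move: h h1 h2; rewrite -/(cos_coef f k) -/(sin_coef f k).
  set n := Normc.normc _; set p := _ `^ _; lra.
have S0 k : 0 < divisor a k by rewrite normr_gt0; have := @sin_irrational R a k.+1%:Z irr isT.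
split => [k|]; first by rewrite divr_ge0 ?(ltW (S0 k))// mulr_ge0// addr_ge0.
exists (4 * C0 * B) => n; have C00 : 0 <= 4 * C0.
  rewrite mulr_ge0//; apply: le_trans (HC0 0%N).
  by rewrite mulr_ge0 ?powR_ge0// sqrtr_ge0.
apply: (@le_trans _ _ (4 * C0 * \sum_(1 <= k < n.+1) k%:R `^ (- (1 + eps)) / `|sin (pi * (k%:R * a))|)).
  rewrite big_add1 big_mkord mulr_sumr; apply: ler_sum => k _.
  by rewrite mulrA ler_pM2r ?invr_gt0.
by rewrite ler_wpM2l.
Qed.

Theorem proposition13 (R : realType) (a : R)
  (a01 : 0 <= a <= 1) (a_irr : irrational a) (a_bad : badly_approximable a)
  (f : torus R -> R)
  (f_int : (@haar R).-integrable setT (EFin \o f))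
  (f_hat : exists2 eps : R, 0 < eps &
    (ereal_sup [set (`|k%:~R| `^ (1 + eps) * Normc.normc (fourier_coef f k))%:E
               | k in [set k : int | k != 0%R]] < +oo)%E)
  (d : measure_display) (Omega : measurableType d) (P : probability Omega R)
  (xi : int -> {RV P >-> torus R})
  (xi_chain : stationary_markov_chain (walk_kernel a) (@haar R) xi) :
  cvgn (autocov_sum a f) /\
  exists sigma : R, [/\ 0 <= sigma, sigma ^+ 2 = asymptotic_variance a f &
    forall a_ : nat -> R, (forall n, 0 < a_ n) ->
      a_ n @[n --> \oo] --> 0 -> n%:R * a_ n @[n --> \oo] --> +oo ->
      MDP P (partial_sum_process f xi) a_ (rate sigma)].
Proof.
have [eps eps0 sup_fin] := f_hat.
have sMS := summable_fourier_divisors a_irr a_bad eps0 sup_fin.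
have inv := haar_kernel_invariant xi_chain.
split; first by apply/cvg_ex; eexists; exact: (autocov_sum_cvg a_irr inv f_int sMS).
have s0 := isum_sigma_ge0 a_irr sMS.
pose sigma := Num.sqrt (isum (sigma_term a f)).
have sigma2 : sigma ^+ 2 = isum (sigma_term a f) by rewrite sqr_sqrtr.
exists sigma; split.
- exact: sqrtr_ge0.
- by rewrite sigma2 (asymptotic_varianceE a_irr inv f_int sMS).
move=> a_ a_gt0 a_0 na_y.
have mf : measurable_fun setT f by apply/measurable_EFinP; exact: measurable_int f_int.
have [sE|sn] := eqVneq sigma 0.
  rewrite sE; have s00 : isum (sigma_term a f) = 0 by rewrite -sigma2 sE expr0n.
  have [N [mN N0] HN] := degenerate_case a_irr inv f_int sMS s00.
  have mi (i : int) : measurable (xi i @^-1` N).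
    by rewrite -[X in measurable X]setTI; exact: measurable_funPT.
  apply: (@MDP_degenerate _ _ _ _ _ _ a_gt0 _ (\bigcup_(i : nat) (xi i%:Z @^-1` N))).
  - by move=> n G; exact: measurable_partial_sum_process.
  - exact: bigcupT_measurable.
  - suff : P.-negligible (\bigcup_(i : nat) (xi i%:Z @^-1` N)).
      by move=> /negligibleP; apply; exact: bigcupT_measurable.
    apply: negligible_bigcup => i; apply/negligibleP => //.
    by have := xi_chain.1 i%:Z N mN; rewrite N0.
  - move=> n w t nw t01; rewrite /= /step_fun in_itv/= t01.
    rewrite big1 ?mulr0// => i _; apply/eqP; rewrite subr_eq0; apply/eqP.
    by apply: HN => Nx; apply: nw; exists i.
have sigma_gt0 : 0 < sigma by rewrite lt_neqAle eq_sym sn sqrtr_ge0.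
have [h [C [N [C0 bh mN N0 [approx h_le D_le D_sqr]]]]] :=
  martingale_approximation a_irr inv f_int sMS.
apply: (@chain_MDP _ _ _ _ a xi xi_chain f h C sigma N) => //.
by rewrite sigma2.
Qed.
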